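(* There is an absolute constant $c>0$ such that for every positive integer $n$ there exist a Jordan curve $K$, a set $V$ of $n$ points on $K$, and a set of pseudolines $\mathcal L$ such that every pair of points of $V$ lies on a pseudoline of $\mathcal L$, the curve pseudo-visibility graph $G_{\mathcal L}(K,V)$ does not contain $K_{3,3}$ as a subgraph, and $G_{\mathcal L}(K,V)$ has at least $c\, n\,\alpha(n)$ edges, where $\alpha(n)$ is the inverse Ackermann function.
   Context: A set of pseudolines is a family of unbounded simple curves in the plane (each homeomorphic to a line, going to infinity at both ends) such that any two of them intersect in exactly one point, at which they cross. Given a Jordan curve $K$, a set $V$ of points on $K$ and a set of pseudolines $\mathcal L$ such that every pair of distinct points of $V$ lies on a pseudoline of $\mathcal L$ (which is then unique), the curve pseudo-visibility graph $G_{\mathcal L}(K,V)$ has vertex set $V$, and two points $u,v\in V$ are adjacent iff the part of the pseudoline of $\mathcal L$ through $u$ and $v$ lying between $u$ and $v$ is disjoint from the exterior of $K$. *)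

(* Defs.v *)
From Stdlib Require Import Reals Lra Lia List Arith.
Open Scope R_scope.

Definition pt := (R * R)%type.

Definition dist2 (p q : pt) : R :=
  sqrt ((fst p - fst q) ^ 2 + (snd p - snd q) ^ 2).
Definition norm2 (p : pt) : R := dist2 p (0, 0).

Definition cont (f : R -> pt) : Prop :=
  forall x eps, 0 < eps -> exists d, 0 < d /\
    forall y, Rabs (y - x) < d -> dist2 (f y) (f x) < eps.

Definition image (f : R -> pt) (p : pt) : Prop := exists t, f t = p.

(* x and y can be joined by a path avoiding the set S
   (a path p on [0,1]; p is taken continuous on all of R, which is
   no restriction since any path on [0,1] extends by constants). *)
Definition joinable (S : pt -> Prop) (x y : pt) : Prop :=
  exists p : R -> pt, cont p /\ p 0 = x /\ p 1 = y /\
    forall r, 0 <= r <= 1 -> ~ S (p r).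

Definition jordan_param (f : R -> pt) : Prop :=
  cont f /\ (forall t, f (t + 1) = f t) /\
  (forall s t, 0 <= s < 1 -> 0 <= t < 1 -> f s = f t -> s = t).

(* exterior of a closed bounded set K: the unbounded component of its
   complement, i.e. points off K that can be joined, avoiding K, to points of
   arbitrarily large norm *)
Definition exterior (K : pt -> Prop) (x : pt) : Prop :=
  ~ K x /\ forall M, exists y, M < norm2 y /\ joinable K x y.

Definition pseudoline (g : R -> pt) : Prop :=
  cont g /\ (forall s t, g s = g t -> s = t) /\
  (forall M, exists T, forall t, T < Rabs t -> M < norm2 (g t)).

(* g2 crosses g1 at the (unique) common point g1 s = g2 t: the two rays of g2
   emanating from that point lie in different components of the complement
   of g1 *)
Definition crosses_at (g1 g2 : R -> pt) (t : R) : Prop :=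
  ~ joinable (image g1) (g2 (t - 1)) (g2 (t + 1)).

Definition pseudoline_family {I : Type} (L : I -> R -> pt) : Prop :=
  (forall i, pseudoline (L i)) /\
  forall i j, i <> j ->
    (exists p, image (L i) p /\ image (L j) p /\
       forall q, image (L i) q -> image (L j) q -> q = p) /\
    (forall s t, L i s = L j t -> crosses_at (L i) (L j) t).

Definition pvis_adj {I : Type} (f : R -> pt) (L : I -> R -> pt)
  (V : nat -> pt) (a b : nat) : Prop :=
  a <> b /\
  exists i s t, L i s = V a /\ L i t = V b /\
    forall r, Rmin s t <= r <= Rmax s t -> ~ exterior (image f) (L i r).

Fixpoint ack (m : nat) : nat -> nat :=
  match m with
  | O => S
  | S m' => fix ackm (n : nat) : nat :=
      match n with
      | O => ack m' 1
      | S n' => ack m' (ackm n')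
      end
  end.

Fixpoint inv_ack_search (fuel k n : nat) : nat :=
  match fuel with
  | O => k
  | S f => if Nat.leb n (ack k k) then k else inv_ack_search f (S k) n
  end.

(* since ack k k > k, the search always succeeds within n steps *)
Definition inv_ack (n : nat) : nat := inv_ack_search n 0 n.

(* Main.v *)
Require Import Defs.
From Stdlib Require Import Reals List.
From Stdlib Require Import Lra Lia Arith Sorted Classical ProofIrrelevance IndefiniteDescription.
Open Scope R_scope.
Import ListNotations.

(** The visibility graph is bipartite between "symbols" and "columns", each
    symbol seeing only columns to its right, and any two symbols share at most
    one column.  Dense graphs of this kind are built by the recursion behind
    Davenport-Schinzel sequences of order 3.  Some columns are left virtual
    ("spots") and are seen by [F] symbols each; next to every spot [q] one puts
    a tiny, steep copy of a smaller configuration having [F] spots, lets [q]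
    become a column, and lets the [j]-th symbol of [q] see the [j]-th spot of
    the copy.  Every symbol then sees one column more, while the number of
    columns grows so slowly that it stays below the number of symbols.

    All pseudolines are straight lines, apart from a small bend far away that
    makes parallel ones cross.  The curve is the image of a circle under three
    shears of the plane, so that its exterior is explicit: two vertical ones
    produce a floor reaching up to just below the visible segments, and a
    horizontal one between them bends the floor over the vertices, which hides
    from each vertex everything above its cone of visible segments. *)

(** * Configurations *)

(** The obstacle is to hide the wrong pairs. Next to a spot [q], a symbol [g] of [q] has to see its
    own spot of the copy and no other one. Spots above its own lie outside the cone of [g], but
    those below it can only be hidden by the floor, somewhere in front of the copy where the line of
    [g] is the lowest among the lines of all symbols of [q]. Hence each of these lines must reach
    their lower envelope ([sel]), for the heights at which the spots of the copy occur. The copy is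
    sheared so that abscissas turn into heights and slopes grow by [/ k]. The symbol coming from the
    larger configuration is then the flattest one at its new spot and is given the lowest height,
    which is how the envelope condition reproduces itself. *)

Definition ev (P : R -> Prop) : Prop :=
  exists k0, 0 < k0 /\ forall k, 0 < k < k0 -> P k.

Lemma ev_impl (P Q : R -> Prop) :
  ev P -> (forall k, 0 < k -> P k -> Q k) -> ev Q.
Proof. intros [k0 [H0 H]] HPQ. exists k0. split; auto. intros k Hk. apply HPQ; [lra | auto]. Qed.

Lemma ev_all (P : R -> Prop) : (forall k, 0 < k -> P k) -> ev P.
Proof. intros H. exists 1. split; [lra | intros k Hk; apply H; lra]. Qed.

Lemma ev_and (P Q : R -> Prop) : ev P -> ev Q -> ev (fun k => P k /\ Q k).
Proof.
  intros [k0 [H0 H]] [k1 [H1 H']]. exists (Rmin k0 k1). split.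
  - now apply Rmin_glb_lt.
  - intros k Hk. pose proof (Rmin_l k0 k1). pose proof (Rmin_r k0 k1).
    split; [apply H | apply H']; lra.
Qed.

(** A configuration has finitely many vertices and almost all its conditions are strict
    inequalities, so one small [k] serves all of them. *)
Lemma ev_list {A : Type} (l : list A) (P : A -> R -> Prop) :
  (forall x, In x l -> ev (P x)) -> ev (fun k => forall x, In x l -> P x k).
Proof.
  induction l as [|a l IH]; intros H.
  - apply ev_all. intros k _ x [].
  - apply ev_impl with (fun k => P a k /\ forall x, In x l -> P x k).
    + apply ev_and; [apply H; now left | apply IH; intros; apply H; now right].
    + intros k _ [Ha Hl] x [<-|Hx]; auto.
Qed.

Lemma ev_imp (A : Prop) (P : R -> Prop) : (A -> ev P) -> ev (fun k => A -> P k).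
Proof.
  intros H. destruct (classic A) as [a|na].
  - apply ev_impl with P; auto.
  - apply ev_all. intros; contradiction.
Qed.

Lemma ev_ex (P : R -> Prop) : ev P -> exists k, 0 < k /\ P k.
Proof. intros [k0 [H0 H]]. exists (k0 / 2). split; [lra | apply H; lra]. Qed.

Lemma ev_cont (f : R -> R) : continuity_pt f 0 -> 0 < f 0 -> ev (fun k => 0 < f k).
Proof.
  intros Hc Hf. destruct (Hc (f 0) Hf) as [d [Hd H]].
  exists d. split; auto. intros k Hk.
  assert (Hx : Rabs (f k - f 0) < f 0).
  { apply (H k). split.
    - split; [exact I | lra].
    - unfold dist; simpl; unfold Rdist. rewrite Rabs_right; lra. }
  apply Rabs_def2 in Hx. lra.
Qed.

(** [det a d p] is positive iff [p] lies strictly below the line through [a]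
    and [d], when [a] is to the left of [d]. *)
Definition det (a d p : pt) : R :=
  (snd d - snd a) * (fst p - fst a) - (snd p - snd a) * (fst d - fst a).

Definition slope (a d : pt) : R := (snd d - snd a) / (fst d - fst a).

(** [spots] are virtual columns: their edges are not counted, and each of them
    is turned into a genuine column when a smaller configuration is inserted
    next to it. *)
Record config := Config {
  vtx : Type;
  place : vtx -> pt;
  syms : list vtx;
  cols : list vtx;
  spots : list (vtx * list vtx);
  adj : vtx -> vtx -> Prop }.

Arguments place {c}. Arguments adj {c}.

Definition xc {c : config} (v : vtx c) : R := fst (place v).
Definition spotpts (c : config) : list (vtx c) := map fst (spots c).
Definition targets (c : config) : list (vtx c) := cols c ++ spotpts c.
Definition verts (c : config) : list (vtx c) := syms c ++ targets c.

Definition under (c : config) (p : pt) : Prop :=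
  forall a d : vtx c, adj a d -> xc a <= fst p <= xc d -> 0 < det (place a) (place d) p.

(** A symbol [a] and a column [d] to its right can be hidden from each other by
    the floor between them, or because [d] is above the cone of [a], or because
    [a] is above the cone of [d]. *)
Definition blocked_inner (c : config) (a d : vtx c) : Prop :=
  exists p, xc a < fst p < xc d /\ det (place a) (place d) p < 0 /\ under c p.

Definition blocked_sym (c : config) (a d : vtx c) : Prop :=
  forall d', adj a d' -> 0 < det (place a) (place d) (place d').

Definition blocked_col (c : config) (a d : vtx c) : Prop :=
  forall b, adj b d -> 0 < det (place a) (place d) (place b).

(** Lines of slopes [s] through points at heights [x] of a vertical segment all
    reach the lower envelope of these lines on the left of the segment. *)
Definition sel (l : list (R * R)) : Prop :=
  forall x s, In (x, s) l -> exists t, 0 < t /\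
    forall x' s', In (x', s') l -> x - t * s <= x' - t * s'.

(** A spot cannot be blocked by its own cone, since it is going to be seen by
    further symbols lying above that cone. *)
Record valid (xs : list R) (c : config) : Prop := {
  v_nodup : NoDup (verts c);
  v_xinj : forall u v : vtx c, In u (verts c) -> In v (verts c) -> xc u = xc v -> u = v;
  v_adj : forall a d : vtx c, adj a d -> In a (syms c) /\ In d (targets c) /\ xc a < xc d;
  v_below : forall a d v : vtx c, adj a d -> In v (verts c) -> xc a < xc v < xc d ->
    0 < det (place a) (place d) (place v);
  v_block : forall a d : vtx c, In a (syms c) -> In d (targets c) -> xc a < xc d -> ~ adj a d ->
    blocked_inner c a d \/ blocked_sym c a d \/ (In d (cols c) /\ blocked_col c a d);
  v_k22 : forall a b d d' : vtx c, adj a d -> adj a d' -> adj b d -> adj b d' -> a = b \/ d = d';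
  v_sorted : StronglySorted (fun s t => xc (fst s) < xc (fst t)) (spots c);
  v_spot : forall q gs, In (q, gs) (spots c) ->
    length gs = length xs /\ NoDup gs /\ (forall g, In g gs <-> adj g q) /\
    sel (combine xs (map (fun g => slope (place g) (place q)) gs));
  v_last : forall a q d : vtx c, In q (spotpts c) -> adj a q -> adj a d -> d = q \/ xc d < xc q }.

Definition has_edges (c : config) (e : nat) : Prop :=
  exists l : list (vtx c * vtx c), NoDup l /\ length l = e /\
    forall a d, In (a, d) l -> adj a d /\ In d (cols c).

(** There are [P] spots with [m] symbols each, and [s] symbols, [c] columns and [e] edges in all.
    The heights [xs] are arbitrary because the recursive step prescribes them: they are the
    abscissas of the spots of another configuration. *)
Definition good (m P s c e : nat) : Prop :=
  forall xs, length xs = m -> StronglySorted Rlt xs ->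
  exists G, valid xs G /\ length (spots G) = P /\ length (syms G) = s /\
    length (cols G) = c /\ has_edges G e.

Lemma disj_sym_target xs (c : config) (w : vtx c) :
  valid xs c -> In w (syms c) -> In w (targets c) -> False.
Proof.
  intros V Hs Ht. pose proof (v_nodup _ _ V) as N. unfold verts in N.
  apply in_split in Hs. destruct Hs as [l1 [l2 E]]. rewrite E in N.
  rewrite <- app_assoc in N. simpl in N. apply NoDup_remove_2 in N.
  apply N. rewrite !in_app_iff. auto.
Qed.

Ltac contin := unfold det; simpl; reg.

(** The conditions on a witness are open, except that edges may start or end at
    its abscissa; hence it can be moved slightly to the right. *)
Lemma blocked_inner_generic xs (c : config) (a d : vtx c) :
  valid xs c -> blocked_inner c a d ->
  exists p, xc a < fst p < xc d /\ det (place a) (place d) p < 0 /\ under c p /\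
    forall v, In v (verts c) -> xc v <> fst p.
Proof.
  intros V (p & Hp & Hd & Hu).
  assert (E : ev (fun h =>
    (0 < xc d - (fst p + h) /\ 0 < - det (place a) (place d) (fst p + h, snd p)) /\
    (forall a', In a' (syms c) -> forall d', In d' (targets c) -> adj a' d' ->
       xc a' <= fst p + h <= xc d' -> 0 < det (place a') (place d') (fst p + h, snd p)) /\
    (forall v, In v (verts c) -> xc v <> fst p + h))).
  { repeat apply ev_and.
    - apply (ev_cont (fun h => xc d - (fst p + h))); [reg | lra].
    - apply (ev_cont (fun h => - det (place a) (place d) (fst p + h, snd p))); [contin|].
      unfold det in *; simpl. lra.
    - apply ev_list; intros a' Ha'. apply ev_list; intros d' Hd'.
      apply ev_imp; intros HE.
      destruct (Rlt_le_dec (fst p) (xc a')) as [H|H].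
      { apply ev_impl with (fun h => 0 < xc a' - (fst p + h)).
        - apply (ev_cont (fun h => xc a' - (fst p + h))); [reg | lra].
        - intros h _ H1 H2. lra. }
      destruct (Rlt_le_dec (xc d') (fst p)) as [H'|H'].
      { apply ev_all. intros h Hh H2. lra. }
      apply ev_impl with (fun h => 0 < det (place a') (place d') (fst p + h, snd p)); [|auto].
      apply (ev_cont (fun h => det (place a') (place d') (fst p + h, snd p))); [contin|].
      specialize (Hu a' d' HE (conj H H')). unfold det in *; simpl. rewrite Rplus_0_r. exact Hu.
    - apply ev_list; intros v Hv.
      destruct (Rlt_le_dec (fst p) (xc v)) as [H|H].
      + apply ev_impl with (fun h => 0 < xc v - (fst p + h)); [|intros; lra].
        apply (ev_cont (fun h => xc v - (fst p + h))); [reg | lra].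
      + apply ev_all. intros; lra. }
  apply ev_ex in E. destruct E as (h & Hh & (H1 & H2) & H3 & H4).
  exists (fst p + h, snd p). simpl. repeat split; auto; try lra.
  intros a' d' HE Hx. destruct (v_adj _ _ V a' d' HE) as (? & ? & _). now apply H3.
Qed.

(** Just to the right of [a], a point slightly above the line to [d] is still under the edges of
    [a], which are strictly steeper, and under the edges passing over [a]. The assumptions are
    separate conditions of [valid], so that the lemma applies to a configuration whose validity is
    still being proved. *)
Lemma blocked_low (c : config) (a d : vtx c) :
  (forall u v : vtx c, In u (verts c) -> In v (verts c) -> xc u = xc v -> u = v) ->
  (forall a d : vtx c, adj a d -> In a (syms c) /\ In d (targets c) /\ xc a < xc d) ->
  (forall a d v : vtx c, adj a d -> In v (verts c) -> xc a < xc v < xc d ->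
    0 < det (place a) (place d) (place v)) ->
  In a (syms c) -> xc a < xc d ->
  (forall d', adj a d' -> det (place a) (place d) (place d') < 0) ->
  blocked_inner c a d.
Proof.
  intros Hinj Hadj Hbel Ha Hx Hd.
  set (s := slope (place a) (place d)).
  (* This point is [h * h] above the line from [a] to [d], whereas the edges of [a] rise above that
     line by a fixed multiple of [h]. *)
  set (p := fun h => (xc a + h, snd (place a) + h * (s + h))).
  assert (Hs : snd (place d) - snd (place a) = s * (xc d - xc a)).
  { unfold s, slope, xc in *. field. lra. }
  assert (E : ev (fun h => 0 < xc d - (xc a + h) /\
    (forall a', In a' (syms c) -> forall d', In d' (targets c) -> adj a' d' ->
       xc a' <= fst (p h) <= xc d' -> 0 < det (place a') (place d') (p h)))).
  { apply ev_and.
    - apply (ev_cont (fun h => xc d - (xc a + h))); [reg | lra].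
    - apply ev_list; intros a' Ha'. apply ev_list; intros d' Hd'.
      apply ev_imp; intros HE.
      assert (Hva : In a (verts c)) by (apply in_or_app; now left).
      assert (Hva' : In a' (verts c)) by (apply in_or_app; now left).
      destruct (Rtotal_order (xc a') (xc a)) as [H|[H|H]].
      + destruct (Rle_lt_dec (xc d') (xc a)) as [H'|H'].
        * apply ev_all. intros h Hh H2. simpl in H2. lra.
        * apply ev_impl with (fun h => 0 < det (place a') (place d') (p h)); [|auto].
          apply (ev_cont (fun h => det (place a') (place d') (p h))).
          -- unfold p. contin.
          -- specialize (Hbel a' d' a HE Hva (conj H H')).
             unfold p, det, xc in *; simpl. rewrite Rmult_0_l, !Rplus_0_r. exact Hbel.
      + apply Hinj in H; auto. subst a'. specialize (Hd d' HE).
        destruct (Hadj a d' HE) as (_ & _ & Hlt).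
        apply ev_impl with (fun h => 0 < (snd (place d') - snd (place a)) - (s + h) * (xc d' - xc a)).
        * apply (ev_cont (fun h => (snd (place d') - snd (place a)) - (s + h) * (xc d' - xc a))); [reg|].
          unfold det in Hd. fold (xc d') (xc d) (xc a) in Hd. rewrite Hs in Hd.
          rewrite Rplus_0_r.
          apply Rmult_lt_reg_l with (xc d - xc a); lra.
        * intros h Hh H2 _. unfold det, p; simpl. fold (xc d') (xc d) (xc a).
          replace ((snd (place d') - snd (place a)) * (xc a + h - xc a) -
             (snd (place a) + h * (s + h) - snd (place a)) * (xc d' - xc a))
            with (h * ((snd (place d') - snd (place a)) - (s + h) * (xc d' - xc a))) by ring.
          now apply Rmult_lt_0_compat.
      + apply ev_impl with (fun h => 0 < xc a' - (xc a + h)).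
        * apply (ev_cont (fun h => xc a' - (xc a + h))); [reg | lra].
        * intros h _ H1 H2. simpl in H2. lra. }
  apply ev_ex in E. destruct E as (h & Hh & H1 & H2).
  exists (p h). split; [simpl; lra|]. split.
  - unfold det, p; simpl. fold (xc d) (xc a). rewrite Hs.
    replace (s * (xc d - xc a) * (xc a + h - xc a) -
      (snd (place a) + h * (s + h) - snd (place a)) * (xc d - xc a))
      with (- (h * h * (xc d - xc a))) by ring.
    assert (0 < h * h * (xc d - xc a)) by (repeat apply Rmult_lt_0_compat; lra). lra.
  - intros a' d' HE Hr. destruct (Hadj a' d' HE) as (? & ? & _). now apply H2.
Qed.

(** * The recursive step *)

Lemma combine_functional {A B : Type} (l : list A) (l' : list B) a b b' :
  NoDup l -> In (a, b) (combine l l') -> In (a, b') (combine l l') -> b = b'.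
Proof.
  revert l'. induction l as [|x l IH]; intros [|y l'] N; simpl; try tauto.
  inversion N; subst. intros [E|H] [E'|H'].
  - congruence.
  - inversion E; subst. apply in_combine_l in H'. tauto.
  - inversion E'; subst. apply in_combine_l in H. tauto.
  - eauto.
Qed.

Lemma combine_swap {A B : Type} (l : list A) (l' : list B) a b :
  In (a, b) (combine l l') -> In (b, a) (combine l' l).
Proof.
  revert l'. induction l as [|x l IH]; intros [|y l']; simpl; try tauto.
  intros [E|H]; [left; congruence | auto].
Qed.

Lemma combine_total {A B : Type} (l : list A) (l' : list B) a :
  length l = length l' -> In a l -> exists b, In (a, b) (combine l l').
Proof.
  revert l'. induction l as [|x l IH]; intros [|y l'] E; simpl in *; try easy.
  intros [<-|H]; [eauto|]. destruct (IH l') with (2 := H) as [b Hb]; [lia | eauto].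
Qed.

Lemma combine_map {A B C D : Type} (f : A -> C) (g : B -> D) (l : list A) (l' : list B) a b :
  In (a, b) (combine l l') -> In (f a, g b) (combine (map f l) (map g l')).
Proof.
  revert l'. induction l as [|x l IH]; intros [|y l']; simpl; try tauto.
  intros [E|H]; [left; congruence | auto].
Qed.

Lemma combine_map_inv {A B C : Type} (f : B -> C) (l : list A) (l' : list B) a c :
  In (a, c) (combine l (map f l')) -> exists b, In (a, b) (combine l l') /\ c = f b.
Proof.
  revert l'. induction l as [|x l IH]; intros [|y l']; simpl; try tauto.
  intros [E|H].
  - inversion E; subst. eauto.
  - destruct (IH l' H) as (b & ? & ?). eauto.
Qed.

(** Counterpart of [ev_list] for parameters that have to be large. *)
Lemma bound_list {A : Type} (l : list A) (P : A -> R -> Prop) :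
  (forall x, In x l -> exists b, forall t, b < t -> P x t) ->
  exists b, forall t, b < t -> forall x, In x l -> P x t.
Proof.
  induction l as [|a l IH]; intros H.
  - exists 0. intros t _ x [].
  - destruct (H a) as [b Hb]; [now left|].
    destruct IH as [b' Hb']; [intros; apply H; now right|].
    exists (Rmax b b'). intros t Ht x [<-|Hx].
    + apply Hb. pose proof (Rmax_l b b'). lra.
    + apply Hb'; auto. pose proof (Rmax_r b b'). lra.
Qed.

Lemma NoDup_list_prod {A B : Type} (l : list A) (l' : list B) :
  NoDup l -> NoDup l' -> NoDup (list_prod l l').
Proof.
  intros N N'. induction N as [|a l Ha N IH]; simpl; [constructor|].
  apply NoDup_app; auto.
  - apply NoDup_map_NoDup_ForallPairs; auto. intros x y _ _ E. congruence.
  - intros [x y] Hi. apply in_map_iff in Hi. destruct Hi as (b & E & _). inversion E; subst.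
    rewrite in_prod_iff. tauto.
Qed.

Lemma NoDup_map_inj {A B : Type} (f : A -> B) (l : list A) :
  (forall x y, f x = f y -> x = y) -> NoDup l -> NoDup (map f l).
Proof. intros Hf. apply NoDup_map_NoDup_ForallPairs. intros x y _ _. apply Hf. Qed.

Lemma sorted_app {A : Type} (R : A -> A -> Prop) l l' :
  StronglySorted R l -> StronglySorted R l' ->
  (forall x y, In x l -> In y l' -> R x y) -> StronglySorted R (l ++ l').
Proof.
  intros S S' Hc. induction S as [|a l S IH F]; simpl; auto.
  constructor.
  - apply IH. intros; apply Hc; simpl; auto.
  - apply Forall_app. split; auto. apply Forall_forall. intros y Hy. apply Hc; simpl; auto.
Qed.

Lemma sorted_flat_map {A B : Type} (R : A -> A -> Prop) (R' : B -> B -> Prop) (f : A -> list B) l :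
  StronglySorted R l -> (forall x, In x l -> StronglySorted R' (f x)) ->
  (forall x y, In x l -> In y l -> R x y -> forall u v, In u (f x) -> In v (f y) -> R' u v) ->
  StronglySorted R' (flat_map f l).
Proof.
  induction 1 as [|a l S IH F]; intros Hf Hc; simpl; [constructor|].
  rewrite Forall_forall in F. apply sorted_app.
  - apply Hf; simpl; auto.
  - apply IH.
    + intros x Hx. apply Hf; simpl; auto.
    + intros x y Hx Hy. apply Hc; simpl; auto.
  - intros u v Hu Hv. apply in_flat_map in Hv. destruct Hv as (y & Hy & Hv).
    apply (Hc a y); simpl; auto.
Qed.

Lemma sorted_combine_map {A B C : Type} (R : B -> B -> Prop) (R' : C -> C -> Prop)
  (f : A * B -> C) (l : list A) (l' : list B) :
  StronglySorted R l' -> (forall a a' b b', R b b' -> R' (f (a, b)) (f (a', b'))) ->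
  StronglySorted R' (map f (combine l l')).
Proof.
  intros S Hf. revert l. induction S as [|b l' S IH F]; intros [|a l]; simpl; try constructor.
  - apply IH.
  - rewrite Forall_forall in *. intros c Hc. apply in_map_iff in Hc.
    destruct Hc as ([a' b'] & <- & Hi). apply in_combine_r in Hi. auto.
Qed.

(** Close to the segment heights decide, so the new line is the lowest. At the distances already
    selected, raising all old slopes by a large [B] puts the old lines below the new one and does
    not affect comparisons among them. The bound is uniform in [s0], since in the recursive step
    [s0] varies together with [B]. *)
Lemma sel_cons (x0 M : R) (l : list (R * R)) : 0 <= M -> sel l ->
  (forall x s, In (x, s) l -> x0 < x) ->
  exists B0, forall B, B0 < B -> forall s0, Rabs s0 <= M ->
    sel ((x0, s0) :: map (fun p => (fst p, snd p + B)) l).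
Proof.
  intros HM S Hx.
  assert (Hb : exists b, forall B, b < B -> forall p, In p l -> forall s0, Rabs s0 <= M ->
    exists t, 0 < t /\ fst p - t * (snd p + B) <= x0 - t * s0 /\
      forall x' s', In (x', s') l -> fst p - t * (snd p + B) <= x' - t * (s' + B)).
  { apply bound_list. intros [x s] Hp. destruct (S x s Hp) as (t & Ht & Hs).
    (* Beyond this value the line of [(x, s + B)] is below that of [(x0, s0)] at distance [t], for
       every [s0] bounded by [M]. *)
    exists ((x - x0) / t - s + M). intros B HB s0 Hs0. exists t. split; auto. split.
    - simpl. assert (E : x - x0 = t * ((x - x0) / t)) by (field; lra).
      assert (s0 <= M) by (apply Rabs_def2b in Hs0 || pose proof (Rle_abs s0); lra).
      assert (t * ((x - x0) / t) <= t * (B + s - s0)) by (apply Rmult_le_compat_l; lra).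
      lra.
    - intros x' s' Hi. simpl. specialize (Hs x' s' Hi). lra. }
  destruct Hb as [b Hb]. exists b. intros B HB s0 Hs0 x s [E|Hi].
  - inversion E; subst.
    assert (Ht : ev (fun t => forall p, In p l -> 0 < fst p - x - t * (snd p + B - s))).
    { apply ev_list. intros [x' s'] Hp. simpl.
      apply (ev_cont (fun t => x' - x - t * (s' + B - s))); [reg|].
      specialize (Hx x' s' Hp). lra. }
    apply ev_ex in Ht. destruct Ht as (t & Ht & Hall). exists t. split; auto.
    intros x' s' [E'|Hi']; [inversion E'; subst; lra|].
    apply in_map_iff in Hi'. destruct Hi' as ([y r] & E' & Hi'). simpl in E'. inversion E'; subst.
    specialize (Hall _ Hi'). simpl in Hall. lra.
  - apply in_map_iff in Hi. destruct Hi as ([y r] & E' & Hi). simpl in E'. inversion E'; subst.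
    destruct (Hb B HB _ Hi s0 Hs0) as (t & Ht & H1 & H2). exists t. split; auto.
    intros x' s' [E|Hi']; [inversion E; subst; exact H1|].
    apply in_map_iff in Hi'. destruct Hi' as ([z w] & E & Hi'). simpl in E. inversion E; subst.
    now apply H2.
Qed.

Definition ccont (f : R -> pt) : Prop :=
  continuity_pt (fun k => fst (f k)) 0 /\ continuity_pt (fun k => snd (f k)) 0.

Lemma det_cont (a d p : R -> pt) :
  ccont a -> ccont d -> ccont p -> continuity_pt (fun k => det (a k) (d k) (p k)) 0.
Proof.
  intros [a1 a2] [d1 d2] [p1 p2]. unfold det.
  apply (continuity_pt_minus
    (fun k => (snd (d k) - snd (a k)) * (fst (p k) - fst (a k)))
    (fun k => (snd (p k) - snd (a k)) * (fst (d k) - fst (a k)))).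
  - apply (continuity_pt_mult (fun k => snd (d k) - snd (a k)) (fun k => fst (p k) - fst (a k)));
    apply (continuity_pt_minus (fun k => _) (fun k => _)); auto.
  - apply (continuity_pt_mult (fun k => snd (p k) - snd (a k)) (fun k => fst (d k) - fst (a k)));
    apply (continuity_pt_minus (fun k => _) (fun k => _)); auto.
Qed.

Lemma ev_det (a d p : R -> pt) :
  ccont a -> ccont d -> ccont p -> 0 < det (a 0) (d 0) (p 0) ->
  ev (fun k => 0 < det (a k) (d k) (p k)).
Proof. intros Ha Hd Hp H. apply (ev_cont (fun k => det (a k) (d k) (p k))); auto. now apply det_cont. Qed.

Lemma ev_det_neg (a d p : R -> pt) :
  ccont a -> ccont d -> ccont p -> det (a 0) (d 0) (p 0) < 0 ->
  ev (fun k => det (a k) (d k) (p k) < 0).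
Proof.
  intros Ha Hd Hp H.
  apply ev_impl with (fun k => 0 < - det (a k) (d k) (p k)); [|intros; lra].
  apply (ev_cont (fun k => - det (a k) (d k) (p k))); [|lra].
  apply (continuity_pt_opp (fun k => det (a k) (d k) (p k))). now apply det_cont.
Qed.

Lemma ev_fst_lt (a b : R -> pt) :
  ccont a -> ccont b -> fst (a 0) < fst (b 0) -> ev (fun k => fst (a k) < fst (b k)).
Proof.
  intros [Ha _] [Hb _] H.
  apply ev_impl with (fun k => 0 < fst (b k) - fst (a k)); [|intros; lra].
  apply (ev_cont (fun k => fst (b k) - fst (a k))); [|lra].
  now apply (continuity_pt_minus (fun k => fst (b k)) (fun k => fst (a k))).
Qed.

Lemma ccont_const (p : pt) : ccont (fun _ => p).
Proof. split; apply continuity_pt_const; intros ? ?; reflexivity. Qed.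

(** The affine copy of a configuration placed to the right of [q]; to first
    order in [k] it is a vertical segment above [q + k (T, H)]. *)
Definition loc (T H k : R) (q p : pt) : pt :=
  (fst q + k * (T + k * fst p), snd q + k * (fst p + H + k * snd p)).

Lemma ccont_loc T H q p : ccont (fun k => loc T H k q p).
Proof. split; simpl; reg. Qed.

Lemma loc_0 T H q p : loc T H 0 q p = q.
Proof. unfold loc. destruct q. simpl. f_equal; ring. Qed.

(** The linear part of [loc] is triangular with both diagonal entries [k * k], hence preserves
    orientation. *)
Lemma det_loc T H k q a d p :
  det (loc T H k q a) (loc T H k q d) (loc T H k q p) = k * k * k * k * det a d p.
Proof. unfold det, loc; simpl. ring. Qed.

Section Step.
Variables (xs : list R) (G L : config) (T H : R).

(** [(w, None)] is the vertex [w] of [G], and [(q, Some p)] the copy of [p] next to [q]; pairs whose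
    [q] is not a spot belong to no list of vertices. *)
Definition svtx : Type := (vtx G * option (vtx L))%type.

Definition spos (k : R) (u : svtx) : pt :=
  match snd u with
  | None => place (fst u)
  | Some p => loc T H k (place (fst u)) (place p)
  end.

Definition matched (q g : vtx G) (p : vtx L) : Prop :=
  exists gs, In (q, gs) (spots G) /\ In (g, p) (combine gs (spotpts L)).

Definition sadj (a d : svtx) : Prop :=
  match snd a, snd d with
  | None, None => adj (fst a) (fst d)
  | None, Some p => matched (fst d) (fst a) p
  | Some s, Some p => fst a = fst d /\ In (fst d) (spotpts G) /\ adj s p
  | Some _, None => False
  end.

Definition glob (w : vtx G) : svtx := (w, None).
Definition copies (l : list (vtx L)) : list svtx := list_prod (spotpts G) (map Some l).

(** Each copied spot keeps the symbols of its copy, and the symbol of [q] matched to it is put in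
    front of them, in accordance with the new lowest height. *)
Definition sspots : list (svtx * list svtx) :=
  flat_map (fun qg =>
    map (fun gp => ((fst qg, Some (fst (snd gp))),
                    glob (fst gp) :: map (fun s => (fst qg, Some s)) (snd (snd gp))))
      (combine (snd qg) (spots L))) (spots G).

(** All targets of [G], its spots included, become columns; the only remaining spots are those of
    the copies. *)
Definition step (k : R) : config :=
  Config svtx (spos k) (map glob (syms G) ++ copies (syms L))
    (map glob (targets G) ++ copies (cols L)) sspots sadj.

Hypothesis VG : valid (map xc (spotpts L)) G.
Hypothesis VL : valid xs L.

(** * Membership and matching in the composed configuration *)

Lemma len_gs q gs : In (q, gs) (spots G) -> length gs = length (spotpts L).
Proof. intros Hq. destruct (v_spot _ _ VG q gs Hq) as (E & _). now rewrite length_map in E. Qed.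

Lemma in_globs w o l : In (w, o) (map glob l) <-> o = None /\ In w l.
Proof.
  rewrite in_map_iff. split.
  - intros (x & E & Hx). inversion E; subst. auto.
  - intros [-> Hw]. now exists w.
Qed.

Lemma in_copies w o l :
  In (w, o) (copies l) <-> exists p, o = Some p /\ In w (spotpts G) /\ In p l.
Proof.
  unfold copies. rewrite in_prod_iff, in_map_iff. split.
  - intros (Hw & p & <- & Hp). eauto.
  - intros (p & -> & Hw & Hp). eauto.
Qed.

Lemma in_sspots q o hs :
  In ((q, o), hs) sspots <-> exists gs g p ss, In (q, gs) (spots G) /\
    In (g, (p, ss)) (combine gs (spots L)) /\ o = Some p /\
    hs = glob g :: map (fun s => (q, Some s)) ss.
Proof.
  unfold sspots. rewrite in_flat_map. split.
  - intros ([q' gs] & Hq & Hm). apply in_map_iff in Hm.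
    destruct Hm as ((g & p & ss) & E & Hi). simpl in *. inversion E; subst.
    exists gs, g, p, ss. auto.
  - intros (gs & g & p & ss & Hq & Hi & -> & ->). exists (q, gs). split; auto.
    apply in_map_iff. exists (g, (p, ss)). auto.
Qed.

Lemma spot_unique (c : config) ys q gs gs' :
  valid ys c -> In (q, gs) (spots c) -> In (q, gs') (spots c) -> gs = gs'.
Proof.
  intros V. pose proof (v_sorted _ _ V) as S. induction S as [|x l S IH F]; simpl; [tauto|].
  rewrite Forall_forall in F.
  intros [->|H1] [E|H2]; auto.
  - congruence.
  - apply F in H2. simpl in H2. lra.
  - subst x. apply F in H1. simpl in H1. lra.
Qed.

Lemma matched_spot q g p : matched q g p ->
  In q (spotpts G) /\ adj g q /\ In p (spotpts L) /\ In g (syms G).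
Proof.
  intros (gs & Hq & Hi). split; [apply in_map_iff; now exists (q, gs)|].
  assert (A : adj g q).
  { destruct (v_spot _ _ VG q gs Hq) as (_ & _ & HE & _). apply HE. now apply in_combine_l in Hi. }
  split; auto. split; [now apply in_combine_r in Hi|]. now apply (v_adj _ _ VG) in A.
Qed.

Lemma nodup_spotpts (c : config) ys : valid ys c -> NoDup (spotpts c).
Proof.
  intros V. pose proof (v_nodup _ _ V) as N. unfold verts, targets in N.
  apply NoDup_app_remove_l in N. now apply NoDup_app_remove_l in N.
Qed.

Lemma matched_fun q g p p' : matched q g p -> matched q g p' -> p = p'.
Proof.
  intros (gs & Hq & Hi) (gs' & Hq' & Hi').
  rewrite <- (spot_unique G _ q gs gs' VG Hq Hq') in Hi'.
  destruct (v_spot _ _ VG q gs Hq) as (_ & N & _). eapply combine_functional; eauto.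
Qed.

Lemma matched_inj q g g' p : matched q g p -> matched q g' p -> g = g'.
Proof.
  intros (gs & Hq & Hi) (gs' & Hq' & Hi').
  rewrite <- (spot_unique G _ q gs gs' VG Hq Hq') in Hi'.
  apply combine_swap in Hi, Hi'. eapply combine_functional; eauto. now apply (nodup_spotpts L xs).
Qed.

Lemma matched_total q g : In q (spotpts G) -> adj g q -> exists p, matched q g p.
Proof.
  intros Hq Hg. apply in_map_iff in Hq. destruct Hq as ([q' gs] & E & Hq). simpl in E. subst q'.
  destruct (v_spot _ _ VG q gs Hq) as (_ & N & HE & _). apply HE in Hg.
  destruct (combine_total gs (spotpts L) g (len_gs q gs Hq) Hg) as [p Hp].
  exists p, gs. auto.
Qed.

Lemma matched_total_r q p : In q (spotpts G) -> In p (spotpts L) -> exists g, matched q g p.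
Proof.
  intros Hq Hp. apply in_map_iff in Hq. destruct Hq as ([q' gs] & E & Hq). simpl in E. subst q'.
  destruct (combine_total (spotpts L) gs p) as [g Hg]; auto.
  - now rewrite (len_gs q gs).
  - exists g, gs. split; auto. now apply combine_swap.
Qed.

Lemma in_sspotpts k w o :
  In (w, o) (spotpts (step k)) <-> exists p, o = Some p /\ In w (spotpts G) /\ In p (spotpts L).
Proof.
  unfold spotpts at 1. rewrite in_map_iff. split.
  - intros ([[w' o'] hs] & E & Hi). simpl in *. inversion E; subst.
    apply in_sspots in Hi. destruct Hi as (gs & g & p & ss & Hq & Hi & -> & _).
    exists p. split; auto. split; [apply in_map_iff; now exists (w, gs)|].
    apply in_combine_r in Hi. apply in_map_iff. now exists (p, ss).
  - intros (p & -> & Hw & Hp). destruct (matched_total_r w p Hw Hp) as (g & gs & Hq & Hi).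
    apply combine_map_inv in Hi. destruct Hi as ([p' ss] & Hi & E). simpl in E. subst p'.
    exists ((w, Some p), glob g :: map (fun s => (w, Some s)) ss). split; auto.
    apply in_sspots. exists gs, g, p, ss. auto.
Qed.

Lemma in_ssyms k w o :
  In (w, o) (syms (step k)) <->
  match o with None => In w (syms G) | Some p => In w (spotpts G) /\ In p (syms L) end.
Proof.
  simpl. rewrite in_app_iff, in_globs, in_copies. destruct o as [p|]; split.
  - intros [[E _]|(p' & E & ? & ?)]; [discriminate|]. inversion E; subst; auto.
  - intros [? ?]. right. eauto.
  - intros [[_ ?]|(p' & E & _)]; [auto|discriminate].
  - auto.
Qed.

Lemma in_scols k w o :
  In (w, o) (cols (step k)) <->
  match o with None => In w (targets G) | Some p => In w (spotpts G) /\ In p (cols L) end.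
Proof.
  simpl. rewrite in_app_iff, in_globs, in_copies. destruct o as [p|]; split.
  - intros [[E _]|(p' & E & ? & ?)]; [discriminate|]. inversion E; subst; auto.
  - intros [? ?]. right. eauto.
  - intros [[_ ?]|(p' & E & _)]; [auto|discriminate].
  - auto.
Qed.

Lemma in_stargets k w o :
  In (w, o) (targets (step k)) <->
  match o with None => In w (targets G) | Some p => In w (spotpts G) /\ In p (targets L) end.
Proof.
  assert (Eq : In (w, o) (targets (step k)) <-> In (w, o) (cols (step k)) \/ In (w, o) (spotpts (step k)))
    by apply in_app_iff.
  rewrite Eq, in_scols, in_sspotpts.
  destruct o as [p|]; [unfold targets; rewrite in_app_iff|]; split.
  - intros [[? ?]|(p' & E & ? & ?)]; [auto|]. inversion E; subst; auto.
  - intros (? & [?|?]); [auto|]. right. eauto.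
  - intros [?|(p' & E & _)]; [auto|discriminate].
  - auto.
Qed.

Lemma in_sverts k w o :
  In (w, o) (verts (step k)) <->
  match o with None => In w (verts G) | Some p => In w (spotpts G) /\ In p (verts L) end.
Proof.
  assert (Eq : In (w, o) (verts (step k)) <-> In (w, o) (syms (step k)) \/ In (w, o) (targets (step k)))
    by apply in_app_iff.
  rewrite Eq, in_ssyms, in_stargets.
  destruct o as [p|]; unfold verts; rewrite in_app_iff; tauto.
Qed.

Lemma sadj_in k a d : sadj a d -> In a (syms (step k)) /\ In d (targets (step k)).
Proof.
  destruct a as [g oa], d as [r od]. rewrite in_ssyms, in_stargets. unfold sadj; simpl.
  destruct oa as [s|], od as [p|]; [| tauto | |].
  - intros (-> & Hr & A). apply (v_adj _ _ VL) in A. tauto.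
  - intros M. apply matched_spot in M. unfold targets. rewrite in_app_iff. tauto.
  - intros A. apply (v_adj _ _ VG) in A. tauto.
Qed.

Lemma ccont_spos u : ccont (fun k => spos k u).
Proof. destruct u as [w [p|]]; [apply ccont_loc | apply (ccont_const (place w))]. Qed.

Lemma spos_0 u : spos 0 u = place (fst u).
Proof. destruct u as [w [p|]]; [apply loc_0 | reflexivity]. Qed.

(** At [k = 0] every copy collapses to its spot, so strict relations in [G] survive for small
    [k]. *)
Lemma far_lt u v : xc (fst u) < xc (fst v) -> ev (fun k => fst (spos k u) < fst (spos k v)).
Proof.
  intros Hlt. apply ev_fst_lt; try apply ccont_spos. now rewrite !spos_0.
Qed.

Lemma far_det a d v : 0 < det (place (fst a)) (place (fst d)) (place (fst v)) ->
  ev (fun k => 0 < det (spos k a) (spos k d) (spos k v)).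
Proof.
  intros Hd. apply ev_det; try apply ccont_spos. now rewrite !spos_0.
Qed.

(** * First-order geometry of a copy *)

Hypothesis T_pos : 0 < T.

Lemma near_lt w p : ev (fun k => xc w < fst (spos k (w, Some p))).
Proof.
  apply ev_impl with (fun k => 0 < T + k * xc p).
  - apply (ev_cont (fun k => T + k * xc p)); [reg | lra].
  - intros k Hk Hp. simpl. fold (xc w) (xc p).
    assert (0 < k * (T + k * xc p)) by now apply Rmult_lt_0_compat. lra.
Qed.

Lemma loc_lt k q p p' : 0 < k ->
  (fst (loc T H k q p) < fst (loc T H k q p') <-> fst p < fst p').
Proof.
  intros Hk. simpl.
  assert (E : fst q + k * (T + k * fst p') - (fst q + k * (T + k * fst p))
    = k * k * (fst p' - fst p)) by ring.
  assert (0 < k * k) by now apply Rmult_lt_0_compat.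
  split; intros Hlt.
  - apply Rmult_lt_reg_l with (k * k); lra.
  - assert (0 < k * k * (fst p' - fst p)) by (apply Rmult_lt_0_compat; lra). lra.
Qed.

(** To first order a copy is a vertical segment on which abscissas have become heights: seen from
    the left, the point of smaller abscissa is the lower one. *)
Lemma det_near (g q p p' : pt) : fst g < fst q -> fst p' < fst p ->
  ev (fun k => 0 < det g (loc T H k q p) (loc T H k q p')).
Proof.
  intros Hg Hp.
  set (f := fun k => (fst p - fst p') * (fst (loc T H k q p) - fst g)
    + k * ((snd p - snd p') * (fst (loc T H k q p) - fst g)
           - (snd (loc T H k q p) - snd g) * (fst p - fst p'))).
  apply ev_impl with (fun k => 0 < f k).
  - apply ev_cont; [unfold f; simpl; reg|]. unfold f. rewrite loc_0.
    rewrite Rmult_0_l, Rplus_0_r. apply Rmult_lt_0_compat; lra.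
  - intros k Hk Hf.
    replace (det _ _ _) with (k * f k) by (unfold f, det, loc; simpl; ring).
    now apply Rmult_lt_0_compat.
Qed.

Lemma slope_mult (g q : pt) : fst g < fst q -> snd q - snd g = slope g q * (fst q - fst g).
Proof. intros. unfold slope. field. lra. Qed.

(** In units of [k], the line from [g] through [q] passes the copy at height [T * slope g q] above
    [q]; a large [H] lifts the whole copy over it. *)
Lemma det_spot (g q p : pt) : fst g < fst q -> T * slope g q < fst p + H ->
  ev (fun k => 0 < det g (loc T H k q p) q).
Proof.
  intros Hg Hp.
  set (f := fun k => (fst p + H + k * snd p) * (fst q - fst g) - (snd q - snd g) * (T + k * fst p)).
  apply ev_impl with (fun k => 0 < f k).
  - apply ev_cont; [unfold f; reg|]. unfold f. rewrite (slope_mult g q Hg).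
    replace (_ - _) with ((fst p + H - T * slope g q) * (fst q - fst g)) by ring.
    apply Rmult_lt_0_compat; lra.
  - intros k Hk Hf.
    replace (det _ _ _) with (k * f k) by (unfold f, det, loc; simpl; ring).
    now apply Rmult_lt_0_compat.
Qed.

(** A point of the gap between [q] and the copy placed next to it, on the
    first-order scale of that copy. *)
Definition gap (t m k : R) (q : pt) : pt := (fst q + k * (T - t), snd q + k * (H + m)).

Lemma ccont_gap t m q : ccont (fun k => gap t m k q).
Proof. split; simpl; reg. Qed.

Lemma gap_0 t m q : gap t m 0 q = q.
Proof. unfold gap. destruct q; simpl. f_equal; ring. Qed.

(** In units of [k] and relative to the level [H], the line from [g] to the copy of [p] has height
    [fst p - t * slope g q] at distance [t] before the copy, and the point of the gap has height
    [m]. *)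
Lemma det_gap (g q p : pt) (t m : R) : fst g < fst q ->
  exists f, continuity_pt f 0 /\ f 0 = (fst q - fst g) * (fst p - t * slope g q - m) /\ forall k, det g (loc T H k q p) (gap t m k q) = k * f k.
Proof.
  intros Hg.
  exists (fun k => (snd q - snd g) * (T - t - (T + k * fst p))
    + (fst q - fst g) * (fst p + H + k * snd p - (H + m))
    + k * ((fst p + H + k * snd p) * (T - t) - (H + m) * (T + k * fst p))).
  repeat split.
  - reg.
  - rewrite (slope_mult g q Hg). ring.
  - intros k. unfold det, loc, gap; simpl. ring.
Qed.

Lemma sverts_xc w o k : In (w, o) (verts (step k)) -> In w (verts G).
Proof.
  rewrite in_sverts. destruct o; [|auto]. intros [Hw _].
  unfold verts, targets. rewrite !in_app_iff. auto.
Qed.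

Lemma spot_not_sym q : In q (spotpts G) -> In q (syms G) -> False.
Proof.
  intros Hq Hs. apply (disj_sym_target _ _ q VG Hs). unfold targets. apply in_or_app; now right.
Qed.

Lemma verts_cases u v : In u (verts G) -> In v (verts G) ->
  xc u < xc v \/ u = v \/ xc v < xc u.
Proof.
  intros Hu Hv. destruct (Rtotal_order (xc u) (xc v)) as [?|[E|?]]; auto.
  right; left. now apply (v_xinj _ _ VG).
Qed.

Lemma sym_vert (c : config) (a : vtx c) : In a (syms c) -> In a (verts c).
Proof. intros. apply in_or_app; now left. Qed.
Lemma target_vert (c : config) (a : vtx c) : In a (targets c) -> In a (verts c).
Proof. intros. apply in_or_app; now right. Qed.
Lemma spot_vert (c : config) (a : vtx c) : In a (spotpts c) -> In a (verts c).
Proof. intros. apply target_vert. apply in_or_app; now right. Qed.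

Lemma step_xinj : ev (fun k => forall u, In u (verts (step 0)) -> forall v, In v (verts (step 0)) ->
  fst (spos k u) = fst (spos k v) -> u = v).
Proof.
  apply ev_list; intros [w o] Hu. apply ev_list; intros [w' o'] Hv.
  destruct (verts_cases w w') as [Hlt|[->|Hlt]]; try (eapply sverts_xc; eassumption).
  - eapply ev_impl; [apply (far_lt (w, o) (w', o')); exact Hlt|]. intros k _ H1 H2. lra.
  - apply in_sverts in Hu, Hv. destruct o as [p|], o' as [p'|]; auto.
    + apply ev_all. intros k Hk E. f_equal. f_equal. apply (v_xinj _ _ VL); try tauto.
      unfold spos in E; simpl in E.
      destruct (Rtotal_order (xc p) (xc p')) as [Hlt|[?|Hlt]]; auto; exfalso.
      * apply (loc_lt k (place w') (place p) (place p') Hk) in Hlt. simpl in Hlt. lra.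
      * apply (loc_lt k (place w') (place p') (place p) Hk) in Hlt. simpl in Hlt. lra.
    + eapply ev_impl; [apply (near_lt w' p)|]. intros k _ H1 H2. unfold spos, loc, xc in *; simpl in *. exfalso; lra.
    + eapply ev_impl; [apply (near_lt w' p')|]. intros k _ H1 H2. unfold spos, loc, xc in *; simpl in *. exfalso; lra.
    + apply ev_all. auto.
  - eapply ev_impl; [apply (far_lt (w', o') (w, o)); exact Hlt|]. intros k _ H1 H2. lra.
Qed.

(** Every edge starting at a symbol of [G] is a small perturbation of an edge of [G]. *)
Lemma sadj_shadow g r o : sadj (g, None) (r, o) -> adj g r.
Proof. destruct o; simpl; auto. intros M. now apply matched_spot in M. Qed.

Lemma step_adj_lt : ev (fun k => forall u, In u (syms (step 0)) -> forall v, In v (targets (step 0)) ->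
  sadj u v -> fst (spos k u) < fst (spos k v)).
Proof.
  apply ev_list; intros [g [s|]] Hu; apply ev_list; intros [r o] Hv; apply ev_imp; intros A.
  - destruct o as [p|]; [|now destruct A]. destruct A as (E & _ & A). simpl in E, A; subst r.
    apply (v_adj _ _ VL) in A. apply ev_all. intros k Hk. apply loc_lt; tauto.
  - apply far_lt. simpl. apply sadj_shadow in A. now apply (v_adj _ _ VG) in A.
Qed.

Hypothesis H_big : forall q g p, In q (spotpts G) -> adj g q -> In p (verts L) ->
  T * slope (place g) (place q) < xc p + H.

(** The new case is an edge from [G] into a copy: it passes over the spot [r] by [H_big], and over
    the points of the copy on the left of its end because these are lower. *)
Lemma step_below : ev (fun k =>
  forall a, In a (syms (step 0)) -> forall d, In d (targets (step 0)) ->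
  forall v, In v (verts (step 0)) -> sadj a d ->
  fst (spos k a) < fst (spos k v) < fst (spos k d) ->
  0 < det (spos k a) (spos k d) (spos k v)).
Proof.
  apply ev_list; intros [g oa] Ha; apply ev_list; intros [r od] Hd; apply ev_list; intros [w ov] Hv.
  apply ev_imp; intros A.
  assert (Vw := sverts_xc _ _ _ Hv).
  assert (Vr := sverts_xc _ _ _ (target_vert _ _ Hd)).
  assert (Vg := sverts_xc _ _ _ (sym_vert _ _ Ha)).
  assert (C1 : xc w < xc g -> ev (fun k => fst (spos k (w, ov)) < fst (spos k (g, oa))))
    by (intros; now apply (far_lt (w, ov) (g, oa))).
  assert (C2 : xc r < xc w -> ev (fun k => fst (spos k (r, od)) < fst (spos k (w, ov))))
    by (intros; now apply (far_lt (r, od) (w, ov))).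
  apply in_sverts in Hv.
  destruct oa as [s|].
  - destruct od as [p|]; [|now destruct A]. destruct A as (E & Hr & A). simpl in E, A, Hr; subst g.
    destruct (verts_cases w r) as [Hlt|[->|Hlt]]; auto.
    + eapply ev_impl; [now apply C1|]. intros k _ H1 H2. lra.
    + destruct ov as [v|].
      * apply ev_all. intros k Hk [H1 H2].
        apply (loc_lt k (place r) (place s) (place v) Hk) in H1.
        apply (loc_lt k (place r) (place v) (place p) Hk) in H2.
        change (0 < det (loc T H k (place r) (place s)) (loc T H k (place r) (place p))
          (loc T H k (place r) (place v))).
        rewrite det_loc. apply Rmult_lt_0_compat; [repeat apply Rmult_lt_0_compat; auto|].
        apply (v_below _ _ VL); tauto.
      * eapply ev_impl; [apply (near_lt r s)|]. intros k _ H1 H2. unfold spos, loc, xc in *; simpl in *. lra.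
    + eapply ev_impl; [now apply C2|]. intros k _ H1 H2. lra.
  - pose proof (sadj_shadow _ _ _ A) as B. destruct (v_adj _ _ VG _ _ B) as (Sg & Tr & Hgr).
    destruct (verts_cases w r) as [Hlt|[->|Hlt]]; auto.
    + destruct (verts_cases w g) as [Hlt'|[->|Hlt']]; auto.
      * eapply ev_impl; [now apply C1|]. intros k _ H1 H2. lra.
      * destruct ov as [v|].
        -- exfalso. now apply (spot_not_sym g).
        -- apply ev_all. intros k _ H1. lra.
      * eapply ev_impl; [apply (far_det (g, None) (r, od) (w, ov))|auto].
        now apply (v_below _ _ VG).
    + destruct od as [p|].
      * simpl in A. destruct (matched_spot _ _ _ A) as (Hr & _ & Hp & _).
        destruct ov as [v|].
        -- destruct (Rlt_le_dec (xc v) (xc p)) as [Hlt|Hle].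
           ++ eapply ev_impl; [apply (det_near (place g) (place r) (place p) (place v)); auto|]. auto.
           ++ apply ev_all. intros k Hk [_ H2].
              apply (loc_lt k (place r) (place v) (place p) Hk) in H2. unfold xc in Hle. lra.
        -- eapply ev_impl; [apply (det_spot (place g) (place r) (place p)); auto|auto].
           apply H_big; auto. now apply spot_vert.
      * destruct ov as [v|].
        -- eapply ev_impl; [apply (near_lt r v)|]. intros k _ H1 H2. unfold spos, loc, xc in *; simpl in *. lra.
        -- apply ev_all. intros k _ H1. lra.
    + eapply ev_impl; [now apply C2|]. intros k _ H1 H2. lra.
Qed.

Lemma ev_under (p : R -> pt) :
  (forall a d, In a (syms (step 0)) -> In d (targets (step 0)) -> sadj a d ->
     ev (fun k => fst (spos k a) <= fst (p k) <= fst (spos k d) ->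
                  0 < det (spos k a) (spos k d) (p k))) ->
  ev (fun k => under (step k) (p k)).
Proof.
  intros He.
  apply ev_impl with (fun k => forall a, In a (syms (step 0)) -> forall d, In d (targets (step 0)) ->
     sadj a d -> fst (spos k a) <= fst (p k) <= fst (spos k d) ->
     0 < det (spos k a) (spos k d) (p k)).
  - apply ev_list; intros a Ha; apply ev_list; intros d Hd. apply ev_imp; auto.
  - intros k _ Hk a d A Hx. destruct (sadj_in 0 a d A). now apply Hk.
Qed.

(** For small [k] no copy reaches the abscissa of [p], so only perturbed edges of [G] can pass over
    it. *)
Lemma under_far (p : pt) : under G p -> (forall v, In v (verts G) -> xc v <> fst p) ->
  ev (fun k => under (step k) p).
Proof.
  intros Hu Hp. apply (ev_under (fun _ => p)). intros [g oa] [r od] Ha Hd A.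
  assert (Hr := Hp r (sverts_xc _ _ _ (target_vert _ _ Hd))).
  assert (C2 : xc r < fst p -> ev (fun k => fst (spos k (r, od)) < fst p)).
  { intros Hx. apply (ev_fst_lt (fun k => spos k (r, od)) (fun _ => p)).
    - apply ccont_spos. - apply ccont_const. - now rewrite spos_0. }
  destruct (Rlt_le_dec (xc r) (fst p)) as [Hx|Hx].
  { eapply ev_impl; [now apply C2|]. intros k _ H1 H2. lra. }
  destruct oa as [s|].
  - destruct od as [l|]; [|now destruct A]. destruct A as (E & _ & _). simpl in E; subst g.
    apply ev_impl with (fun k => fst p < fst (spos k (r, Some s))); [|intros k _ H1 H2; lra].
    apply (ev_fst_lt (fun _ => p) (fun k => spos k (r, Some s))).
    + apply ccont_const. + apply ccont_spos. + rewrite spos_0. simpl. unfold xc in *. lra.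
  - apply sadj_shadow in A. destruct (Rlt_le_dec (fst p) (xc g)) as [Hg|Hg].
    + apply ev_all. intros k _ H1. unfold spos, xc in *; simpl in *. lra.
    + apply ev_impl with (fun k => 0 < det (place g) (spos k (r, od)) p); [|auto].
      apply (ev_det (fun _ => place g) (fun k => spos k (r, od)) (fun _ => p));
        try apply ccont_const; [apply ccont_spos|]. rewrite spos_0. now apply Hu.
Qed.

(** A point that collapses to [q] from the right is under the edges of [G] passing over [q], by
    [v_below] for [q] itself. What remains to be checked are the edges into and inside the copy at
    [q]. *)
Lemma under_near q (p : R -> pt) : In q (spotpts G) -> ccont p -> p 0 = place q ->
  ev (fun k => xc q < fst (p k)) ->
  (forall g l, matched q g l -> ev (fun k => fst (p k) <= fst (spos k (q, Some l)) ->
     0 < det (place g) (spos k (q, Some l)) (p k))) ->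
  (forall s l, adj s l ->
     ev (fun k => fst (spos k (q, Some s)) <= fst (p k) <= fst (spos k (q, Some l)) ->
       0 < det (spos k (q, Some s)) (spos k (q, Some l)) (p k))) ->
  ev (fun k => under (step k) (p k)).
Proof.
  intros Hq Cp P0 Hgt Hm Hl. apply ev_under. intros [g oa] [r od] Ha Hd A.
  assert (C1 : xc q < xc g -> ev (fun k => fst (p k) < fst (spos k (g, oa)))).
  { intros Hx. apply ev_fst_lt; auto; [apply ccont_spos|]. now rewrite P0, spos_0. }
  assert (C2 : xc r < xc q -> ev (fun k => fst (spos k (r, od)) < fst (p k))).
  { intros Hx. apply ev_fst_lt; auto; [apply ccont_spos|]. now rewrite P0, spos_0. }
  assert (Vq := spot_vert _ _ Hq).
  assert (Vr := sverts_xc _ _ _ (target_vert _ _ Hd)).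
  assert (Vg := sverts_xc _ _ _ (sym_vert _ _ Ha)).
  destruct (verts_cases r q) as [Hx|[->|Hx]]; auto.
  - eapply ev_impl; [now apply C2|]. intros k _ H1 H2. lra.
  - destruct oa as [s|].
    + destruct od as [l|]; [|now destruct A]. destruct A as (E & _ & A). simpl in E, A; subst g.
      now apply Hl.
    + destruct od as [l|].
      * eapply ev_impl; [now apply (Hm g l)|]. intros k _ H1 [_ H2]. now apply H1.
      * eapply ev_impl; [exact Hgt|]. intros k _ H1 H2. unfold spos, xc in *; simpl in *. lra.
  - destruct oa as [s|].
    + destruct od as [l|]; [|now destruct A]. destruct A as (E & _ & A). simpl in E, A; subst g.
      eapply ev_impl; [now apply C1|]. intros k _ H1 H2. lra.
    + apply sadj_shadow in A. destruct (verts_cases g q) as [Hg|[->|Hg]]; auto.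
      * apply ev_impl with (fun k => 0 < det (spos k (g, None)) (spos k (r, od)) (p k)); [|auto].
        apply ev_det; auto; try apply ccont_spos. rewrite !spos_0, P0. now apply (v_below _ _ VG).
      * exfalso. apply (spot_not_sym q); auto. now apply (v_adj _ _ VG) in A.
      * eapply ev_impl; [now apply C1|]. intros k _ H1 H2. lra.
Qed.

(** * Hiding the non-adjacent pairs *)

Definition blocked (k : R) (a d : svtx) : Prop :=
  blocked_inner (step k) a d \/ blocked_sym (step k) a d \/
  (In d (cols (step 0)) /\ blocked_col (step k) a d).

Lemma ev_blocked_sym a d :
  (forall d', In d' (targets (step 0)) -> sadj a d' ->
    ev (fun k => 0 < det (spos k a) (spos k d) (spos k d'))) ->
  ev (fun k => blocked k a d).
Proof.
  intros He. apply ev_impl with (fun k => forall d', In d' (targets (step 0)) -> sadj a d' ->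
    0 < det (spos k a) (spos k d) (spos k d')).
  - apply ev_list; intros d' Hd'. apply ev_imp; auto.
  - intros k _ Hk. right; left. intros d' A. apply Hk; auto. now apply (sadj_in 0) in A.
Qed.

Lemma ev_blocked_col a d : In d (cols (step 0)) ->
  (forall b, In b (syms (step 0)) -> sadj b d ->
    ev (fun k => 0 < det (spos k a) (spos k d) (spos k b))) ->
  ev (fun k => blocked k a d).
Proof.
  intros Hd He. apply ev_impl with (fun k => forall b, In b (syms (step 0)) -> sadj b d ->
    0 < det (spos k a) (spos k d) (spos k b)).
  - apply ev_list; intros b Hb. apply ev_imp; auto.
  - intros k _ Hk. right; right. split; auto. intros b A. apply Hk; auto. now apply (sadj_in 0) in A.
Qed.

Lemma ev_blocked_inner a d (p : R -> pt) :
  ev (fun k => fst (spos k a) < fst (p k)) -> ev (fun k => fst (p k) < fst (spos k d)) ->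
  ev (fun k => det (spos k a) (spos k d) (p k) < 0) -> ev (fun k => under (step k) (p k)) ->
  ev (fun k => blocked k a d).
Proof.
  intros H1 H2 H3 H4.
  eapply ev_impl; [apply (ev_and _ _ (ev_and _ _ H1 H2) (ev_and _ _ H3 H4))|].
  intros k _ ((? & ?) & ? & ?). left. exists (p k). auto.
Qed.

Lemma col_not_spot (c : config) ys w : valid ys c -> In w (cols c) -> In w (spotpts c) -> False.
Proof.
  intros V Hc Hs. pose proof (v_nodup _ _ V) as N. unfold verts, targets in N.
  apply NoDup_app_remove_l in N. apply in_split in Hc. destruct Hc as [l1 [l2 E]].
  rewrite E, <- app_assoc in N. simpl in N. apply NoDup_remove_2 in N.
  apply N. rewrite !in_app_iff. auto.
Qed.

(** Each of the three reasons valid in [G] survives. In the third one [r] is a column and not a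
    spot, so no copy is placed next to it and it gains no neighbour. *)
Lemma block_far g r o : In g (syms G) -> In (r, o) (targets (step 0)) -> xc g < xc r -> ~ adj g r ->
  ev (fun k => blocked k (g, None) (r, o)).
Proof.
  intros Hg Hr Hx HA.
  assert (Tr : In r (targets G)).
  { apply in_stargets in Hr. destruct o; auto. unfold targets. apply in_or_app. tauto. }
  destruct (v_block _ _ VG g r Hg Tr Hx HA) as [Hi|[Hs|[Hc Hb]]].
  - destruct (blocked_inner_generic _ _ _ _ VG Hi) as (p & Hp & Hd & Hu & Hv).
    apply (ev_blocked_inner _ _ (fun _ => p)).
    + apply ev_all. intros k _. apply Hp.
    + apply (ev_fst_lt (fun _ => p) (fun k => spos k (r, o))); [apply ccont_const|apply ccont_spos|].
      rewrite spos_0. apply Hp.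
    + apply (ev_det_neg (fun k => spos k (g, None)) (fun k => spos k (r, o)) (fun _ => p));
      try apply ccont_spos; [apply ccont_const|]. now rewrite !spos_0.
    + now apply under_far.
  - apply ev_blocked_sym. intros [r' o'] _ A. apply sadj_shadow in A. apply far_det. now apply Hs.
  - destruct o as [p|].
    + apply in_stargets in Hr. exfalso. now apply (col_not_spot G _ r VG Hc).
    + apply ev_blocked_col; [now apply in_scols|].
      intros [b [s|]] _ A; [now destruct A|]. simpl in A. apply ev_all. intros k _. now apply Hb.
Qed.

Hypothesis T_sel : forall q g p, matched q g p -> exists t, 0 < t < T /\
  forall g' p', matched q g' p' ->
    xc p - t * slope (place g) (place q) <= xc p' - t * slope (place g') (place q).

(** A column of the copy is seen only by symbols lower than itself, so [g] is above its cone. A spot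
    higher than that of [g] is above the cone of [g]: by [v_last] the other edges of [g] end at [q]
    or before it, where [v_below] applies. A lower spot is hidden by the floor in the gap, at the
    distance [t] where the line of [g] is lowest. *)
Lemma block_matched q g p : In p (targets L) -> In q (spotpts G) -> adj g q -> ~ matched q g p ->
  ev (fun k => blocked k (g, None) (q, Some p)).
Proof.
  intros Hp Hq A Hm. destruct (v_adj _ _ VG _ _ A) as (Sg & Tq & Hgq).
  unfold targets in Hp. apply in_app_or in Hp. destruct Hp as [Hp|Hp].
  { apply ev_blocked_col; [now apply in_scols|]. intros [b [s|]] _ B.
    - destruct B as (E & _ & B). simpl in E, B; subst b. apply (v_adj _ _ VL) in B.
      apply (det_near (place g) (place q) (place p) (place s)); tauto.
    - apply matched_spot in B. simpl in B. exfalso. now apply (col_not_spot L _ p VL). }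
  destruct (matched_total q g Hq A) as [pi Hpi].
  destruct (matched_spot _ _ _ Hpi) as (_ & _ & Hpi' & _).
  destruct (Rtotal_order (xc pi) (xc p)) as [Hx|[Hx|Hx]].
  - apply ev_blocked_sym. intros [r o] Hr B.
    assert (Vr := sverts_xc _ _ _ (target_vert _ _ Hr)).
    assert (B' := sadj_shadow _ _ _ B). destruct (v_last _ _ VG g q r Hq A B') as [->|Hlt].
    + destruct o as [l|].
      * assert (l = pi) by exact (matched_fun q g l pi B Hpi). subst l.
        apply (det_near (place g) (place q) (place p) (place pi)); assumption.
      * apply (det_spot (place g) (place q) (place p)); auto. apply H_big; auto. now apply spot_vert.
    + apply (far_det (g, None) (q, Some p) (r, o)). simpl. apply (v_below _ _ VG); auto.
      now apply (v_adj _ _ VG) in B'.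
  - apply (v_xinj _ _ VL) in Hx; try now apply spot_vert. now subst pi.
  - destruct (T_sel _ _ _ Hpi) as (t & Ht & Hsel).
    (* Halfway between the lines from [g] to [p] and to [pi]: above the former and, by the choice of
       [t], below the lines from all symbols of [q] to their spots. *)
    set (m := (xc p + xc pi) / 2 - t * slope (place g) (place q)).
    assert (Hlow : forall l : vtx L, ev (fun k => fst (gap t m k (place q)) < fst (spos k (q, Some l)))).
    { intros l. apply ev_impl with (fun k => 0 < t + k * xc l).
      - apply (ev_cont (fun k => t + k * xc l)); [reg|lra].
      - intros k Hk Hl. unfold gap, spos, loc; simpl. fold (xc l).
        assert (0 < k * (t + k * xc l)) by now apply Rmult_lt_0_compat. lra. }
    apply (ev_blocked_inner _ _ (fun k => gap t m k (place q))); auto.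
    + apply (ev_fst_lt (fun k => spos k (g, None)) (fun k => gap t m k (place q)));
        [apply ccont_spos|apply ccont_gap|]. now rewrite spos_0, gap_0.
    + destruct (det_gap (place g) (place q) (place p) t m Hgq) as (f & Cf & F0 & Hf).
      apply ev_impl with (fun k => 0 < - f k).
      * apply (ev_cont (fun k => - f k)); [now apply (continuity_pt_opp f)|]. rewrite F0.
        assert (0 < (xc q - xc g) * (xc pi - xc p)) by (apply Rmult_lt_0_compat; lra).
        unfold m, xc in *. lra.
      * intros k Hk H1. unfold spos; simpl fst; simpl snd. cbv iota. rewrite Hf.
        assert (0 < k * - f k) by now apply Rmult_lt_0_compat. lra.
    + apply under_near with q; auto; [apply ccont_gap|apply gap_0| | |].
      * apply ev_all. intros k Hk. simpl. fold (xc q).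
        assert (0 < k * (T - t)) by (apply Rmult_lt_0_compat; lra). lra.
      * intros g' l Hml. destruct (matched_spot _ _ _ Hml) as (_ & A' & _).
        destruct (v_adj _ _ VG _ _ A') as (_ & _ & Hgq').
        destruct (det_gap (place g') (place q) (place l) t m Hgq') as (f & Cf & F0 & Hf).
        apply ev_impl with (fun k => 0 < f k).
        -- apply ev_cont; auto. rewrite F0. specialize (Hsel _ _ Hml).
           apply Rmult_lt_0_compat; unfold m, xc in *; lra.
        -- intros k Hk H1 _. unfold spos; simpl fst; simpl snd. cbv iota. rewrite Hf.
           now apply Rmult_lt_0_compat.
      * intros s l _. eapply ev_impl; [apply (Hlow s)|]. intros k _ H1 H2. lra.
Qed.

Lemma loc_le k q p p' : 0 < k ->
  fst (loc T H k q p) <= fst (loc T H k q p') -> fst p <= fst p'.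
Proof.
  intros Hk Hle. destruct (Rle_lt_dec (fst p) (fst p')) as [?|Hlt]; auto.
  apply (loc_lt k q p' p Hk) in Hlt. lra.
Qed.

(** The affine copy preserves all three reasons, but a witness must also stay under the edges from
    [G] into the copy. Those ending on its right pass above it by [det_near], and genericity
    excludes an end at its own abscissa. *)
Lemma block_local q s p : In q (spotpts G) -> In s (syms L) -> In p (targets L) -> xc s < xc p ->
  ~ adj s p -> ev (fun k => blocked k (q, Some s) (q, Some p)).
Proof.
  intros Hq Hs Hp Hx HA.
  assert (K4 : forall k, 0 < k -> 0 < k * k * k * k)
    by (intros; repeat apply Rmult_lt_0_compat; auto).
  destruct (v_block _ _ VL s p Hs Hp Hx HA) as [Hi|[Hb|[Hc Hb]]].
  - destruct (blocked_inner_generic _ _ _ _ VL Hi) as (z & Hz & Hd & Hu & Hv).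
    apply (ev_blocked_inner _ _ (fun k => loc T H k (place q) z)).
    + apply ev_all. intros k Hk. now apply loc_lt.
    + apply ev_all. intros k Hk. now apply loc_lt.
    + apply ev_all. intros k Hk. unfold spos; simpl fst; simpl snd; cbv iota. rewrite det_loc.
      specialize (K4 k Hk). assert (0 < k * k * k * k * - det (place s) (place p) z)
        by (apply Rmult_lt_0_compat; lra). lra.
    + apply under_near with q; auto; [apply ccont_loc|apply loc_0| | |].
      * apply ev_impl with (fun k => 0 < T + k * fst z).
        -- apply (ev_cont (fun k => T + k * fst z)); [reg|lra].
        -- intros k Hk Hl. simpl. fold (xc q).
           assert (0 < k * (T + k * fst z)) by now apply Rmult_lt_0_compat. lra.
      * intros g l Hml. destruct (matched_spot _ _ _ Hml) as (_ & A & Hl & _).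
        apply (v_adj _ _ VG) in A. apply spot_vert in Hl.
        destruct (Rtotal_order (fst z) (xc l)) as [Hlt|[E|Hlt]].
        -- eapply ev_impl; [apply (det_near (place g) (place q) (place l) z)|auto]; tauto.
        -- now destruct (Hv l Hl).
        -- apply ev_all. intros k Hk H1. apply (loc_le k (place q) z (place l) Hk) in H1.
           unfold xc in Hlt. lra.
      * intros s' l A. apply ev_all. intros k Hk [H1 H2].
        apply (loc_le k (place q) (place s') z Hk) in H1.
        apply (loc_le k (place q) z (place l) Hk) in H2.
        unfold spos; simpl fst; simpl snd; cbv iota. rewrite det_loc.
        apply Rmult_lt_0_compat; auto.
  - apply ev_blocked_sym. intros [r [l|]] _ A; [|now destruct A].
    destruct A as (E & _ & A). simpl in E, A; subst r. apply ev_all. intros k Hk.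
    unfold spos; simpl fst; simpl snd; cbv iota. rewrite det_loc.
    apply Rmult_lt_0_compat; auto.
  - apply ev_blocked_col; [now apply in_scols|]. intros [b [l|]] _ A.
    + destruct A as (E & _ & A). simpl in E, A; subst b. apply ev_all. intros k Hk.
      unfold spos; simpl fst; simpl snd; cbv iota. rewrite det_loc.
      apply Rmult_lt_0_compat; auto.
    + apply matched_spot in A. simpl in A. exfalso. now apply (col_not_spot L _ p VL).
Qed.

(** Edges inside a copy have slope about [/ k], hence are steeper than the line to any vertex beyond
    the copy; this is the situation of [blocked_low]. *)
Lemma det_out q s l (u : svtx) : fst q < xc (fst u) -> fst s < fst l ->
  ev (fun k => det (loc T H k q s) (spos k u) (loc T H k q l) < 0).
Proof.
  intros Hq Hs.
  set (f := fun k =>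
    ((fst l - fst s) + k * (snd l - snd s)) * (fst (spos k u) - fst (loc T H k q s))
    - k * (fst l - fst s) * (snd (spos k u) - snd (loc T H k q s))).
  apply ev_impl with (fun k => 0 < f k).
  - apply ev_cont.
    + unfold f. destruct u as [w [p|]]; simpl; reg.
    + unfold f. rewrite spos_0, loc_0.
      replace (_ - _) with ((fst l - fst s) * (xc (fst u) - fst q)) by (unfold xc; ring).
      apply Rmult_lt_0_compat; lra.
  - intros k Hk Hf.
    replace (det _ _ _) with (- (k * f k)) by (unfold f, det, loc; simpl; ring).
    assert (0 < k * f k) by now apply Rmult_lt_0_compat. lra.
Qed.

Lemma block_out q s r o : In q (spotpts G) -> In s (syms L) -> xc q < xc r ->
  ev (fun k => blocked k (q, Some s) (r, o)).
Proof.
  intros Hq Hs Hx.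
  assert (E : ev (fun k => forall d, In d (targets (step 0)) -> sadj (q, Some s) d ->
     det (spos k (q, Some s)) (spos k (r, o)) (spos k d) < 0)).
  { apply ev_list; intros [r' [l|]] _; apply ev_imp; intros A; [|now destruct A].
    destruct A as (E & _ & A). simpl in E, A; subst r'.
    apply (det_out (place q) (place s) (place l) (r, o)); auto. now apply (v_adj _ _ VL) in A. }
  eapply ev_impl;
    [apply (ev_and _ _ (ev_and _ _ E (far_lt (q, Some s) (r, o) Hx))
       (ev_and _ _ step_xinj (ev_and _ _ step_adj_lt step_below)))|].
  intros k Hk ((H1 & H2) & H3 & H4 & H5). left.
  apply blocked_low.
  - intros u v Hu Hv. now apply H3.
  - intros a d A. destruct (sadj_in 0 a d A) as [? ?].
    split; [assumption|]. split; [assumption|]. now apply H4.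
  - intros a d v A. destruct (sadj_in 0 a d A). intros. now apply H5.
  - now apply in_ssyms.
  - exact H2.
  - intros d A. apply H1; auto. now apply (sadj_in 0) in A.
Qed.

Lemma step_block : ev (fun k =>
  forall a, In a (syms (step 0)) -> forall d, In d (targets (step 0)) ->
  ~ sadj a d -> fst (spos k a) < fst (spos k d) -> blocked k a d).
Proof.
  apply ev_list; intros [g oa] Ha; apply ev_list; intros [r od] Hd; apply ev_imp; intros A.
  assert (Vr := sverts_xc _ _ _ (target_vert _ _ Hd)).
  assert (Vg := sverts_xc _ _ _ (sym_vert _ _ Ha)).
  assert (Tr : In r (targets G)).
  { apply in_stargets in Hd. destruct od; auto. unfold targets. apply in_or_app. tauto. }
  destruct (verts_cases g r) as [Hx|[->|Hx]]; auto.
  - apply in_ssyms in Ha. destruct oa as [s|].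
    + eapply ev_impl; [now apply (block_out g s r od)|]. auto.
    + destruct (classic (adj g r)) as [B|B].
      * destruct od as [p|]; [|now destruct A]. apply in_stargets in Hd.
        eapply ev_impl; [apply (block_matched r g p); solve [tauto | exact A]|auto].
      * eapply ev_impl; [now apply (block_far g r od)|auto].
  - apply in_ssyms in Ha. destruct oa as [s|].
    + destruct od as [p|].
      * apply in_stargets in Hd. destruct (Rlt_le_dec (xc s) (xc p)) as [Hlt|Hle].
        -- eapply ev_impl; [apply (block_local r s p); try tauto|auto].
           intros B. apply A. split; [reflexivity|tauto].
        -- apply ev_all. intros k Hk Hlt. apply (loc_lt k (place r) (place s) (place p) Hk) in Hlt.
           unfold xc in Hle. lra.
      * eapply ev_impl; [apply (near_lt r s)|]. intros k _ H1 H2. exfalso.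
        unfold spos, loc, xc in *; simpl in *. lra.
    + exfalso. now apply (disj_sym_target _ _ r VG).
  - eapply ev_impl; [apply (far_lt (r, od) (g, oa)); exact Hx|]. intros k _ H1 H2. lra.
Qed.

(** * Remaining conditions and validity of the step *)

Lemma step_sorted : ev (fun k =>
  StronglySorted (fun s t => fst (spos k (fst s)) < fst (spos k (fst t))) sspots).
Proof.
  assert (E : ev (fun k => forall q, In q (spotpts G) -> forall q', In q' (spotpts G) ->
    xc q < xc q' -> forall p, In p (spotpts L) -> forall p', In p' (spotpts L) ->
    fst (spos k (q, Some p)) < fst (spos k (q', Some p')))).
  { apply ev_list; intros q _. apply ev_list; intros q' _. apply ev_imp; intros Hx.
    apply ev_list; intros p _. apply ev_list; intros p' _.
    now apply (far_lt (q, Some p) (q', Some p')). }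
  eapply ev_impl; [exact E|]. intros k Hk Hall. unfold sspots.
  eapply sorted_flat_map; [apply (v_sorted _ _ VG)| |].
  - intros [q gs] Hq. apply sorted_combine_map with (R := fun s t => xc (fst s) < xc (fst t)).
    + apply (v_sorted _ _ VL).
    + intros g g' [p ss] [p' ss'] Hlt. now apply loc_lt.
  - intros [q gs] [q' gs'] Hq Hq' Hlt u v Hu Hv.
    apply in_map_iff in Hu, Hv. destruct Hu as ([g [p ss]] & <- & Hu).
    destruct Hv as ([g' [p' ss']] & <- & Hv). apply in_combine_r in Hu, Hv. simpl.
    apply (in_map fst) in Hu, Hv, Hq, Hq'. now apply Hall.
Qed.

Lemma NoDup_copies l : NoDup l -> NoDup (copies l).
Proof.
  intros N. apply NoDup_list_prod; [now apply (nodup_spotpts G _ VG)|].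
  apply NoDup_map_inj; auto. congruence.
Qed.

Lemma NoDup_globs l : NoDup l -> NoDup (map glob l).
Proof. apply NoDup_map_inj. unfold glob. congruence. Qed.

Lemma sorted_NoDup {A : Type} (f : A -> R) (l : list A) :
  StronglySorted (fun s t => f s < f t) l -> NoDup l.
Proof.
  induction 1 as [|a l S IH F]; constructor; auto.
  intros Hi. rewrite Forall_forall in F. specialize (F a Hi). lra.
Qed.

Lemma NoDup_spotpts_sorted (c : config) :
  StronglySorted (fun s t => xc (fst s) < xc (fst t)) (spots c) -> NoDup (spotpts c).
Proof.
  intros S. apply (sorted_NoDup (fun v : vtx c => xc v)). unfold spotpts.
  induction S as [|a l S IH F]; simpl; constructor; auto.
  rewrite Forall_forall in *. intros x Hx. apply in_map_iff in Hx. destruct Hx as (y & <- & Hy). auto.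
Qed.

Lemma step_nodup k : NoDup (spotpts (step k)) -> NoDup (verts (step k)).
Proof.
  intros N.
  pose proof (v_nodup _ _ VG) as NG. pose proof (v_nodup _ _ VL) as NL. unfold verts in NG, NL.
  assert (NGt := NoDup_app_remove_l _ _ NG). assert (NLt := NoDup_app_remove_l _ _ NL).
  apply NoDup_app_remove_r in NG, NL. unfold targets in NLt. apply NoDup_app_remove_r in NLt.
  unfold verts. apply NoDup_app; [| unfold targets; apply NoDup_app; auto |].
  - apply NoDup_app; [now apply NoDup_globs|now apply NoDup_copies|].
    intros [w o] H1 H2. apply in_globs in H1. apply in_copies in H2.
    destruct H1 as [-> _]. destruct H2 as (p & E & _). discriminate.
  - apply NoDup_app; [now apply NoDup_globs|now apply NoDup_copies|].
    intros [w o] H1 H2. apply in_globs in H1. apply in_copies in H2.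
    destruct H1 as [-> _]. destruct H2 as (p & E & _). discriminate.
  - intros [w o] H1 H2. apply in_scols in H1. apply in_sspotpts in H2.
    destruct H2 as (p & -> & _ & Hp). apply (col_not_spot L _ p VL); tauto.
  - intros [w o] H1 H2. apply in_ssyms in H1. apply in_stargets in H2. destruct o as [p|].
    + apply (disj_sym_target _ _ p VL); tauto.
    + apply (disj_sym_target _ _ w VG); tauto.
Qed.

Lemma step_last : ev (fun k => forall a, In a (syms (step 0)) ->
  forall u, In u (spotpts (step 0)) -> forall d, In d (targets (step 0)) ->
  sadj a u -> sadj a d -> d = u \/ fst (spos k d) < fst (spos k u)).
Proof.
  apply ev_list; intros [g oa] Ha. apply ev_list; intros [q o] Hu. apply ev_list; intros [r od] Hd.
  apply ev_imp; intros A. apply ev_imp; intros B.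
  apply in_sspotpts in Hu. destruct Hu as (p & -> & Hq & Hp).
  destruct oa as [s|].
  - destruct od as [l|]; [|now destruct B].
    destruct A as (E & _ & A). simpl in E, A; subst g.
    destruct B as (E & _ & B). simpl in E, B; subst r.
    apply ev_all. intros k Hk. destruct (v_last _ _ VL s p l Hp A B) as [->|Hlt]; auto.
    right. now apply loc_lt.
  - assert (A' := sadj_shadow _ _ _ A). assert (B' := sadj_shadow _ _ _ B).
    destruct (v_last _ _ VG g q r Hq A' B') as [->|Hlt].
    + destruct od as [l|].
      * apply ev_all. intros k _. left. now rewrite (matched_fun q g l p B A).
      * eapply ev_impl; [apply (near_lt q p)|]. intros k _ H1. right. exact H1.
    + eapply ev_impl; [apply (far_lt (r, od) (q, Some p)); exact Hlt|]. auto.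
Qed.

(** A symbol of [G] and a copied one share at most one neighbour, since the former sees a single
    spot of each copy. Two symbols of [G] can share two only over a common [r] of [G], but different
    symbols are matched to different spots of the copy at [r]. *)
Lemma step_k22 a b d d' : sadj a d -> sadj a d' -> sadj b d -> sadj b d' -> a = b \/ d = d'.
Proof.
  assert (Hgg : forall g g' r r' o o', sadj (g, None) (r, o) -> sadj (g, None) (r', o') ->
    sadj (g', None) (r, o) -> sadj (g', None) (r', o') -> g = g' \/ (r, o) = (r', o')).
  { intros g g' r r' o o' A A' B B'.
    destruct (v_k22 _ _ VG g g' r r') as [->|<-]; eauto using sadj_shadow.
    destruct o as [p|].
    - left. exact (matched_inj r g g' p A B).
    - destruct o' as [p'|]; auto. left. exact (matched_inj r g g' p' A' B'). }
  assert (Hlg : forall s q g d d', sadj (q, Some s) d -> sadj (q, Some s) d' ->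
    sadj (g, None) d -> sadj (g, None) d' -> d = d').
  { intros s q g [r [l|]] [r' [l'|]] A A' B B'; try now destruct A; try now destruct A'.
    destruct A as (E & _ & A). destruct A' as (E' & _ & A'). simpl in E, E'. subst r r'.
    now rewrite (matched_fun q g l l' B B'). }
  destruct a as [q [s|]], b as [q' [s'|]]; intros A A' B B'.
  - destruct d as [r [l|]]; [|now destruct A]. destruct d' as [r' [l'|]]; [|now destruct A'].
    destruct A as (E1 & _ & A), A' as (E2 & _ & A'), B as (E3 & _ & B), B' as (E4 & _ & B').
    simpl in *. subst. destruct (v_k22 _ _ VL s s' l l') as [-> | ->]; auto.
  - right. eauto.
  - right. eauto.
  - destruct d as [r o], d' as [r' o']. destruct (Hgg q q' r r' o o') as [->|E]; auto.
Qed.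

(** This [/ k] is the large shift [B] of [sel_cons]. *)
Lemma slope_loc k q p p' : 0 < k -> fst p <> fst p' ->
  slope (loc T H k q p) (loc T H k q p') = slope p p' + / k.
Proof. intros. unfold slope, loc; simpl. field. split; [lra|]. split; [lra|].
  intros E. apply H1. assert (k * k * (fst p' - fst p) = 0) by lra.
  assert (0 < k * k) by now apply Rmult_lt_0_compat. nra. Qed.

Lemma ev_inv B : ev (fun k => B < / k).
Proof.
  apply ev_impl with (fun k => 0 < 1 - k * B).
  - apply (ev_cont (fun k => 1 - k * B)); [reg|lra].
  - intros k Hk Hb. apply Rmult_lt_reg_l with k; auto. rewrite Rinv_r; lra.
Qed.

Lemma ev_slope_bound g q p : fst g < fst q ->
  ev (fun k => Rabs (slope g (loc T H k q p)) <= Rabs (slope g q) + 1).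
Proof.
  intros Hg. set (M := Rabs (slope g q) + 1).
  pose proof (Rle_abs (slope g q)) as B1. pose proof (Rle_abs (- slope g q)) as B2.
  rewrite Rabs_Ropp in B2.
  assert (E : ev (fun k => (0 < M * (fst (loc T H k q p) - fst g) - (snd (loc T H k q p) - snd g) /\
    0 < M * (fst (loc T H k q p) - fst g) + (snd (loc T H k q p) - snd g)) /\
    0 < fst (loc T H k q p) - fst g)).
  { repeat apply ev_and.
    - apply (ev_cont (fun k => M * (fst (loc T H k q p) - fst g) - (snd (loc T H k q p) - snd g)));
        [simpl; reg|]. rewrite loc_0, (slope_mult g q Hg).
      replace (_ - _) with ((M - slope g q) * (fst q - fst g)) by ring.
      apply Rmult_lt_0_compat; unfold M; lra.
    - apply (ev_cont (fun k => M * (fst (loc T H k q p) - fst g) + (snd (loc T H k q p) - snd g)));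
        [simpl; reg|]. rewrite loc_0, (slope_mult g q Hg).
      replace (_ + _) with ((M + slope g q) * (fst q - fst g)) by ring.
      apply Rmult_lt_0_compat; unfold M; lra.
    - apply (ev_cont (fun k => fst (loc T H k q p) - fst g)); [simpl; reg|]. rewrite loc_0. lra. }
  eapply ev_impl; [exact E|]. intros k _ ((H1 & H2) & H3).
  rewrite (slope_mult g (loc T H k q p)) in H1, H2 by lra.
  set (s := slope g (loc T H k q p)) in *. set (D := fst (loc T H k q p) - fst g) in *.
  apply Rabs_le. split; apply Rmult_le_reg_r with D; lra.
Qed.

(** [sel_cons] with [B = / k]: the symbol of [G] comes with a slope that stays bounded as [k]
    shrinks, and with the lowest height [x0]. *)
Lemma step_sel x0 : (forall x, In x xs -> x0 < x) -> ev (fun k =>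
  forall uh, In uh sspots -> sel (combine (x0 :: xs)
    (map (fun h => slope (spos k h) (spos k (fst uh))) (snd uh)))).
Proof.
  intros Hx0. apply ev_list. intros [[q o] hs] Hu. apply in_sspots in Hu.
  destruct Hu as (gs & g & p & ss & Hq & Hi & -> & ->).
  assert (Hm : matched q g p).
  { exists gs. split; auto. apply (combine_map (fun x => x) fst) in Hi. now rewrite map_id in Hi. }
  destruct (matched_spot _ _ _ Hm) as (_ & A & _). apply (v_adj _ _ VG) in A.
  apply in_combine_r in Hi. destruct (v_spot _ _ VL p ss Hi) as (Elen & _ & Hss & Hsel).
  destruct (sel_cons x0 (Rabs (slope (place g) (place q)) + 1)
    (combine xs (map (fun g => slope (place g) (place p)) ss))) as [B0 HB]; auto.
  { pose proof (Rabs_pos (slope (place g) (place q))). lra. }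
  { intros x s Hin. apply Hx0. now apply in_combine_l in Hin. }
  eapply ev_impl; [apply (ev_and _ _ (ev_inv B0) (ev_slope_bound (place g) (place q) (place p) (proj2 (proj2 A))))|].
  intros k Hk [H1 H2]. specialize (HB _ H1 _ H2).
  simpl snd. simpl fst. simpl map. simpl combine.
  match goal with |- sel (?a :: ?l) => replace l with
    (map (fun z : R * R => (fst z, snd z + / k))
      (combine xs (map (fun s => slope (place s) (place p)) ss))); [exact HB|] end.
  rewrite map_map. clear Elen Hsel HB.
  assert (Hne : forall s, In s ss -> xc s <> xc p).
  { intros s Hs. apply Hss in Hs. apply (v_adj _ _ VL) in Hs. lra. }
  clear - Hk Hne. revert ss Hne. induction xs as [|x xs' IH]; intros [|s ss] Hne; simpl; auto.
  f_equal.
  - f_equal. symmetry. unfold spos; simpl fst; simpl snd; cbv iota. apply slope_loc; auto.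
    apply Hne; simpl; auto.
  - apply IH. intros; apply Hne; simpl; auto.
Qed.

Lemma step_spot_list q o hs : In ((q, o), hs) sspots ->
  length hs = S (length xs) /\ NoDup hs /\ forall h, In h hs <-> sadj h (q, o).
Proof.
  intros Hu. apply in_sspots in Hu. destruct Hu as (gs & g & p & ss & Hq & Hi & -> & ->).
  assert (Hm : matched q g p).
  { exists gs. split; auto. apply (combine_map (fun x => x) fst) in Hi. now rewrite map_id in Hi. }
  apply in_combine_r in Hi. destruct (v_spot _ _ VL p ss Hi) as (Elen & N & Hss & _).
  split; [simpl; now rewrite length_map, Elen|]. split.
  - constructor.
    + intros Hg. apply in_map_iff in Hg. destruct Hg as (s & E & _). discriminate.
    + apply NoDup_map_inj; auto. congruence.
  - intros [b [s|]]; simpl; rewrite in_map_iff.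
    + split.
      * intros [E|(s' & E & Hs)]; [discriminate|]. inversion E; subst.
        apply matched_spot in Hm. unfold sadj; simpl. rewrite <- Hss. tauto.
      * unfold sadj; simpl. intros (-> & _ & Hs). right. exists s. now rewrite Hss.
    + split.
      * intros [E|(s' & E & _)]; [|discriminate]. now inversion E; subst.
      * intros M. left. now rewrite (matched_inj q g b p Hm M).
Qed.

Lemma step_valid x0 : (forall x, In x xs -> x0 < x) -> ev (fun k => valid (x0 :: xs) (step k)).
Proof.
  intros Hx0.
  eapply ev_impl; [apply (ev_and _ _ (ev_and _ _ step_xinj (ev_and _ _ step_adj_lt step_below))
    (ev_and _ _ (ev_and _ _ step_block step_sorted) (ev_and _ _ step_last (step_sel x0 Hx0))))|].
  intros k Hk ((Hinj & Hlt & Hbel) & (Hblk & Hsort) & Hlast & Hsel).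
  constructor.
  - apply step_nodup. now apply NoDup_spotpts_sorted.
  - intros u v Hu Hv. now apply Hinj.
  - intros a d A. destruct (sadj_in 0 a d A) as [? ?].
    split; [assumption|]. split; [assumption|]. now apply Hlt.
  - intros a d v A. destruct (sadj_in 0 a d A) as [? ?]. intros Hv Hx. now apply Hbel.
  - intros a d Ha Hd Hx A. now apply Hblk.
  - exact step_k22.
  - exact Hsort.
  - intros [q o] hs Hu. destruct (step_spot_list q o hs Hu) as (? & ? & ?).
    split; [assumption|]. split; [assumption|]. split; [assumption|]. exact (Hsel _ Hu).
  - intros a u d Hu A B.
    destruct (sadj_in 0 a u A) as [Ha _]. destruct (sadj_in 0 a d B) as [_ Hd].
    now apply (Hlast a Ha u Hu d Hd).
Qed.

End Step.

(** * Counting, and choosing the parameters of a step *)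

Lemma length_flat_map_const {A B : Type} (f : A -> list B) (l : list A) n :
  (forall x, In x l -> length (f x) = n) -> length (flat_map f l) = (length l * n)%nat.
Proof.
  induction l as [|a l IH]; intros Hf; simpl; auto.
  rewrite length_app, IH by (intros; apply Hf; simpl; auto). rewrite Hf; simpl; auto.
Qed.

Lemma NoDup_flat_map {A B : Type} (f : A -> list B) (l : list A) :
  NoDup l -> (forall x, In x l -> NoDup (f x)) ->
  (forall x y b, In x l -> In y l -> In b (f x) -> In b (f y) -> x = y) -> NoDup (flat_map f l).
Proof.
  induction 1 as [|a l Ha N IH]; intros Hf Hd; simpl; [constructor|].
  apply NoDup_app.
  - apply Hf; simpl; auto.
  - apply IH.
    + intros; apply Hf; simpl; auto.
    + intros x y b Hx Hy. apply Hd; simpl; auto.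
  - intros b Hb Hb'. apply in_flat_map in Hb'. destruct Hb' as (y & Hy & Hb').
    apply Ha. rewrite (Hd a y b); simpl; auto.
Qed.

(** The middle term counts the edges into the spots of [G], now columns: each of these spots has as
    many symbols as [L] has spots. *)
Lemma step_edges xs (G L : config) T H k e e' :
  valid (map xc (spotpts L)) G -> valid xs L ->
  has_edges G e -> has_edges L e' ->
  has_edges (step G L T H k)
    (e + length (spots G) * length (spots L) + length (spots G) * e').
Proof.
  intros VG VL (l & N & El & Hl) (l' & N' & El' & Hl').
  set (l1 := map (fun ad => (glob G L (fst ad), glob G L (snd ad))) l).
  set (l2 := flat_map (fun qg => map (fun g => (glob G L g, glob G L (fst qg))) (snd qg)) (spots G)).
  set (l3 := flat_map (fun q => map (fun ad => ((q, Some (fst ad)) : svtx G L, (q, Some (snd ad)) : svtx G L)) l')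
    (spotpts G)).
  assert (Hsp : forall q gs, In (q, gs) (spots G) -> In q (spotpts G))
    by (intros q gs Hq; apply in_map_iff; now exists (q, gs)).
  exists (l1 ++ l2 ++ l3). split; [|split].
  - apply NoDup_app; [|apply NoDup_app|].
    + apply NoDup_map_inj; auto. intros [a d] [a' d'] E. simpl in E. unfold glob in E. congruence.
    + apply NoDup_flat_map.
      * apply NoDup_map_inv with (f := fst). now apply (nodup_spotpts G (map xc (spotpts L))).
      * intros [q gs] Hq. apply NoDup_map_inj.
        -- intros x y E. unfold glob in E. congruence.
        -- now apply (v_spot _ _ VG q gs).
      * intros [q gs] [q' gs'] b Hq Hq' Hb Hb'. apply in_map_iff in Hb, Hb'.
        destruct Hb as (x & <- & _), Hb' as (y & E & _). unfold glob in E; simpl in E.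
        assert (q' = q) by congruence. subst q'.
        now rewrite (spot_unique G _ q gs gs' VG Hq Hq').
    + apply NoDup_flat_map.
      * now apply (nodup_spotpts G (map xc (spotpts L))).
      * intros q _. apply NoDup_map_inj; auto. intros [a d] [a' d'] E. simpl in E. congruence.
      * intros q q' b _ _ Hb Hb'. apply in_map_iff in Hb, Hb'.
        destruct Hb as (x & <- & _), Hb' as (y & E & _). congruence.
    + intros b Hb Hb'. apply in_flat_map in Hb, Hb'.
      destruct Hb as (q & _ & Hb), Hb' as (q' & _ & Hb'). apply in_map_iff in Hb, Hb'.
      destruct Hb as (x & <- & _), Hb' as (y & E & _). unfold glob in E. congruence.
    + intros b Hb Hb'. apply in_map_iff in Hb. destruct Hb as ([a d] & <- & Hb).
      apply in_app_or in Hb'. destruct Hb' as [Hb'|Hb']; apply in_flat_map in Hb';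
        destruct Hb' as (q & Hq & Hb'); apply in_map_iff in Hb'; destruct Hb' as (y & E & _).
      * unfold glob in E; simpl in E. destruct q as [q gs]. simpl in E.
        assert (q = d) by congruence. subst q. apply Hl in Hb.
        apply (col_not_spot G _ d VG); [tauto|eauto].
      * unfold glob in E; simpl in E. congruence.
  - rewrite !length_app. unfold l1, l2, l3. rewrite length_map.
    rewrite (length_flat_map_const _ _ (length (spots L))).
    + rewrite (length_flat_map_const _ _ e').
      * unfold spotpts. rewrite length_map. lia.
      * intros q _. now rewrite length_map.
    + intros [q gs] Hq. simpl. rewrite length_map.
      destruct (v_spot _ _ VG q gs Hq) as (E & _). unfold spotpts in E. now rewrite !length_map in E.
  - intros [g o] [r o'] Hi. rewrite !in_app_iff in Hi. destruct Hi as [Hi|[Hi|Hi]].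
    + apply in_map_iff in Hi. destruct Hi as ([a d] & E & Hi). unfold glob in E; simpl in E.
      inversion E; subst. apply Hl in Hi. split; [apply Hi|].
      apply in_scols. unfold targets. apply in_or_app; left; apply Hi.
    + apply in_flat_map in Hi. destruct Hi as ([q gs] & Hq & Hi). apply in_map_iff in Hi.
      destruct Hi as (a & E & Hi). unfold glob in E; simpl in E. inversion E; subst.
      split; [now apply (v_spot _ _ VG r gs Hq)|].
      apply in_scols. unfold targets. apply in_or_app; right; eauto.
    + apply in_flat_map in Hi. destruct Hi as (q & Hq & Hi). apply in_map_iff in Hi.
      destruct Hi as ([a d] & E & Hi). simpl in E. inversion E; subst. apply Hl' in Hi.
      split; [repeat split; tauto|]. apply in_scols. tauto.
Qed.

Lemma sorted_spot_xs (c : config) :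
  StronglySorted (fun s t => xc (fst s) < xc (fst t)) (spots c) ->
  StronglySorted Rlt (map xc (spotpts c)).
Proof.
  unfold spotpts. induction 1 as [|a l S IH F]; simpl; constructor; auto.
  rewrite Forall_forall in *. intros x Hx. rewrite map_map in Hx. apply in_map_iff in Hx.
  destruct Hx as (y & <- & Hy). auto.
Qed.

Lemma length_copies (G L : config) (l : list (vtx L)) :
  length (copies G L l) = (length (spots G) * length l)%nat.
Proof.
  transitivity (length (spotpts G) * length (map Some l))%nat; [apply length_prod|].
  unfold spotpts. now rewrite !length_map.
Qed.

(** The order of the choices is forced: [L] for all heights but the lowest, [G] for the abscissas of
    the spots of [L], then [T] beyond all selecting distances, [H] large for this [T], and finally
    [k] small for all of them. *)
Theorem good_step F m P s c e s' c' e' :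
  good F P s c e -> good m F s' c' e' ->
  good (S m) (P * F) (s + P * s') (c + P + P * c') (e + P * F + P * e').
Proof.
  intros HG HL xs Exs Sxs. destruct xs as [|x0 xs]; [discriminate|].
  apply StronglySorted_inv in Sxs. destruct Sxs as [Sxs Fxs]. rewrite Forall_forall in Fxs.
  destruct (HL xs) as (L & VL & PL & SL & CL & EL); auto.
  destruct (HG (map xc (spotpts L))) as (G & VG & PG & SG & CG & EG).
  { unfold spotpts. now rewrite !length_map. }
  { apply sorted_spot_xs. apply (v_sorted _ _ VL). }
  assert (HT : exists b, forall T, b < T -> forall qg, In qg (spots G) ->
    forall gp, In gp (combine (snd qg) (spotpts L)) -> exists t, 0 < t < T /\
    forall gp', In gp' (combine (snd qg) (spotpts L)) ->
      xc (snd gp) - t * slope (place (fst gp)) (place (fst qg))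
      <= xc (snd gp') - t * slope (place (fst gp')) (place (fst qg))).
  { apply bound_list. intros [q gs] Hq. apply bound_list. intros [g p] Hi. simpl in *.
    destruct (v_spot _ _ VG q gs Hq) as (_ & _ & _ & Hsel).
    assert (Hin : forall g p, In (g, p) (combine gs (spotpts L)) ->
      In (xc p, slope (place g) (place q)) (combine (map xc (spotpts L))
        (map (fun g => slope (place g) (place q)) gs))).
    { intros g0 p0 Hi0. apply combine_swap in Hi0.
      exact (combine_map xc (fun g => slope (place g) (place q)) _ _ _ _ Hi0). }
    destruct (Hsel _ _ (Hin g p Hi)) as (t & Ht & Hall). exists t. intros T HT. exists t.
    split; [lra|]. intros [g' p'] Hi'. apply Hall. auto. }
  destruct HT as [b HT]. set (T := Rmax b 0 + 1).
  assert (T_pos : 0 < T) by (unfold T; pose proof (Rmax_r b 0); lra).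
  assert (T_b : b < T) by (unfold T; pose proof (Rmax_l b 0); lra).
  assert (HH : exists h, forall H, h < H -> forall q, In q (spotpts G) -> forall g, In g (syms G) ->
    forall p, In p (verts L) -> T * slope (place g) (place q) < xc p + H).
  { apply bound_list; intros q _. apply bound_list; intros g _. apply bound_list; intros p _.
    exists (T * slope (place g) (place q) - xc p). intros; lra. }
  destruct HH as [h HH].
  assert (Ek : ev (fun k => valid (x0 :: xs) (step G L T (h + 1) k))).
  { apply step_valid; auto.
    - intros q g p Hq A Hp. apply HH; auto; [lra|]. now apply (v_adj _ _ VG) in A.
    - intros q g p (gs & Hq & Hi). destruct (HT T T_b _ Hq _ Hi) as (t & Ht & Hall).
      exists t. split; auto. intros g' p' (gs' & Hq' & Hi').
      rewrite <- (spot_unique G _ q gs gs' VG Hq Hq') in Hi'. exact (Hall _ Hi'). }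
  apply ev_ex in Ek. destruct Ek as (k & _ & V).
  exists (step G L T (h + 1) k). split; auto. split; [|split; [|split]].
  - simpl. unfold sspots. rewrite (length_flat_map_const _ _ F); [now rewrite PG|].
    intros [q gs] Hq. simpl. rewrite length_map, length_combine.
    destruct (v_spot _ _ VG q gs Hq) as (E & _). unfold spotpts in E. rewrite !length_map in E. lia.
  - simpl. now rewrite length_app, length_map, length_copies, PG, SG, SL.
  - simpl. unfold targets. rewrite length_app, length_map, length_copies, length_app.
    unfold spotpts. now rewrite length_map, PG, CG, CL.
  - rewrite <- PG, <- PL. now apply step_edges with xs.
Qed.

(** * Base configurations and removal of spots *)

Lemma good_isolated P c : good 0 P 0 c 0.
Proof.
  intros xs Exs _. apply length_zero_iff_nil in Exs. subst xs.
  set (C := Config nat (fun i => (INR i, 0)) [] (seq P c) (map (fun i => (i, [])) (seq 0 P))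
    (fun _ _ => False)).
  assert (Es : spotpts C = seq 0 P) by (unfold spotpts; simpl; rewrite map_map; apply map_id).
  exists C. split; [|simpl; rewrite length_map, !length_seq; repeat split; auto].
  - constructor; simpl; try tauto.
    + unfold verts, targets. rewrite Es. simpl.
      apply NoDup_app; try apply seq_NoDup. intros i. rewrite !in_seq. lia.
    + intros u v _ _ E. now apply INR_eq.
    + unfold xc; simpl. clear Es C. generalize 0%nat as n. induction P as [|P IH]; intros n; simpl; constructor; auto.
      apply Forall_forall. intros [j l] Hj. apply in_map_iff in Hj. destruct Hj as (i & E & Hi).
      inversion E; subst. apply in_seq in Hi. simpl. apply lt_INR. lia.
    + intros q gs Hq. apply in_map_iff in Hq. destruct Hq as (i & E & Hi). inversion E; subst.
      repeat split; try tauto; try constructor. intros x s [].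
  - exists []. repeat split; try constructor; tauto.
Qed.

Lemma sel_exists xs : StronglySorted Rlt xs -> exists ss,
  length ss = length xs /\ StronglySorted Rlt ss /\ sel (combine xs ss).
Proof.
  induction 1 as [|x xs S IH F].
  - exists []. repeat split; [constructor|intros ? ? []].
  - destruct IH as (ss & El & Ss & Hs). rewrite Forall_forall in F.
    destruct (sel_cons x 0 (combine xs ss)) as [B0 HB]; auto; [lra| |].
    { intros y s Hi. apply F. now apply in_combine_l in Hi. }
    destruct (bound_list ss (fun s B => 0 < s + B)) as [b Hb].
    { intros s _. exists (- s). intros; lra. }
    set (B := Rmax B0 b + 1). pose proof (Rmax_l B0 b). pose proof (Rmax_r B0 b).
    exists (0 :: map (fun s => s + B) ss). split; [simpl; now rewrite length_map, El|]. split.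
    + constructor.
      * clear - Ss. induction Ss as [|s ss S IH F]; simpl; constructor; auto.
        rewrite Forall_forall in *. intros t Ht. apply in_map_iff in Ht.
        destruct Ht as (u & <- & Hu). specialize (F u Hu). lra.
      * apply Forall_forall. intros t Ht. apply in_map_iff in Ht. destruct Ht as (u & <- & Hu).
        apply Hb; auto. unfold B; lra.
    + simpl. replace (combine xs (map (fun s => s + B) ss)) with
        (map (fun p : R * R => (fst p, snd p + B)) (combine xs ss)).
      * apply HB; [unfold B; lra|]. rewrite Rabs_R0. lra.
      * clear. revert ss. induction xs as [|y xs IH]; intros [|s ss]; simpl; auto. now rewrite IH.
Qed.

(** The spot is the origin and all symbols lie to its left, with slopes increasing from left to
    right; so each symbol is below the segments of the symbols further left. *)
Lemma good_pencil m : good m 1 m 0 0.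
Proof.
  intros xs Exs Sxs. destruct (sel_exists xs Sxs) as (ss & El & Ss & Hsel).
  rewrite Exs in El.
  set (pl := fun i : nat => (INR i - INR m, nth i ss 0 * (INR i - INR m))).
  set (C := Config nat pl (seq 0 m) [] [(m, seq 0 m)] (fun a d => d = m /\ (a < m)%nat)).
  assert (Hx : forall u : vtx C, xc u = INR u - INR m) by reflexivity.
  assert (Hlt : forall i, (i < m)%nat -> INR i < INR m) by (intros; now apply lt_INR).
  assert (Hsl : forall i, (i < m)%nat -> slope (pl i) (pl m) = nth i ss 0).
  { intros i Hi. apply Hlt in Hi. unfold slope, pl; simpl.
    rewrite (nth_overflow ss) by lia. field. lra. }
  assert (Hmono : forall i j, (i < j)%nat -> (j < m)%nat -> nth i ss 0 < nth j ss 0).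
  { clear - Ss El. rewrite <- El. clear El. induction Ss as [|s ss S IH F]; intros [|i] [|j] Hij Hj; simpl in *; try lia.
    - rewrite Forall_forall in F. apply F. apply nth_In. lia.
    - apply IH; lia. }
  exists C. split; [|split; [reflexivity|]; split; [simpl; now rewrite length_seq|]; split; [reflexivity|]].
  - constructor.
    + unfold verts, targets, spotpts; simpl. apply NoDup_app.
      * apply seq_NoDup. * repeat constructor; auto. * intros i Hi. apply in_seq in Hi. simpl. lia.
    + intros u v _ _ E. rewrite !Hx in E. apply INR_eq. lra.
    + intros a d [-> Ha]. split; [apply in_seq; lia|]. split; [now left|]. rewrite !Hx.
      specialize (Hlt a Ha). lra.
    + intros a d v [-> Ha] Hv [H1 H2]. rewrite !Hx in H1, H2.
      assert (Hav : (a < v)%nat) by (apply INR_lt; lra).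
      assert (Hvm : (v < m)%nat) by (apply INR_lt; lra).
      change (0 < det (pl a) (pl m) (pl v)). unfold det, pl; simpl.
      specialize (Hmono a v Hav Hvm).
      replace (_ - _) with ((nth v ss 0 - nth a ss 0) * ((INR m - INR v) * (INR m - INR a))) by ring.
      repeat apply Rmult_lt_0_compat; lra.
    + intros a d Ha Hd _ A. exfalso. apply A. destruct Hd as [<-|[]]. simpl in Ha.
      apply in_seq in Ha. split; auto. lia.
    + intros a b d d' [-> _] [-> _] _ _. auto.
    + repeat constructor.
    + intros q gs [E|[]]. inversion E; subst q gs. split; [simpl; now rewrite length_seq|].
      split; [apply seq_NoDup|]. split.
      * intros g. change (In (g : nat) (seq 0 m) <-> m = m /\ (g < m)%nat). rewrite in_seq.
        split; [intros [_ Hg]; split; auto|intros [_ Hg]; split; auto; apply Nat.le_0_l].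
      * replace (map _ _) with ss; auto. apply nth_ext with 0 0.
        -- now rewrite length_map, length_seq.
        -- intros i Hi. rewrite El in Hi.
           change (nth i ss 0 = nth i (map (fun g => slope (pl g) (pl m)) (seq 0 m)) 0).
           rewrite (nth_indep (map (fun g => slope (pl g) (pl m)) (seq 0 m)) 0 ((fun g => slope (pl g) (pl m)) 0%nat))
             by (now rewrite length_map, length_seq).
           symmetry. etransitivity; [apply (map_nth (fun g => slope (pl g) (pl m)))|].
           rewrite seq_nth by auto. now apply Hsl.
    + intros a q d _ [-> _] [-> _]. auto.
  - exists []. repeat split; try constructor; try tauto; destruct H.
Qed.

(** Every reason for being hidden quantifies over edges, so it survives the removal of edges. *)
Lemma good_erase m P s c e : good m P s c e -> good m 0 s c e.
Proof.
  intros HG xs Exs Sxs. destruct (HG xs Exs Sxs) as (G & V & _ & ES & EC & l & N & El & Hl).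
  set (C := Config (vtx G) place (syms G) (cols G) [] (fun a d => adj a d /\ In d (cols G))).
  assert (Et : forall v : vtx G, In v (targets C) <-> In v (cols G))
    by (intros v; unfold targets; simpl; now rewrite app_nil_r).
  assert (Ht : forall v : vtx G, In v (targets C) -> In v (targets G)).
  { intros v Hv. apply Et in Hv. unfold targets. apply in_or_app; auto. }
  assert (Hv : forall v : vtx G, In v (verts C) -> In v (verts G)).
  { intros v Hin. apply in_app_or in Hin. apply in_or_app. destruct Hin; auto. }
  exists C. split; [|repeat split; auto].
  - constructor; simpl; try tauto.
    + unfold verts, targets; simpl. rewrite app_nil_r. pose proof (v_nodup _ _ V) as ND.
      unfold verts, targets in ND. rewrite app_assoc in ND. now apply NoDup_app_remove_r in ND.
    + intros u v Hu Hu'. apply (v_xinj _ _ V); auto.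
    + intros a d [A Hd]. rewrite Et. apply (v_adj _ _ V) in A. unfold xc in *; simpl. tauto.
    + intros a d v [A Hd] Hv' Hx. apply (v_below _ _ V); auto.
    + intros a d Ha Hd Hx A. assert (Hd' := Hd). apply Et in Hd'.
      destruct (v_block _ _ V a d) as [(p & Hp & Hpd & Hu)|[Hs|[_ Hb]]]; auto.
      * left. exists p. split; auto. split; auto. intros a' d' [A' _]. now apply Hu.
      * right; left. intros d' [A' _]. now apply Hs.
      * right; right. split; auto. intros b [A' _]. now apply Hb.
    + intros a b d d' [? _] [? _] [? _] [? _]. now apply (v_k22 _ _ V).
    + constructor.
  - exists l. split; [exact N|]. split; [exact El|]. intros a d Hi.
    specialize (Hl a d Hi). simpl. tauto.
Qed.

(** * Ackermann growth *)

Open Scope nat_scope.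

Lemma ack_S_0 k : ack (S k) 0 = ack k 1.
Proof. reflexivity. Qed.

Lemma ack_S_S k n : ack (S k) (S n) = ack k (ack (S k) n).
Proof. reflexivity. Qed.

Lemma ack_gt k : forall n, n < ack k n.
Proof.
  induction k as [|k IH]; [simpl; lia|]. induction n as [|n IHn].
  - rewrite ack_S_0. specialize (IH 1). lia.
  - rewrite ack_S_S. specialize (IH (ack (S k) n)). lia.
Qed.

Lemma ack_lt_S k n : ack k n < ack k (S n).
Proof. destruct k; [simpl; lia|]. rewrite ack_S_S. apply ack_gt. Qed.

Lemma ack_mono_r k n n' : n <= n' -> ack k n <= ack k n'.
Proof. induction 1 as [|n' _ IH]; auto. pose proof (ack_lt_S k n'). lia. Qed.

Lemma ack_le_S k n : ack k n <= ack (S k) n.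
Proof.
  destruct n as [|n]; [rewrite ack_S_0; apply ack_mono_r; lia|].
  rewrite ack_S_S. apply ack_mono_r. apply ack_gt.
Qed.

Lemma ack_mono_l k k' n : k <= k' -> ack k n <= ack k' n.
Proof. induction 1 as [|k' _ IH]; auto. pose proof (ack_le_S k' n). lia. Qed.

Lemma ack_1 n : ack 1 n = n + 2.
Proof. induction n as [|n IH]; auto. rewrite ack_S_S, IH. simpl. lia. Qed.

Lemma ack_2 n : ack 2 n = 2 * n + 3.
Proof. induction n as [|n IH]; auto. rewrite ack_S_S, IH, ack_1. lia. Qed.

Lemma ack_3_sqr n : n * n <= ack 3 n.
Proof.
  induction n as [|n IH]; [simpl; lia|]. rewrite ack_S_S, ack_2. nia.
Qed.

Lemma pow2_ack k : 2 ^ k <= ack (k + 2) 1.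
Proof.
  induction k as [|k IH]; [simpl; lia|].
  change (S k + 2) with (S (k + 2)). rewrite ack_S_S, ack_S_0.
  assert (H : ack 2 (ack (k + 2) 1) <= ack (k + 2) (ack (k + 2) 1)) by (apply ack_mono_l; lia).
  rewrite ack_2 in H. simpl. lia.
Qed.

(** For [a = ack k n] the product is at most [a * a], which [ack k a] dominates, and this iterate of
    [ack k] is absorbed by the two higher levels. *)
Lemma mul_ack k n : 3 <= k -> n * ack k n <= ack (k + 2) n.
Proof.
  intros Hk. destruct n as [|n]; [lia|].
  set (a := ack k (S n)). assert (Ha : S n <= a) by (unfold a; pose proof (ack_gt k (S n)); lia).
  assert (H1 : S n * a <= a * a) by nia.
  pose proof (ack_3_sqr a) as H2.
  assert (H3 : ack 3 a <= ack k a) by (apply ack_mono_l; auto).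
  assert (H4 : ack k a <= ack (S k) (S (S n))).
  { rewrite ack_S_S. apply ack_mono_r. apply ack_le_S. }
  assert (H5 : ack (S k) (S (S n)) <= ack (k + 2) (S n)).
  { replace (k + 2) with (S (S k)) by lia. rewrite (ack_S_S (S k) n). apply ack_mono_r.
    assert (H : ack 1 n <= ack (S (S k)) n) by (apply ack_mono_l; lia).
    rewrite ack_1 in H. lia. }
  lia.
Qed.

Lemma inv_ack_le n k : n <= ack k k -> inv_ack n <= k.
Proof.
  intros Hn. unfold inv_ack.
  assert (H : forall f j, j <= k -> inv_ack_search f j n <= k).
  { induction f as [|f IH]; intros j Hj; simpl; auto.
    destruct (Nat.leb_spec n (ack j j)) as [?|Hlt]; auto.
    apply IH. destruct (Nat.eq_dec j k) as [->|]; lia. }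
  apply H. lia.
Qed.

(** The number of spots of the [i]-th level construction with [m] symbols in
    each spot. *)
Fixpoint nspots (i : nat) : nat -> nat :=
  match i with
  | O => fun _ => 1
  | S i' => fix nsp (m : nat) : nat :=
      match m with
      | O => 2 ^ S i'
      | S m' => nspots i' (nsp m') * nsp m'
      end
  end.

Lemma nspots_S_S i m : nspots (S i) (S m) = nspots i (nspots (S i) m) * nspots (S i) m.
Proof. reflexivity. Qed.

Lemma nspots_ge i m : 2 ^ i <= nspots i m.
Proof.
  revert m. induction i as [|i IH]; [simpl; lia|].
  induction m as [|m IHm]; [simpl; lia|].
  rewrite nspots_S_S. specialize (IH (nspots (S i) m)).
  assert (0 < 2 ^ i) by (apply Nat.neq_0_lt_0, Nat.pow_nonzero; lia). nia.
Qed.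

(** Each level costs three: two for the factor [F] by [mul_ack], and one for the recursion over
    [m]. *)
Lemma nspots_ack i m : nspots i m <= ack (3 + 3 * i) m.
Proof.
  revert m. induction i as [|i IH]; intros m.
  - assert (H : ack 2 m <= ack 3 m) by apply ack_le_S. rewrite ack_2 in H. simpl nspots. simpl Nat.mul.
    rewrite Nat.add_0_r. lia.
  - induction m as [|m IHm].
    + change (nspots (S i) 0) with (2 ^ S i). pose proof (pow2_ack (S i)) as H.
      rewrite <- ack_S_0 in H. etransitivity; [exact H|]. apply ack_mono_l. lia.
    + rewrite nspots_S_S. set (F := nspots (S i) m) in *.
      assert (H1 : nspots i F * F <= F * ack (3 + 3 * i) F) by (specialize (IH F); nia).
      assert (H2 := mul_ack (3 + 3 * i) F ltac:(lia)).
      replace (3 + 3 * S i) with (S (3 + 3 * i + 2)) in * by lia.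
      rewrite ack_S_S. etransitivity; [exact H1|]. etransitivity; [exact H2|]. now apply ack_mono_r.
Qed.

(** Symbols see at least [i] columns on average, each level adding one. The ratio of columns to
    symbols is at most 1 - 2^(-i): the [P] spots turned into columns are at most a fraction 2^(-i-1)
    of the [P * F] symbols of the larger configuration, as [F] is at least [2 ^ S i]. This is why
    the recursion over [m] starts from that many empty spots. *)
Lemma good_levels i : forall m, exists c e, let s := m * nspots i m in
  good m (nspots i m) s c e /\ c * 2 ^ i <= s * (2 ^ i - 1) /\ i * s <= e.
Proof.
  induction i as [|i IHi]; intros m.
  - exists 0, 0. simpl. rewrite Nat.mul_1_r. split; [apply good_pencil|lia].
  - induction m as [|m IHm].
    + exists 0, 0. split; [apply good_isolated|]. lia.
    + destruct IHm as (cL & eL & GL & HcL & HeL).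
      set (F := nspots (S i) m) in *.
      destruct (IHi F) as (cG & eG & GG & HcG & HeG).
      set (P := nspots i F) in *.
      exists (cG + P + P * cL), (eG + P * F + P * eL). cbv zeta.
      rewrite nspots_S_S. fold F P. split; [|split].
      * replace (S m * (P * F)) with (F * P + P * (m * F)) by ring.
        exact (good_step _ _ _ _ _ _ _ _ _ GG GL).
      * pose proof (nspots_ge (S i) m) as HF. fold F in HF.
        assert (HD : 0 < 2 ^ i) by (apply Nat.neq_0_lt_0, Nat.pow_nonzero; lia).
        rewrite Nat.pow_succ_r' in *. set (D := 2 ^ i) in *.
        assert (E1 : D - 1 + 1 = D) by lia. set (D1 := D - 1) in *.
        replace (2 * D - 1) with (2 * D1 + 1) in * by lia.
        clearbody D1. subst D. rewrite <- E1 in *. clear HD E1 HeG HeL.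
        assert (H1 : P * (2 * (D1 + 1)) <= P * F) by (apply Nat.mul_le_mono_l; auto).
        assert (H2 : P * (cL * (2 * (D1 + 1))) <= P * (m * F * (2 * D1 + 1)))
          by (apply Nat.mul_le_mono_l; auto).
        nia.
      * assert (H2 : P * (S i * (m * F)) <= P * eL) by (apply Nat.mul_le_mono_l; auto). nia.
Qed.

(** * Configurations with a prescribed number of vertices *)

Lemma good_levels_1 i : 1 <= i -> exists s c e,
  good 1 0 s c e /\ i <= s /\ c <= s /\ i * s <= e /\ (i = 1 -> s = 1 /\ c = 1 /\ e = 1) /\
  s <= ack (3 + 3 * i) 1.
Proof.
  intros Hi. destruct (Nat.eq_dec i 1) as [->|Hne].
  (* A single edge replaces level 1 of the recursion, which is larger: with the one additional
     vertex per copy it fits into every [n >= 3]. *)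
  - exists 1, 1, 1. split; [|split; [lia|split; [lia|split; [lia|split; [lia|]]]]].
    + apply good_erase with 1.
      exact (good_step 1 0 1 1 0 0 0 0 0 (good_pencil 1) (good_isolated 1 0)).
    + pose proof (ack_gt (3 + 3 * 1) 1). lia.
  - destruct (good_levels i 1) as (c & e & HG & Hc & He).
    rewrite Nat.mul_1_l in *. exists (nspots i 1), c, e.
    split; [now apply good_erase with (nspots i 1)|].
    assert (HD : 0 < 2 ^ i) by (apply Nat.neq_0_lt_0, Nat.pow_nonzero; lia).
    split; [pose proof (nspots_ge i 1); pose proof (Nat.pow_gt_lin_r 2 i); lia|].
    split; [nia|]. split; [auto|]. split; [lia|]. apply nspots_ack.
Qed.

(** Level [I] has at least [I] symbols, so a value of [I] above [n] leaves only the second case: a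
    level that fits into [n] while the next one does not. *)
Lemma level_bracket n I : 3 <= n -> 1 <= I ->
  (exists s c e, good 1 0 s c e /\ I <= s /\ c <= s /\ I * s <= e /\ s + c + 1 <= n) \/
  (exists i s c e s' c', 1 <= i /\ good 1 0 s c e /\ i <= s /\ c <= s /\ i * s <= e /\
    s + c + 1 <= n /\ n < s' + c' + 1 /\ c' <= s' /\ s' <= ack (3 + 3 * S i) 1).
Proof.
  intros Hn. induction 1 as [|I HI IH].
  - left. destruct (good_levels_1 1) as (s & c & e & HG & H1 & H2 & H3 & H4 & _); [lia|].
    exists s, c, e. repeat split; auto. lia.
  - destruct IH as [(s & c & e & HG & H1 & H2 & H3 & H4)|IH]; [|now right].
    destruct (good_levels_1 (S I)) as (s' & c' & e' & HG' & H1' & H2' & H3' & _ & H5'); [lia|].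
    destruct (le_lt_dec (s' + c' + 1) n) as [Hle|Hlt].
    + left. exists s', c', e'. auto.
    + right. exists I, s, c, e, s', c'. repeat split; auto.
Qed.

Theorem config_exists n : 1 <= n -> exists xs G e,
  valid xs G /\ spots G = [] /\ length (syms G) + length (cols G) = n /\ has_edges G e /\
  inv_ack n * n <= 60 * e.
Proof.
  intros Hn.
  assert (Hfin : forall m s c e, good m 0 s c e -> s + c = n -> inv_ack n * n <= 60 * e ->
    exists xs G e, valid xs G /\ spots G = [] /\ length (syms G) + length (cols G) = n /\
      has_edges G e /\ inv_ack n * n <= 60 * e).
  { intros m s c e HG Hsc He.
    destruct (HG (map INR (seq 0 m))) as (G & V & HP & HS & HC & HE).
    - now rewrite length_map, length_seq.
    - generalize 0. clear. induction m as [|m IH]; intros j; simpl; constructor; auto.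
      apply Forall_forall. intros x Hx. apply in_map_iff in Hx. destruct Hx as (i & <- & Hi).
      apply in_seq in Hi. apply lt_INR. lia.
    - exists (map INR (seq 0 m)), G, e. apply length_zero_iff_nil in HP.
      rewrite HS, HC. auto. }
  destruct (le_lt_dec n 2) as [Hn2|Hn2].
  - destruct (Nat.eq_dec n 1) as [->|Hne].
    + apply (Hfin 0 0 1 0); [apply (good_isolated 0 1)|lia|].
      change (inv_ack 1) with 0. lia.
    + destruct (good_levels_1 1) as (s & c & e & HG & H1 & H2 & H3 & H4 & _); [lia|].
      apply (Hfin _ _ _ _ HG); [lia|]. assert (n = 2) by lia. subst n.
      change (inv_ack 2) with 1. lia.
  - destruct (level_bracket n (S n)) as [(s & c & e & _ & H1 & _ & _ & H2)|Hb]; try lia.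
    destruct Hb as (i & s & c & e & s' & c' & Hi & HG & H1 & H2 & H3 & H4 & H5 & H6 & H7).
    (* The additional vertex is the isolated spot next to which a copy is placed. *)
    set (N := s + c + 1) in *.
    set (k := n / N). set (r := n mod N).
    assert (En : n = N * k + r) by (apply Nat.div_mod_eq).
    assert (Hr : r < N) by (apply Nat.mod_upper_bound; lia).
    assert (Hk : 1 <= k) by (apply Nat.div_le_lower_bound; lia).
    (* Disjoint copies at [k] isolated spots, together with [r] isolated columns, have exactly [n]
       vertices. *)
    pose proof (good_step 0 1 k 0 r 0 s c e (good_isolated k r) HG) as HW.
    rewrite Nat.mul_0_r in HW.
    apply (Hfin _ _ _ _ HW); [unfold N in *; lia|].
    (* Since the next level does not fit, [n] is at most [2 * s'], and [s'] is bounded by the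
       Ackermann function. *)
    assert (Ha : inv_ack n <= 3 * i + 7).
    { apply inv_ack_le.
      assert (B1 : n <= 2 * s' + 1) by lia.
      assert (B2 : 2 * s' + 3 <= ack (3 * i + 6) s').
      { rewrite <- ack_2. apply ack_mono_l. lia. }
      replace (3 + 3 * S i) with (3 * i + 6) in H7 by lia.
      assert (B3 : ack (3 * i + 6) s' <= ack (3 * i + 7) 2).
      { replace (3 * i + 7) with (S (3 * i + 6)) by lia. rewrite ack_S_S. apply ack_mono_r.
        etransitivity; [exact H7|apply ack_le_S]. }
      assert (B4 : ack (3 * i + 7) 2 <= ack (3 * i + 7) (3 * i + 7)) by (apply ack_mono_r; lia).
      lia. }
    (* From [N <= 3 * s] and [n < 2 * k * N]. Together with [3 * i + 7 <= 10 * i] this gives the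
       constant 60. *)
    assert (B : n <= 6 * (k * s)) by (unfold N in *; nia).
    assert (B' : k * (i * s) <= k * e) by (apply Nat.mul_le_mono_l; auto).
    assert (B'' : inv_ack n * n <= 10 * i * (6 * (k * s))) by (apply Nat.mul_le_mono; lia).
    nia.
Qed.

Close Scope nat_scope.

(** * Curves and pseudolines in the plane *)

Lemma dist2_fst p q : Rabs (fst p - fst q) <= dist2 p q.
Proof.
  unfold dist2. rewrite <- sqrt_Rsqr_abs. apply sqrt_le_1_alt. unfold Rsqr.
  pose proof (pow2_ge_0 (snd p - snd q)). simpl. lra.
Qed.

Lemma dist2_snd p q : Rabs (snd p - snd q) <= dist2 p q.
Proof.
  unfold dist2. rewrite <- sqrt_Rsqr_abs. apply sqrt_le_1_alt. unfold Rsqr.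
  pose proof (pow2_ge_0 (fst p - fst q)). simpl. lra.
Qed.

Lemma dist2_le p q : dist2 p q <= Rabs (fst p - fst q) + Rabs (snd p - snd q).
Proof.
  pose proof (Rabs_pos (fst p - fst q)). pose proof (Rabs_pos (snd p - snd q)).
  unfold dist2. rewrite <- (sqrt_pow2 (Rabs (fst p - fst q) + Rabs (snd p - snd q))) by lra.
  apply sqrt_le_1_alt. rewrite <- (pow2_abs (fst p - fst q)), <- (pow2_abs (snd p - snd q)). nra.
Qed.

Lemma cont_pair (u v : R -> R) : continuity u -> continuity v -> cont (fun t => (u t, v t)).
Proof.
  intros Hu Hv x eps He.
  destruct (Hu x (eps / 2)) as (d1 & Hd1 & H1); [lra|].
  destruct (Hv x (eps / 2)) as (d2 & Hd2 & H2); [lra|].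
  exists (Rmin d1 d2). split; [now apply Rmin_glb_lt|]. intros y Hy.
  pose proof (Rmin_l d1 d2). pose proof (Rmin_r d1 d2).
  assert (B1 : Rabs (u y - u x) < eps / 2).
  { destruct (Req_dec x y) as [->|Hne]; [rewrite Rminus_diag, Rabs_R0; lra|].
    apply (H1 y). repeat split; auto. simpl. unfold Rdist. lra. }
  assert (B2 : Rabs (v y - v x) < eps / 2).
  { destruct (Req_dec x y) as [->|Hne]; [rewrite Rminus_diag, Rabs_R0; lra|].
    apply (H2 y). repeat split; auto. simpl. unfold Rdist. lra. }
  pose proof (dist2_le (u y, v y) (u x, v x)). simpl in *. lra.
Qed.

Lemma cont_fst f : cont f -> continuity (fun t => fst (f t)).
Proof.
  intros Hf x eps He. destruct (Hf x eps He) as (d & Hd & H). exists d. split; auto.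
  intros y [_ Hy]. simpl in *. unfold Rdist in *. specialize (H y Hy).
  pose proof (dist2_fst (f y) (f x)). lra.
Qed.

Lemma cont_snd f : cont f -> continuity (fun t => snd (f t)).
Proof.
  intros Hf x eps He. destruct (Hf x eps He) as (d & Hd & H). exists d. split; auto.
  intros y [_ Hy]. simpl in *. unfold Rdist in *. specialize (H y Hy).
  pose proof (dist2_snd (f y) (f x)). lra.
Qed.

Lemma continuity_Rabs (f : R -> R) : continuity f -> continuity (fun x => Rabs (f x)).
Proof. intros H. apply (continuity_comp f Rabs); auto. apply Rcontinuity_abs. Qed.

Lemma Rmax_abs x y : Rmax x y = (x + y + Rabs (x - y)) / 2.
Proof. unfold Rmax, Rabs. destruct (Rle_dec x y), (Rcase_abs (x - y)); lra. Qed.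

Lemma Rmin_abs x y : Rmin x y = (x + y - Rabs (x - y)) / 2.
Proof. unfold Rmin, Rabs. destruct (Rle_dec x y), (Rcase_abs (x - y)); lra. Qed.

Lemma continuity_ext (f g : R -> R) : (forall x, f x = g x) -> continuity f -> continuity g.
Proof.
  intros E Hf x eps He. destruct (Hf x eps He) as (d & Hd & H). exists d. split; auto.
  intros y Hy. rewrite <- !E. auto.
Qed.

Lemma continuity_id : continuity (fun x => x).
Proof. apply derivable_continuous, derivable_id. Qed.

Lemma continuity_cst (c : R) : continuity (fun _ => c).
Proof. apply continuity_const. intros ? ?; reflexivity. Qed.

Lemma continuity_scal' (c : R) (f : R -> R) : continuity f -> continuity (fun x => c * f x).
Proof. intros H. apply (continuity_scal f c H). Qed.

Lemma continuity_Rmax (f g : R -> R) : continuity f -> continuity g ->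
  continuity (fun x => Rmax (f x) (g x)).
Proof.
  intros Hf Hg.
  apply continuity_ext with (fun x => / 2 * (f x + g x + Rabs (f x - g x))).
  - intros x. rewrite Rmax_abs. lra.
  - apply continuity_scal'.
    apply (continuity_plus (fun x => f x + g x) (fun x => Rabs (f x - g x))).
    + now apply continuity_plus.
    + apply continuity_Rabs. now apply continuity_minus.
Qed.

Lemma continuity_Rmin (f g : R -> R) : continuity f -> continuity g ->
  continuity (fun x => Rmin (f x) (g x)).
Proof.
  intros Hf Hg.
  apply continuity_ext with (fun x => / 2 * (f x + g x - Rabs (f x - g x))).
  - intros x. rewrite Rmin_abs. lra.
  - apply continuity_scal'.
    apply (continuity_minus (fun x => f x + g x) (fun x => Rabs (f x - g x))).
    + now apply continuity_plus.
    + apply continuity_Rabs. now apply continuity_minus.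
Qed.

Lemma continuity_sqrt (f : R -> R) : (forall x, 0 <= f x) -> continuity f ->
  continuity (fun x => sqrt (f x)).
Proof.
  intros Hf Hc x. apply (continuity_pt_comp f sqrt); [apply Hc|]. now apply continuity_pt_sqrt.
Qed.

Definition sqn (z : pt) : R := fst z * fst z + snd z * snd z.

Lemma norm2_sqn z : norm2 z = sqrt (sqn z).
Proof. unfold norm2, dist2, sqn. simpl. f_equal. ring. Qed.

Lemma sqn_pos z : 0 <= sqn z.
Proof. unfold sqn. nra. Qed.

(** A closed curve obtained from a circle by a homeomorphism of the plane
    which moves all points by a bounded amount. *)
Section Homeo.
Variables (Psi Phi : pt -> pt) (rho D : R).
Hypothesis Phi_Psi : forall z, Phi (Psi z) = z.
Hypothesis Psi_Phi : forall z, Psi (Phi z) = z.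
Hypothesis Psi_cont : forall p, cont p -> cont (fun t => Psi (p t)).
Hypothesis Phi_cont : forall p, cont p -> cont (fun t => Phi (p t)).
Hypothesis Psi_bound : forall z, norm2 z <= norm2 (Psi z) + D.
Hypothesis Psi_bound' : forall z, norm2 (Psi z) <= norm2 z + D.
Hypothesis rho_pos : 0 < rho.

Definition circle (t : R) : pt := (rho * cos (2 * PI * t), rho * sin (2 * PI * t)).
Definition curve (t : R) : pt := Psi (circle t).

Lemma sqn_circle t : sqn (circle t) = rho * rho.
Proof.
  unfold sqn, circle; simpl. pose proof (sin2_cos2 (2 * PI * t)) as H. unfold Rsqr in H.
  replace (_ + _) with (rho * rho * (sin (2 * PI * t) * sin (2 * PI * t)
    + cos (2 * PI * t) * cos (2 * PI * t))) by ring.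
  rewrite H. ring.
Qed.

Lemma circle_onto z : sqn z = rho * rho -> exists t, circle t = z.
Proof.
  intros H. destruct z as [x y]. unfold sqn in H; simpl in H.
  assert (Hx : -1 <= x / rho <= 1).
  { split.
    - apply Rmult_le_reg_r with rho; auto. replace (x / rho * rho) with x by (field; lra). nra.
    - apply Rmult_le_reg_r with rho; auto. replace (x / rho * rho) with x by (field; lra). nra. }
  pose proof PI_RGT_0 as HPI.
  set (th := acos (x / rho)).
  assert (Ec : rho * cos th = x) by (unfold th; rewrite cos_acos by auto; field; lra).
  assert (Es : (rho * sin th) * (rho * sin th) = y * y).
  { pose proof (sin2_cos2 th) as E. unfold Rsqr in E. rewrite <- Ec in H. nra. }
  assert (Hy : y = rho * sin th \/ y = - (rho * sin th)).
  { destruct (Req_dec y (rho * sin th)) as [?|Hne]; auto. right.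
    assert ((y - rho * sin th) * (y + rho * sin th) = 0) by lra.
    apply Rmult_integral in H0. lra. }
  destruct Hy as [Hy|Hy].
  - exists (th / (2 * PI)). unfold circle. replace (2 * PI * (th / (2 * PI))) with th by (field; lra).
    now rewrite Ec, <- Hy.
  - exists (- th / (2 * PI)). unfold circle.
    replace (2 * PI * (- th / (2 * PI))) with (- th) by (field; lra).
    rewrite cos_neg, sin_neg, Ec. f_equal. lra.
Qed.

Lemma circle_inj s t : 0 <= s < 1 -> 0 <= t < 1 -> circle s = circle t -> s = t.
Proof.
  intros Hs Ht E. unfold circle in E. inversion E as [[E1 E2]].
  apply Rmult_eq_reg_l in E1, E2; try lra. pose proof PI_RGT_0 as HPI.
  assert (Hc : cos (2 * (PI * (s - t))) = 1).
  { replace (2 * (PI * (s - t))) with (2 * PI * s - 2 * PI * t) by ring.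
    rewrite cos_minus, E1, E2. pose proof (sin2_cos2 (2 * PI * t)) as H. unfold Rsqr in H. lra. }
  rewrite cos_2a_sin in Hc.
  assert (Hz : sin (PI * (s - t)) = 0) by nra.
  destruct (Rtotal_order s t) as [Hlt|[?|Hlt]]; auto; exfalso.
  - assert (0 < sin (PI * (t - s))) by (apply sin_gt_0; nra).
    replace (PI * (s - t)) with (- (PI * (t - s))) in Hz by ring. rewrite sin_neg in Hz. lra.
  - assert (0 < sin (PI * (s - t))) by (apply sin_gt_0; nra). lra.
Qed.

Lemma cont_circle : cont circle.
Proof. apply cont_pair; reg. Qed.

Lemma curve_jordan : jordan_param curve.
Proof.
  split; [|split].
  - apply Psi_cont. exact cont_circle.
  - intros t. unfold curve, circle.
    replace (2 * PI * (t + 1)) with (2 * PI * t + 2 * INR 1 * PI) by (simpl; ring).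
    now rewrite cos_period, sin_period.
  - intros s t Hs Ht E. unfold curve in E. apply (f_equal Phi) in E. rewrite !Phi_Psi in E.
    now apply circle_inj.
Qed.

Lemma on_curve p : image curve p <-> sqn (Phi p) = rho * rho.
Proof.
  split.
  - intros (t & <-). unfold curve. rewrite Phi_Psi. apply sqn_circle.
  - intros E. destruct (circle_onto _ E) as (t & Et). exists t. unfold curve. now rewrite Et, Psi_Phi.
Qed.

Lemma sqn_norm2 z : sqn z = norm2 z * norm2 z.
Proof. rewrite norm2_sqn. symmetry. apply sqrt_def, sqn_pos. Qed.

Lemma norm2_pos z : 0 <= norm2 z.
Proof. rewrite norm2_sqn. apply sqrt_pos. Qed.

(** By [Psi_bound'] a far point has a far preimage, so in the coordinates given by [Phi] a path to
    it has to cross the circle. *)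
Lemma inside_not_exterior p : sqn (Phi p) <= rho * rho -> ~ exterior (image curve) p.
Proof.
  intros Hp (Hn & Hj). rewrite on_curve in Hn.
  destruct (Hj (rho + D)) as (y & Hy & path & Cp & P0 & P1 & Hav).
  set (h := fun t => sqn (Phi (path t)) - rho * rho).
  assert (Ch : continuity h).
  { unfold h, sqn. assert (C1 := cont_fst _ (Phi_cont _ Cp)). assert (C2 := cont_snd _ (Phi_cont _ Cp)).
    apply (continuity_minus (fun t => fst (Phi (path t)) * fst (Phi (path t))
      + snd (Phi (path t)) * snd (Phi (path t))) (fun t => rho * rho)); [|apply continuity_cst].
    apply (continuity_plus (fun t => fst (Phi (path t)) * fst (Phi (path t)))
      (fun t => snd (Phi (path t)) * snd (Phi (path t)))).
    - now apply (continuity_mult (fun t => fst (Phi (path t))) (fun t => fst (Phi (path t)))).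
    - now apply (continuity_mult (fun t => snd (Phi (path t))) (fun t => snd (Phi (path t)))). }
  assert (H0 : h 0 < 0) by (unfold h; rewrite P0; lra).
  assert (H1 : 0 < h 1).
  { unfold h. rewrite P1, sqn_norm2. pose proof (Psi_bound' (Phi y)) as B. rewrite Psi_Phi in B. nra. }
  destruct (IVT h 0 1 Ch) as (z & Hz & Ez); auto; [lra|].
  apply (Hav z Hz). rewrite on_curve. unfold h in Ez. lra.
Qed.

(** In the coordinates given by [Phi], moving radially outwards avoids the circle; the image of this
    ray is unbounded by [Psi_bound]. *)
Lemma outside_exterior p : rho * rho < sqn (Phi p) -> exterior (image curve) p.
Proof.
  intros Hp. split; [rewrite on_curve; lra|]. intros M.
  set (z := Phi p) in *.
  assert (Hz : 0 < norm2 z).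
  { pose proof (norm2_pos z). rewrite sqn_norm2 in Hp. nra. }
  set (l := (Rabs (M + D) + 1) / norm2 z).
  assert (Hl : 0 < l).
  { unfold l. apply Rdiv_lt_0_compat; auto. pose proof (Rabs_pos (M + D)). lra. }
  assert (Hs : forall c, sqn (c * fst z, c * snd z) = c * c * sqn z)
    by (intros c; unfold sqn; simpl; ring).
  exists (Psi ((1 + 1 * l) * fst z, (1 + 1 * l) * snd z)). split.
  - pose proof (Psi_bound ((1 + 1 * l) * fst z, (1 + 1 * l) * snd z)) as B.
    rewrite norm2_sqn, Hs in B. rewrite sqrt_mult_alt in B by nra.
    rewrite sqrt_square in B by lra. rewrite <- norm2_sqn in B.
    assert (E : l * norm2 z = Rabs (M + D) + 1) by (unfold l; field; lra).
    pose proof (Rle_abs (M + D)). lra.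
  - exists (fun r => Psi ((1 + r * l) * fst z, (1 + r * l) * snd z)). split; [|split; [|split]].
    + apply (Psi_cont (fun r => ((1 + r * l) * fst z, (1 + r * l) * snd z))). apply cont_pair; reg.
    + rewrite <- (Psi_Phi p). fold z. destruct z as [x y]. simpl. do 2 f_equal; ring.
    + reflexivity.
    + intros r Hr. rewrite on_curve, Phi_Psi, Hs.
      assert (1 <= (1 + r * l) * (1 + r * l)) by nra. pose proof (sqn_pos z). nra.
Qed.

End Homeo.

(** * Graphs and bent lines as pseudolines *)

Lemma crossing_not_joinable (l : R -> R) (x y : pt) : continuity l ->
  (snd x < l (fst x) /\ l (fst y) < snd y) \/ (l (fst x) < snd x /\ snd y < l (fst y)) ->
  ~ joinable (image (fun t => (t, l t))) x y.
Proof.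
  intros Cl Hs (path & Cp & P0 & P1 & Hav).
  assert (Ch : continuity (fun t => snd (path t) - l (fst (path t)))).
  { apply (continuity_minus (fun t => snd (path t)) (fun t => l (fst (path t)))).
    - now apply cont_snd.
    - apply (continuity_comp (fun t => fst (path t)) l); auto. now apply cont_fst. }
  assert (Hz : exists z, 0 <= z <= 1 /\ snd (path z) - l (fst (path z)) = 0).
  { destruct Hs as [[H0 H1]|[H0 H1]].
    - destruct (IVT _ 0 1 Ch) as (z & Hz & Ez); [lra|rewrite P0; lra|rewrite P1; lra|eauto].
    - destruct (IVT (fun t => - (snd (path t) - l (fst (path t)))) 0 1) as (z & Hz & Ez).
      + now apply (continuity_opp (fun t => snd (path t) - l (fst (path t)))).
      + lra. + rewrite P0; lra. + rewrite P1; lra. + exists z. split; [auto|lra]. }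
  destruct Hz as (z & Hz & Ez). apply (Hav z Hz). exists (fst (path z)).
  destruct (path z) as [u v]; simpl in *. f_equal. lra.
Qed.

Lemma graph_pseudoline (l : R -> R) : continuity l -> pseudoline (fun t => (t, l t)).
Proof.
  intros Cl. split; [|split].
  - apply cont_pair; auto. apply continuity_id.
  - intros s t E. congruence.
  - intros M. exists (Rabs M). intros t Ht. pose proof (dist2_fst (t, l t) (0, 0)) as B.
    simpl in B. rewrite Rminus_0_r in B. unfold norm2. pose proof (Rle_abs M). lra.
Qed.

Lemma graph_crossing (l1 l2 : R -> R) (z : R) : continuity l1 -> continuity l2 ->
  l1 z = l2 z -> ((forall x, x < z -> l2 x < l1 x) /\ (forall x, z < x -> l1 x < l2 x)) \/
    ((forall x, x < z -> l1 x < l2 x) /\ (forall x, z < x -> l2 x < l1 x)) ->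
  (exists p, image (fun t => (t, l1 t)) p /\ image (fun t => (t, l2 t)) p /\
    forall q, image (fun t => (t, l1 t)) q -> image (fun t => (t, l2 t)) q -> q = p) /\
  (forall s t, (s, l1 s) = (t, l2 t) -> crosses_at (fun t => (t, l1 t)) (fun t => (t, l2 t)) t).
Proof.
  intros C1 C2 Ez Hs.
  assert (Hu : forall x, l1 x = l2 x -> x = z).
  { intros x Ex. destruct (Rtotal_order x z) as [Hlt|[?|Hlt]]; auto; exfalso;
    destruct Hs as [[H1 H2]|[H1 H2]];
    first [specialize (H1 x Hlt); lra | specialize (H2 x Hlt); lra]. }
  split.
  - exists (z, l1 z). split; [now exists z|]. split; [exists z; congruence|].
    intros q (s & <-) (t & E). injection E as E1 E2. subst t. now rewrite (Hu s).
  - intros s t E. inversion E as [[E1 E2]]. subst s. apply Hu in E2. subst t.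
    unfold crosses_at. apply crossing_not_joinable; auto. simpl.
    destruct Hs as [[H1 H2]|[H1 H2]]; [left|right]; split; first [apply H1; lra | apply H2; lra].
Qed.

(** Beyond the abscissa [Rb], where all vertices lie to its left, the lines
    are bent slightly so that parallel ones cross as well. *)
Definition bent (Rb th : R) (mk : R * R) (x : R) : R :=
  fst mk * x + snd mk - th * snd mk * Rmax 0 (x - Rb).

Lemma continuity_bent Rb th mk : continuity (bent Rb th mk).
Proof.
  unfold bent.
  apply (continuity_minus (fun x => fst mk * x + snd mk) (fun x => th * snd mk * Rmax 0 (x - Rb))).
  - reg.
  - apply continuity_scal'. apply (continuity_Rmax (fun _ => 0) (fun x => x - Rb)).
    + apply continuity_cst. + reg.
Qed.

Lemma Rmax0_cases x : (0 <= x /\ Rmax 0 x = x) \/ (x <= 0 /\ Rmax 0 x = 0).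
Proof. unfold Rmax. destruct (Rle_dec 0 x); lra. Qed.

(** For such a small [th] the bends do not reverse the order of the slopes, so the difference stays
    strictly increasing. *)
Lemma bent_crossing_slope Rb th m k m' k' : m' < m -> 0 <= th ->
  th * Rabs (k - k') < m - m' ->
  exists z, bent Rb th (m, k) z = bent Rb th (m', k') z /\
    (forall x, x < z -> bent Rb th (m, k) x < bent Rb th (m', k') x) /\
    (forall x, z < x -> bent Rb th (m', k') x < bent Rb th (m, k) x).
Proof.
  intros Hm Hth Hk.
  set (h := fun x => bent Rb th (m, k) x - bent Rb th (m', k') x).
  pose proof (Rle_abs (k - k')) as A1. pose proof (Rle_abs (- (k - k'))) as A2.
  rewrite Rabs_Ropp in A2.
  assert (B1 : th * (k - k') < m - m') by nra.
  assert (B2 : 0 < m - m' - th * (k - k')) by lra.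
  set (g := Rmin (m - m') (m - m' - th * (k - k'))).
  assert (Hg : 0 < g) by (apply Rmin_glb_lt; lra).
  assert (G1 : g <= m - m') by apply Rmin_l.
  assert (G2 : g <= m - m' - th * (k - k')) by apply Rmin_r.
  assert (Hinc : forall x y, x < y -> h x + g * (y - x) <= h y).
  { intros x y Hxy. unfold h, bent; simpl.
    destruct (Rmax0_cases (x - Rb)) as [[H1 E1]|[H1 E1]], (Rmax0_cases (y - Rb)) as [[H2 E2]|[H2 E2]];
      rewrite E1, E2; nra. }
  assert (Ch : continuity h).
  { unfold h. apply (continuity_minus (bent Rb th (m, k)) (bent Rb th (m', k')));
      apply continuity_bent. }
  (* Growth at rate at least [g] forces a sign change of [h] within distance [w] of 0. *)
  set (w := Rabs (h 0) / g + 1).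
  assert (Hw : 0 < w) by (unfold w; pose proof (Rabs_pos (h 0));
    assert (0 <= Rabs (h 0) / g) by (apply Rmult_le_pos; [auto|left; now apply Rinv_0_lt_compat]); lra).
  assert (Ew : g * w = Rabs (h 0) + g) by (unfold w; field; lra).
  pose proof (Rle_abs (h 0)) as D1. pose proof (Rle_abs (- h 0)) as D2. rewrite Rabs_Ropp in D2.
  destruct (IVT h (- w) w Ch) as (z & Hz & Ez).
  - lra.
  - specialize (Hinc (- w) 0 ltac:(lra)). lra.
  - specialize (Hinc 0 w ltac:(lra)). lra.
  - exists z. unfold h in Ez. split; [lra|]. split; intros x Hx.
    + specialize (Hinc x z Hx). unfold h in Hinc. nra.
    + specialize (Hinc z x Hx). unfold h in Hinc. nra.
Qed.

(** The bend is proportional to the intercept, so two parallel lines differ by [k - k'] times a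
    common factor, which changes sign at [Rb + / th]. *)
Lemma bent_crossing_parallel Rb th m k k' : k' < k -> 0 < th ->
  exists z, bent Rb th (m, k) z = bent Rb th (m, k') z /\
    (forall x, x < z -> bent Rb th (m, k') x < bent Rb th (m, k) x) /\
    (forall x, z < x -> bent Rb th (m, k) x < bent Rb th (m, k') x).
Proof.
  intros Hk Hth. exists (Rb + / th).
  assert (Hi : 0 < / th) by now apply Rinv_0_lt_compat.
  assert (E : forall x, bent Rb th (m, k) x - bent Rb th (m, k') x
    = (k - k') * (1 - th * Rmax 0 (x - Rb))) by (intros; unfold bent; simpl; ring).
  assert (Et : th * / th = 1) by (field; lra).
  split; [|split].
  - specialize (E (Rb + / th)). replace (Rb + / th - Rb) with (/ th) in E by ring.
    rewrite Rmax_right in E by lra. rewrite Et in E. lra.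
  - intros x Hx. specialize (E x). destruct (Rmax0_cases (x - Rb)) as [[H1 E1]|[H1 E1]]; rewrite E1 in E.
    + assert (th * (x - Rb) < 1) by nra. nra.
    + nra.
  - intros x Hx. specialize (E x). rewrite Rmax_right in E by lra.
    assert (1 < th * (x - Rb)) by nra. nra.
Qed.

(** Indexing by slope and intercept identifies the lines spanned by collinear pairs, so distinct
    indices are distinct pseudolines. *)
Lemma bent_family (Rb : R) (ls : list (R * R)) : exists th,
  pseudoline_family (fun (i : {mk : R * R | In mk ls}) t => (t, bent Rb th (proj1_sig i) t)).
Proof.
  assert (Hth : exists th, 0 < th /\ forall a b, In a ls -> In b ls -> fst b < fst a ->
    th * Rabs (snd a - snd b) < fst a - fst b).
  { assert (H : forall l : list ((R * R) * (R * R)), exists th, 0 < th /\ forall ab, In ab l ->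
      fst (snd ab) < fst (fst ab) ->
      th * Rabs (snd (fst ab) - snd (snd ab)) < fst (fst ab) - fst (snd ab)).
    { induction l as [|[a b] l (th & Hth & IH)]; [exists 1; split; [lra|intros ? []]|].
      destruct (Rlt_le_dec (fst b) (fst a)) as [Hlt|Hle].
      - set (t := (fst a - fst b) / (Rabs (snd a - snd b) + 1)).
        pose proof (Rabs_pos (snd a - snd b)).
        assert (Ht : 0 < t) by (apply Rdiv_lt_0_compat; lra).
        assert (Et : t * Rabs (snd a - snd b) = fst a - fst b - t) by (unfold t; field; lra).
        pose proof (Rmin_l th t). pose proof (Rmin_r th t).
        exists (Rmin th t). split; [now apply Rmin_glb_lt|]. intros ab [<-|Hi] Hs.
        + simpl in *. nra.
        + specialize (IH ab Hi Hs). pose proof (Rabs_pos (snd (fst ab) - snd (snd ab))). nra.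
      - exists th. split; auto. intros ab [<-|Hi] Hs; [simpl in *; lra|auto]. }
    destruct (H (list_prod ls ls)) as (th & Hth & Hall). exists th. split; auto.
    intros a b Ha Hb. apply (Hall (a, b)). now apply in_prod. }
  destruct Hth as (th & Hth & Hall). exists th. split.
  - intros [mk Hmk]. apply graph_pseudoline. apply continuity_bent.
  - intros [[m k] Hi] [[m' k'] Hj] Hne. simpl.
    assert (Hne' : (m, k) <> (m', k')).
    { intros E. injection E as E1 E2. subst m' k'. apply Hne. f_equal. apply proof_irrelevance. }
    assert (Hz : exists z, bent Rb th (m, k) z = bent Rb th (m', k') z /\
      (((forall x, x < z -> bent Rb th (m', k') x < bent Rb th (m, k) x) /\
        (forall x, z < x -> bent Rb th (m, k) x < bent Rb th (m', k') x)) \/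
       ((forall x, x < z -> bent Rb th (m, k) x < bent Rb th (m', k') x) /\
        (forall x, z < x -> bent Rb th (m', k') x < bent Rb th (m, k) x)))).
    { destruct (Rtotal_order m m') as [Hm|[Hm|Hm]].
      - destruct (bent_crossing_slope Rb th m' k' m k) as (z & E & H1 & H2); try lra.
        + now apply (Hall (m', k') (m, k)).
        + exists z. split; [lra|]. left. auto.
      - subst m'. destruct (Rtotal_order k k') as [Hk|[Hk|Hk]].
        + destruct (bent_crossing_parallel Rb th m k' k) as (z & E & H1 & H2); auto.
          exists z. split; [lra|]. right. auto.
        + congruence.
        + destruct (bent_crossing_parallel Rb th m k k') as (z & E & H1 & H2); auto.
          exists z. split; [lra|]. left. auto.
      - destruct (bent_crossing_slope Rb th m k m' k') as (z & E & H1 & H2); try lra.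
        + now apply (Hall (m, k) (m', k')).
        + exists z. split; [lra|]. right. auto. }
    destruct Hz as (z & Ez & Hs). apply graph_crossing with z; auto; apply continuity_bent.
Qed.

(** * The curve *)

Definition fmax (l : list (R -> R)) (b x : R) : R :=
  fold_right (fun g acc => Rmax (g x) acc) b l.

Lemma fmax_base l b x : b <= fmax l b x.
Proof.
  induction l as [|g l IH]; simpl; [lra|]. pose proof (Rmax_r (g x) (fmax l b x)).
  unfold fmax in *. lra.
Qed.

Lemma fmax_ge l b x g : In g l -> g x <= fmax l b x.
Proof.
  induction l as [|h l IH]; simpl; [tauto|]. pose proof (Rmax_l (h x) (fmax l b x)).
  pose proof (Rmax_r (h x) (fmax l b x)). unfold fmax in *.
  intros [->|Hg]; [auto|]. specialize (IH Hg). lra.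
Qed.

Lemma fmax_le l b x c : b <= c -> (forall g, In g l -> g x <= c) -> fmax l b x <= c.
Proof.
  intros Hb. induction l as [|h l IH]; simpl; auto. intros Hg.
  apply Rmax_lub; [apply Hg; auto | apply IH; auto].
Qed.

Lemma continuity_fmax l b : (forall g, In g l -> continuity g) -> continuity (fmax l b).
Proof.
  induction l as [|h l IH]; intros Hg.
  - apply continuity_cst.
  - apply (continuity_Rmax h (fmax l b)); [apply Hg | apply IH; intros; apply Hg]; simpl; auto.
Qed.

Lemma mul_abs_le a b A : Rabs a <= A -> a * b <= A * Rabs b /\ - (A * Rabs b) <= a * b.
Proof.
  intros Ha. pose proof (Rabs_pos b).
  assert (Rabs (a * b) <= A * Rabs b) by (rewrite Rabs_mult; nra).
  pose proof (Rle_abs (a * b)). pose proof (Rle_abs (- (a * b))). rewrite Rabs_Ropp in *. lra.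
Qed.

Lemma Rabs_cases x : (0 <= x /\ Rabs x = x) \/ (x <= 0 /\ Rabs x = - x).
Proof. unfold Rabs. destruct (Rcase_abs x); lra. Qed.

(** A vertex together with the slope [nm] of the outer boundary of its cone of
    visibility; [ns] tells symbols, whose cone opens to the right, from
    columns, whose cone opens to the left. *)
Record node := Node { nx : R; ny : R; nm : R; ns : bool }.

Section Floor.
Variables (nodes : list node) (ws : list pt) (M gam : R).
Hypothesis M_ge : 1 <= M.
Hypothesis gam_pos : 0 < gam.
Hypothesis gam_le : gam <= 1.
Hypothesis node_bd : forall n, In n nodes -> Rabs (nx n) <= M /\ Rabs (ny n) <= M /\ Rabs (nm n) <= M.
Hypothesis node_sep : forall n n', In n nodes -> In n' nodes -> n <> n' -> gam <= Rabs (nx n - nx n').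
Hypothesis ws_bd : forall p, In p ws -> Rabs (fst p) <= M /\ Rabs (snd p) <= M.
Hypothesis ws_sep : forall p n, In p ws -> In n nodes -> gam <= Rabs (nx n - fst p).

(** Columns stand at height [eta] over the floor [f2]. Within distance [rad] of a vertex, slopes up
    to [M] change heights by at most [eta / 16], while a wall of slope [steep] rises by [16 * eta].
    Tents of slope [lam] fall to the base level within [gam / 2], so that they do not interfere near
    vertices. A segment whose slope is off by [gam] or more gains height [kap] within [del / 2],
    half the shift of the walls. *)
Definition eta := gam / 8.
Definition rad := eta / (16 * M).
Definition del := rad / 2.
Definition steep := 256 * M.
Definition lam := 100 * M / gam.
Definition kap := gam * del / 2.
Definition nh (n : node) : R := if ns n then 0 else eta.

(** The floor: near a vertex it is parallel to the boundary of the cone, and it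
    reaches up to the witnesses [ws] of blocked pairs. *)
Definition tent (n : node) (x : R) : R :=
  ny n - nh n + nm n * (x - nx n) - lam * Rmax 0 (Rabs (x - nx n) - rad).
Definition wtent (p : pt) (x : R) : R := snd p - lam * Rabs (x - fst p).
Definition f2 : R -> R := fmax (map tent nodes ++ map wtent ws) (- (2 * M + 2)).

(** Small steep walls, on the left of the symbols and on the right of the
    columns. *)
Definition bump (n : node) (u : R) : R :=
  if ns n
  then Rmin (2 * eta) (Rmin (- steep * (u - nx n)) (steep * (u - nx n + 3 * rad)))
  else Rmin (2 * eta) (Rmin (eta + steep * (u - (nx n - del)))
                            (eta + steep * (nx n - del + 3 * rad - u))).
Definition f1 : R -> R := fmax (map bump nodes) (- eta).

(** The horizontal shift that bends the walls over the vertices: it begins at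
    height 0, where symbols sit, and ends at height [eta], where columns sit. *)
Definition psi (y : R) : R := del * Rmax 0 (Rmin 1 (Rmin (y / kap) (1 + (eta - y) / kap))).

Lemma eta_pos : 0 < eta. Proof. unfold eta. lra. Qed.
Lemma eta_gam : gam = 8 * eta. Proof. unfold eta. lra. Qed.
Lemma M_rad : M * rad = eta / 16. Proof. unfold rad. field. lra. Qed.
Lemma rad_pos : 0 < rad. Proof. unfold rad. pose proof eta_pos. apply Rdiv_lt_0_compat; lra. Qed.
Lemma rad_le : rad <= eta / 16. Proof. pose proof M_rad. pose proof rad_pos. nra. Qed.
Lemma steep_rad : steep * rad = 16 * eta.
Proof. unfold steep. pose proof M_rad. nra. Qed.
Lemma del_rad : rad = 2 * del. Proof. unfold del. lra. Qed.
Lemma steep_del : steep * del = 8 * eta.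
Proof. unfold del. pose proof steep_rad. lra. Qed.
Lemma lam_gam : lam * gam = 100 * M. Proof. unfold lam. field. lra. Qed.
Lemma lam_rad : lam * rad = 25 / 32.
Proof. unfold lam, rad, eta. field. lra. Qed.
Lemma lam_ge : 100 * M <= lam.
Proof. pose proof lam_gam. assert (0 < lam) by (unfold lam; apply Rdiv_lt_0_compat; lra). nra. Qed.
Lemma kap_pos : 0 < kap.
Proof. unfold kap. pose proof rad_pos. pose proof del_rad. assert (0 < gam * del) by (apply Rmult_lt_0_compat; lra). lra. Qed.
Lemma kap_le : kap <= del / 2.
Proof. unfold kap. pose proof rad_pos. pose proof del_rad. nra. Qed.

Ltac params := pose proof eta_pos; pose proof eta_gam; pose proof M_rad; pose proof rad_pos;
  pose proof rad_le; pose proof steep_rad; pose proof del_rad; pose proof steep_del;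
  pose proof lam_gam; pose proof lam_rad; pose proof lam_ge; pose proof kap_pos; pose proof kap_le.

Lemma nh_bd n : 0 <= nh n <= eta.
Proof. unfold nh. pose proof eta_pos. destruct (ns n); lra. Qed.

Lemma tent_le n x : In n nodes ->
  tent n x <= ny n - nh n + M * Rabs (x - nx n) - lam * Rmax 0 (Rabs (x - nx n) - rad).
Proof.
  intros Hn. destruct (node_bd n Hn) as (_ & _ & B).
  destruct (mul_abs_le (nm n) (x - nx n) M B). unfold tent. lra.
Qed.

Lemma tent_far n x : In n nodes -> gam / 2 <= Rabs (x - nx n) -> tent n x <= - (2 * M + 2).
Proof.
  intros Hn Hx. pose proof (tent_le n x Hn) as B. destruct (node_bd n Hn) as (_ & B' & _).
  pose proof (Rle_abs (ny n)). pose proof (nh_bd n). params.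
  rewrite Rmax_right in B by lra. set (t := Rabs (x - nx n)) in *.
  assert ((lam - M) * (gam / 2) <= (lam - M) * t) by (apply Rmult_le_compat_l; lra).
  assert (M * gam <= M) by nra. lra.
Qed.

Lemma wtent_far p x : In p ws -> gam / 2 <= Rabs (x - fst p) -> wtent p x <= - (2 * M + 2).
Proof.
  intros Hp Hx. destruct (ws_bd p Hp) as (_ & B). pose proof (Rle_abs (snd p)). params.
  unfold wtent. set (t := Rabs (x - fst p)) in *.
  assert (lam * (gam / 2) <= lam * t) by (apply Rmult_le_compat_l; lra). lra.
Qed.

Lemma tent_f2 n x : In n nodes -> tent n x <= f2 x.
Proof. intros Hn. apply fmax_ge. apply in_or_app; left. now apply in_map. Qed.

Lemma wtent_f2 p x : In p ws -> wtent p x <= f2 x.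
Proof. intros Hp. apply fmax_ge. apply in_or_app; right. now apply in_map. Qed.

Lemma f2_le x c : - (2 * M + 2) <= c -> (forall n, In n nodes -> tent n x <= c) ->
  (forall p, In p ws -> wtent p x <= c) -> f2 x <= c.
Proof.
  intros Hb Hn Hp. apply fmax_le; auto. intros g Hg. apply in_app_or in Hg.
  destruct Hg as [Hg|Hg]; apply in_map_iff in Hg; destruct Hg as (z & <- & Hz); auto.
Qed.

Lemma f2_low x : - (2 * M + 2) <= f2 x.
Proof. apply fmax_base. Qed.

Lemma f2_high x : f2 x <= 2 * M.
Proof.
  params. apply f2_le; [lra| |].
  - intros n Hn. pose proof (tent_le n x Hn) as B. destruct (node_bd n Hn) as (_ & B' & _).
    pose proof (Rle_abs (ny n)). pose proof (nh_bd n). pose proof (Rabs_pos (x - nx n)).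
    set (t := Rabs (x - nx n)) in *.
    destruct (Rmax0_cases (t - rad)) as [[Hc Ec]|[Hc Ec]]; rewrite Ec in B.
    + assert (0 <= (lam - M) * (t - rad)) by (apply Rmult_le_pos; lra). lra.
    + assert (M * t <= M * rad) by (apply Rmult_le_compat_l; lra). lra.
  - intros p Hp. destruct (ws_bd p Hp) as (_ & B). pose proof (Rle_abs (snd p)).
    unfold wtent. pose proof (Rabs_pos (x - fst p)).
    assert (0 <= lam * Rabs (x - fst p)) by (apply Rmult_le_pos; lra). lra.
Qed.

Lemma f2_near n x : In n nodes -> Rabs (x - nx n) <= rad -> f2 x = tent n x.
Proof.
  intros Hn Hx. apply Rle_antisym; [|now apply tent_f2]. params.
  assert (Hlow : - (2 * M + 2) <= tent n x).
  { unfold tent. rewrite Rmax_left by lra. destruct (node_bd n Hn) as (_ & B1 & B2).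
    destruct (mul_abs_le (nm n) (x - nx n) M B2). pose proof (Rle_abs (- ny n)) as B3.
    rewrite Rabs_Ropp in B3. pose proof (nh_bd n).
    assert (M * Rabs (x - nx n) <= M * rad) by (apply Rmult_le_compat_l; lra). lra. }
  apply f2_le; auto.
  - intros n' Hn'. destruct (classic (n' = n)) as [->|Hne]; [lra|].
    apply Rle_trans with (- (2 * M + 2)); auto. apply tent_far; auto.
    pose proof (node_sep n n' Hn Hn' (not_eq_sym Hne)) as S.
    pose proof (Rabs_triang (nx n - x) (x - nx n')) as T.
    replace (nx n - x + (x - nx n')) with (nx n - nx n') in T by ring.
    rewrite (Rabs_minus_sym (nx n) x) in T. lra.
  - intros p Hp. apply Rle_trans with (- (2 * M + 2)); auto. apply wtent_far; auto.
    pose proof (ws_sep p n Hp Hn) as S.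
    pose proof (Rabs_triang (nx n - x) (x - fst p)) as T.
    replace (nx n - x + (x - fst p)) with (nx n - fst p) in T by ring.
    rewrite (Rabs_minus_sym (nx n) x) in T. lra.
Qed.

Lemma f1_low u : - eta <= f1 u.
Proof. apply fmax_base. Qed.

Lemma bump_f1 n u : In n nodes -> bump n u <= f1 u.
Proof. intros Hn. apply fmax_ge. now apply in_map. Qed.

Lemma f1_le u c : - eta <= c -> (forall n, In n nodes -> bump n u <= c) -> f1 u <= c.
Proof.
  intros Hb Hn. apply fmax_le; auto. intros g Hg. apply in_map_iff in Hg.
  destruct Hg as (z & <- & Hz); auto.
Qed.

Lemma bump_le n u : bump n u <= 2 * eta.
Proof. unfold bump. destruct (ns n); apply Rmin_l. Qed.

Lemma f1_high u : f1 u <= 2 * eta.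
Proof. pose proof eta_pos. apply f1_le; [lra|]. intros; apply bump_le. Qed.

Lemma bump_sym_le n u : ns n = true ->
  bump n u <= - steep * (u - nx n) /\ bump n u <= steep * (u - nx n + 3 * rad).
Proof.
  intros E. unfold bump. rewrite E. split.
  - eapply Rle_trans; [apply Rmin_r | apply Rmin_l].
  - eapply Rle_trans; [apply Rmin_r | apply Rmin_r].
Qed.

Lemma bump_col_le n u : ns n = false ->
  bump n u <= eta + steep * (u - (nx n - del)) /\
  bump n u <= eta + steep * (nx n - del + 3 * rad - u).
Proof.
  intros E. unfold bump. rewrite E. split.
  - eapply Rle_trans; [apply Rmin_r | apply Rmin_l].
  - eapply Rle_trans; [apply Rmin_r | apply Rmin_r].
Qed.

Lemma bump_far n u : gam / 2 <= Rabs (u - nx n) -> bump n u <= - eta.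
Proof.
  intros Hu. params. assert (0 < steep) by (unfold steep; lra).
  destruct (ns n) eqn:E.
  - destruct (bump_sym_le n u E) as [B1 B2].
    destruct (Rabs_cases (u - nx n)) as [[H' E']|[H' E']]; rewrite E' in Hu.
    + assert (steep * rad <= steep * (u - nx n)) by (apply Rmult_le_compat_l; lra). lra.
    + assert (steep * (u - nx n) <= steep * (- (4 * rad))) by (apply Rmult_le_compat_l; lra). lra.
  - destruct (bump_col_le n u E) as [B1 B2].
    destruct (Rabs_cases (u - nx n)) as [[H' E']|[H' E']]; rewrite E' in Hu.
    + assert (steep * (4 * rad) <= steep * (u - nx n)) by (apply Rmult_le_compat_l; lra). lra.
    + assert (steep * (u - nx n) <= steep * (- (4 * rad))) by (apply Rmult_le_compat_l; lra). lra.
Qed.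

Lemma psi_bd y : 0 <= psi y <= del.
Proof.
  unfold psi. pose proof rad_pos. pose proof del_rad.
  set (z := Rmax 0 (Rmin 1 (Rmin (y / kap) (1 + (eta - y) / kap)))).
  assert (0 <= z) by apply Rmax_l.
  assert (z <= 1) by (apply Rmax_lub; [lra|apply Rmin_l]). nra.
Qed.

Lemma psi_low y : y <= 0 -> psi y = 0.
Proof.
  intros Hy. unfold psi. rewrite Rmax_left; [ring|].
  eapply Rle_trans; [apply Rmin_r|]. eapply Rle_trans; [apply Rmin_l|].
  pose proof kap_pos. apply Rmult_le_reg_r with kap; auto. unfold Rdiv.
  rewrite Rmult_assoc, Rinv_l by lra. lra.
Qed.

Lemma psi_mid y : kap <= y <= eta -> psi y = del.
Proof.
  intros Hy. pose proof kap_pos. unfold psi.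
  assert (1 <= y / kap).
  { apply Rmult_le_reg_r with kap; auto. unfold Rdiv. rewrite Rmult_assoc, Rinv_l; lra. }
  assert (0 <= (eta - y) / kap) by (apply Rmult_le_pos; [lra|left; now apply Rinv_0_lt_compat]).
  rewrite Rmin_left by (apply Rmin_glb; lra). rewrite Rmax_right; lra.
Qed.

Lemma psi_top : psi (eta + kap) = 0.
Proof.
  pose proof kap_pos. unfold psi. rewrite Rmax_left; [ring|].
  eapply Rle_trans; [apply Rmin_r|]. eapply Rle_trans; [apply Rmin_r|].
  replace ((eta - (eta + kap)) / kap) with (-1) by (field; lra). lra.
Qed.

(** Membership is tested after undoing the shears: [y - f2 x] is the height over the coarse floor,
    and the walls [f1] are shifted according to this height. *)
Definition above (x y : R) : Prop := f1 (x - psi (y - f2 x)) <= y - f2 x.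

Lemma others_near n u : In n nodes -> Rabs (u - nx n) <= gam / 2 ->
  forall n', In n' nodes -> n' <> n -> bump n' u <= - eta.
Proof.
  intros Hn Hu n' Hn' Hne. apply bump_far.
  pose proof (node_sep n n' Hn Hn' (not_eq_sym Hne)) as S.
  pose proof (Rabs_triang (nx n - u) (u - nx n')) as T.
  replace (nx n - u + (u - nx n')) with (nx n - nx n') in T by ring.
  rewrite (Rabs_minus_sym (nx n) u) in T. lra.
Qed.

Lemma f1_near n u c : In n nodes -> Rabs (u - nx n) <= gam / 2 -> - eta <= c -> bump n u <= c ->
  f1 u <= c.
Proof.
  intros Hn Hu Hc Hb. apply f1_le; auto. intros n' Hn'.
  destruct (classic (n' = n)) as [->|Hne]; auto.
  pose proof (others_near n u Hn Hu n' Hn' Hne). lra.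
Qed.

(** * Edges stay above the floor *)

Section Edge.
Variables (a d : node) (m : R).
Hypothesis Ha : In a nodes.
Hypothesis Hd : In d nodes.
Hypothesis Sa : ns a = true.
Hypothesis Sd : ns d = false.
Hypothesis Had : nx a < nx d.
Hypothesis Hline : ny d = ny a + m * (nx d - nx a).
Hypothesis Hm : Rabs m <= M.
Hypothesis Hma : m <= nm a.
Hypothesis Hmd : nm d <= m.
Let line (x : R) : R := ny a + m * (x - nx a).
Hypothesis Hover : forall n, In n nodes -> nx a < nx n < nx d -> ny n + gam <= line (nx n).
Hypothesis Hwover : forall p, In p ws -> nx a <= fst p <= nx d -> snd p + gam <= line (fst p).

Lemma gap_ad : gam <= nx d - nx a.
Proof.
  assert (Hne : d <> a) by (intros E; rewrite E in Had; lra).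
  pose proof (node_sep d a Hd Ha Hne) as S. rewrite Rabs_right in S; lra.
Qed.

Lemma line_lip x y : line x <= line y + M * Rabs (x - y).
Proof.
  destruct (mul_abs_le m (x - y) M Hm). unfold line. lra.
Qed.

Lemma line_low x : nx a <= x <= nx d -> - M <= line x.
Proof.
  intros Hx. destruct (node_bd a Ha) as (_ & B1 & _), (node_bd d Hd) as (_ & B2 & _).
  pose proof (Rle_abs (- ny a)) as B3. pose proof (Rle_abs (- ny d)) as B4.
  rewrite Rabs_Ropp in B3, B4. unfold line. destruct (Rle_lt_dec 0 m).
  - assert (0 <= m * (x - nx a)) by (apply Rmult_le_pos; lra). lra.
  - assert (0 <= - m * (nx d - x)) by (apply Rmult_le_pos; lra). nra.
Qed.

Lemma tent_other n x : In n nodes -> n <> a -> n <> d -> nx a <= x <= nx d ->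
  tent n x <= line x - 2 * eta.
Proof.
  intros Hn Hna Hnd Hx. params.
  pose proof (node_sep n a Hn Ha Hna) as S1. pose proof (node_sep n d Hn Hd Hnd) as S2.
  destruct (Rlt_le_dec (nx a) (nx n)) as [H'|H'].
  2: { rewrite Rabs_left1 in S1 by lra. pose proof (line_low x Hx).
       assert (tent n x <= - (2 * M + 2)) by (apply tent_far; auto; rewrite Rabs_right; lra). lra. }
  destruct (Rlt_le_dec (nx n) (nx d)) as [H''|H''].
  2: { rewrite Rabs_right in S2 by lra. pose proof (line_low x Hx).
       assert (tent n x <= - (2 * M + 2)) by (apply tent_far; auto; rewrite Rabs_left1; lra). lra. }
  pose proof (Hover n Hn (conj H' H'')) as HO. pose proof (tent_le n x Hn) as B.
  pose proof (nh_bd n). pose proof (line_lip (nx n) x) as HL. rewrite Rabs_minus_sym in HL.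
  pose proof (Rabs_pos (x - nx n)). set (t := Rabs (x - nx n)) in *.
  destruct (Rmax0_cases (t - rad)) as [[Hc Ec]|[Hc Ec]]; rewrite Ec in B.
  - assert (0 <= (lam - 2 * M) * (t - rad)) by (apply Rmult_le_pos; lra). lra.
  - assert (M * t <= M * rad) by (apply Rmult_le_compat_l; lra). lra.
Qed.

Lemma wtent_other p x : In p ws -> nx a <= x <= nx d -> wtent p x <= line x - 2 * eta.
Proof.
  intros Hp Hx. params.
  pose proof (ws_sep p a Hp Ha) as S1. pose proof (ws_sep p d Hp Hd) as S2.
  destruct (Rlt_le_dec (nx a) (fst p)) as [H'|H'].
  2: { rewrite Rabs_right in S1 by lra. pose proof (line_low x Hx).
       assert (wtent p x <= - (2 * M + 2)) by (apply wtent_far; auto; rewrite Rabs_right; lra). lra. }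
  destruct (Rlt_le_dec (fst p) (nx d)) as [H''|H''].
  2: { rewrite Rabs_left1 in S2 by lra. pose proof (line_low x Hx).
       assert (wtent p x <= - (2 * M + 2)) by (apply wtent_far; auto; rewrite Rabs_left1; lra). lra. }
  pose proof (Hwover p Hp (conj (Rlt_le _ _ H') (Rlt_le _ _ H''))) as HO.
  pose proof (line_lip (fst p) x) as HL. rewrite Rabs_minus_sym in HL.
  pose proof (Rabs_pos (x - fst p)). unfold wtent. set (t := Rabs (x - fst p)) in *.
  assert (0 <= (lam - M) * t) by (apply Rmult_le_pos; lra). lra.
Qed.

Lemma tent_a_eq x : nx a <= x ->
  line x - tent a x = - (nm a - m) * (x - nx a) + lam * Rmax 0 (x - nx a - rad).
Proof.
  intros Hx. unfold tent, line, nh. rewrite Sa, (Rabs_right (x - nx a)) by lra. ring.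
Qed.

Lemma tent_d_eq x : x <= nx d ->
  line x - tent d x = eta - (m - nm d) * (nx d - x) + lam * Rmax 0 (nx d - x - rad).
Proof.
  intros Hx. unfold tent, line, nh. rewrite Sd, (Rabs_left1 (x - nx d)) by lra.
  rewrite Hline. replace (- (x - nx d) - rad) with (nx d - x - rad) by ring. ring.
Qed.

Lemma slopes_bd : nm a - m <= 2 * M /\ m - nm d <= 2 * M.
Proof.
  destruct (node_bd a Ha) as (_ & _ & B1), (node_bd d Hd) as (_ & _ & B2).
  pose proof (Rle_abs (nm a)). pose proof (Rle_abs (- nm d)) as B3. rewrite Rabs_Ropp in B3.
  pose proof (Rle_abs m). pose proof (Rle_abs (- m)) as B4. rewrite Rabs_Ropp in B4. lra.
Qed.

Lemma tent_a_far x : nx a + 2 * rad <= x -> tent a x <= line x - 2 * eta.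
Proof.
  intros Hx. params. pose proof (tent_a_eq x ltac:(lra)) as E. rewrite Rmax_right in E by lra.
  destruct slopes_bd as [B _]. set (t := x - nx a) in *. assert (2 * rad <= t) by (unfold t; lra).
  assert ((nm a - m) * t <= 2 * M * t) by (apply Rmult_le_compat_r; lra).
  assert (0 <= (lam - 2 * M) * (t - 2 * rad)) by (apply Rmult_le_pos; lra). lra.
Qed.

Lemma tent_d_far x : x <= nx d - 2 * rad -> tent d x <= line x - 2 * eta.
Proof.
  intros Hx. params. pose proof (tent_d_eq x ltac:(lra)) as E. rewrite Rmax_right in E by lra.
  destruct slopes_bd as [_ B]. set (t := nx d - x) in *. assert (2 * rad <= t) by (unfold t; lra).
  assert ((m - nm d) * t <= 2 * M * t) by (apply Rmult_le_compat_r; lra).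
  assert (0 <= (lam - 2 * M) * (t - 2 * rad)) by (apply Rmult_le_pos; lra). lra.
Qed.

Lemma f2_edge x c : nx a <= x <= nx d -> line x - 2 * eta <= c -> tent a x <= c -> tent d x <= c ->
  f2 x <= c.
Proof.
  intros Hx H1 H2 H3. params. apply f2_le.
  - pose proof (line_low x Hx). lra.
  - intros n Hn. destruct (classic (n = a)) as [->|Hna]; auto.
    destruct (classic (n = d)) as [->|Hnd]; auto. pose proof (tent_other n x Hn Hna Hnd Hx). lra.
  - intros p Hp. pose proof (wtent_other p x Hp Hx). lra.
Qed.

(** Near [a] the segment has height at most 0 over [f2], where nothing is shifted, and the wall
    descends faster than the segment. Near [d] its height is between [kap] and [eta], where the
    shift is exactly [del], and leftwards the wall again descends faster. Away from both ends it is
    at least [2 * eta] above [f2], which no wall exceeds. *)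
Lemma edge_above x : nx a <= x <= nx d -> above x (line x).
Proof.
  intros Hx. unfold above. params. pose proof gap_ad as Hgap. destruct slopes_bd as [Bs1 Bs2].
  set (y2 := line x - f2 x).
  destruct (Rle_lt_dec (2 * eta) y2) as [Hy|Hy].
  { pose proof (f1_high (x - psi y2)). lra. }
  pose proof (psi_bd y2) as Bp. assert (0 < steep) by (unfold steep; lra).
  destruct (Rle_lt_dec (nx a + 2 * rad) x) as [Ha2|Ha2].
  - pose proof (tent_a_far x Ha2) as Ta.
    destruct (Rle_lt_dec x (nx d - 2 * rad)) as [Hd2|Hd2].
    + pose proof (tent_d_far x Hd2) as Td.
      assert (f2 x <= line x - 2 * eta) by (apply f2_edge; lra). unfold y2 in Hy. lra.
    + set (t := nx d - x) in *. assert (Ht : 0 <= t < 2 * rad) by (unfold t; lra).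
      pose proof (tent_d_eq x ltac:(lra)) as E. fold t in E.
      pose proof (tent_f2 d x Hd) as G1.
      assert (G2 : f2 x <= Rmax (tent d x) (line x - 2 * eta)).
      { apply f2_edge; auto; [apply Rmax_r| |apply Rmax_l].
        eapply Rle_trans; [exact Ta|apply Rmax_r]. }
      assert (Ey : y2 = line x - tent d x).
      { unfold y2 in *. unfold Rmax in G2. destruct (Rle_dec (tent d x) (line x - 2 * eta)); lra. }
      assert (Bm : 0 <= (m - nm d) * t <= 2 * M * t).
      { split; [apply Rmult_le_pos; lra | apply Rmult_le_compat_r; lra]. }
      assert (M * t <= M * (2 * rad)) by (apply Rmult_le_compat_l; lra).
      assert (Bl : 0 <= lam * Rmax 0 (t - rad)).
      { apply Rmult_le_pos; [lra|apply Rmax_l]. }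
      destruct (Rle_lt_dec t rad) as [Hr|Hr].
      * rewrite Rmax_left in E by lra. assert (Ep : psi y2 = del) by (apply psi_mid; lra).
        rewrite Ep. apply f1_near with d; auto; try lra.
        -- rewrite Rabs_left1; unfold t in *; lra.
        -- destruct (bump_col_le d (x - del) Sd) as [B _].
           replace (x - del - (nx d - del)) with (- t) in B by (unfold t; ring).
           assert (2 * M * t <= steep * t) by (unfold steep; apply Rmult_le_compat_r; lra). lra.
      (* Here the shift is only known to be between 0 and [del], but this far from [d] the wall is
         low for all such shifts. *)
      * apply f1_near with d; auto; try lra.
        -- rewrite Rabs_left1; unfold t in *; lra.
        -- destruct (bump_col_le d (x - psi y2) Sd) as [B _].
           assert (steep * (x - psi y2 - (nx d - del)) <= steep * (- del)).
           { apply Rmult_le_compat_l; unfold t in *; lra. }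
           lra.
  - set (t := x - nx a) in *. assert (Ht : 0 <= t < 2 * rad) by (unfold t; lra).
    pose proof (tent_d_far x ltac:(lra)) as Td.
    pose proof (tent_a_eq x ltac:(lra)) as E. fold t in E.
    pose proof (tent_f2 a x Ha) as G1.
    assert (G2 : f2 x <= Rmax (tent a x) (line x - 2 * eta)).
    { apply f2_edge; auto; [apply Rmax_r|apply Rmax_l|].
      eapply Rle_trans; [exact Td|apply Rmax_r]. }
    assert (Ey : y2 = line x - tent a x).
    { unfold y2 in *. unfold Rmax in G2. destruct (Rle_dec (tent a x) (line x - 2 * eta)); lra. }
    assert (Bm : 0 <= (nm a - m) * t <= 2 * M * t).
    { split; [apply Rmult_le_pos; lra | apply Rmult_le_compat_r; lra]. }
    assert (M * t <= M * (2 * rad)) by (apply Rmult_le_compat_l; lra).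
    assert (Bl : 0 <= lam * Rmax 0 (t - rad)).
    { apply Rmult_le_pos; [lra|apply Rmax_l]. }
    destruct (Rle_lt_dec t rad) as [Hr|Hr].
    + rewrite Rmax_left in E by lra. assert (Ep : psi y2 = 0) by (apply psi_low; lra).
      rewrite Ep, Rminus_0_r. apply f1_near with a; auto; try lra.
      * rewrite Rabs_right; unfold t in *; lra.
      * destruct (bump_sym_le a x Sa) as [B _]. fold t in B.
        assert (2 * M * t <= steep * t) by (unfold steep; apply Rmult_le_compat_r; lra). lra.
    + apply f1_near with a; auto; try lra.
      * rewrite Rabs_right; unfold t in *; lra.
      * destruct (bump_sym_le a (x - psi y2) Sa) as [B _].
        assert (steep * del <= steep * (x - psi y2 - nx a)).
        { apply Rmult_le_compat_l; unfold t in *; lra. }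
        lra.
Qed.

End Edge.

(** * Points of segments hidden by the floor *)

Definition below (x y : R) : Prop := y - f2 x < f1 (x - psi (y - f2 x)).

Lemma steep_ge : 256 <= steep.
Proof. unfold steep. lra. Qed.

Lemma f2_node n : In n nodes -> f2 (nx n) = ny n - nh n.
Proof.
  intros Hn. pose proof rad_pos. rewrite (f2_near n) by (auto; rewrite Rminus_diag, Rabs_R0; lra).
  unfold tent. rewrite Rminus_diag, Rabs_R0, Rmax_left by lra. ring.
Qed.

(** At height [eta] the shift is [del], which moves the wall of a column, drawn at [nx n - del],
    exactly onto the column. *)
Lemma node_on_floor n : In n nodes -> f1 (nx n - psi (ny n - f2 (nx n))) = ny n - f2 (nx n).
Proof.
  intros Hn. params. pose proof steep_ge.
  assert (0 < steep * rad) by (apply Rmult_lt_0_compat; lra).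
  rewrite f2_node by auto. replace (ny n - (ny n - nh n)) with (nh n) by ring.
  unfold nh. destruct (ns n) eqn:E.
  - rewrite psi_low by lra. rewrite Rminus_0_r. apply Rle_antisym.
    + apply f1_near with n; auto; [rewrite Rminus_diag, Rabs_R0; lra|lra|].
      destruct (bump_sym_le n (nx n) E). lra.
    + eapply Rle_trans; [|apply (bump_f1 n); auto]. unfold bump. rewrite E.
      repeat apply Rmin_glb; lra.
  - rewrite psi_mid by lra. apply Rle_antisym.
    + apply f1_near with n; auto; [rewrite Rabs_left1; lra|lra|].
      destruct (bump_col_le n (nx n - del) E). lra.
    + eapply Rle_trans; [|apply (bump_f1 n); auto]. unfold bump. rewrite E.
      repeat apply Rmin_glb; lra.
Qed.

Lemma below_witness p y : In p ws -> y + gam <= snd p -> below (fst p) y.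
Proof.
  intros Hp Hy. unfold below. pose proof (f1_low (fst p - psi (y - f2 (fst p)))).
  pose proof (wtent_f2 p (fst p) Hp) as B. unfold wtent in B. rewrite Rminus_diag, Rabs_R0 in B.
  params. lra.
Qed.

(** A segment reaching a symbol from the left meets the wall whatever its slope; this hides every
    pair whose right end is a symbol. *)
Lemma below_sym_left n m : In n nodes -> ns n = true -> Rabs m <= M ->
  below (nx n - rad) (ny n - m * rad).
Proof.
  intros Hn E Hm. unfold below. params. pose proof steep_ge.
  destruct (node_bd n Hn) as (_ & _ & Bm).
  pose proof (Rle_abs (nm n)). pose proof (Rle_abs (- m)) as Bm'. rewrite Rabs_Ropp in Bm'.
  assert (nm n * rad <= M * rad) by (apply Rmult_le_compat_r; lra).
  assert (- m * rad <= M * rad) by (apply Rmult_le_compat_r; lra).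
  assert (Ef : f2 (nx n - rad) = ny n - nm n * rad).
  { rewrite (f2_near n); auto; [|rewrite Rabs_left1; lra]. unfold tent, nh.
    rewrite E, Rmax_left by (rewrite Rabs_left1; lra). ring. }
  rewrite Ef. set (y2 := ny n - m * rad - (ny n - nm n * rad)).
  pose proof (psi_bd y2) as Bp.
  eapply Rlt_le_trans; [|apply (bump_f1 n); auto]. unfold bump. rewrite E.
  assert (0 <= steep * psi y2) by (apply Rmult_le_pos; lra).
  assert (steep * psi y2 <= steep * del) by (apply Rmult_le_compat_l; lra).
  unfold y2 at 1. repeat apply Rmin_glb_lt; lra.
Qed.

Lemma below_col_right n m : In n nodes -> ns n = false -> Rabs m <= M ->
  below (nx n + rad) (ny n + m * rad).
Proof.
  intros Hn E Hm. unfold below. params. pose proof steep_ge.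
  destruct (node_bd n Hn) as (_ & _ & Bm).
  pose proof (Rle_abs (- nm n)) as Bn. rewrite Rabs_Ropp in Bn. pose proof (Rle_abs m).
  assert (- nm n * rad <= M * rad) by (apply Rmult_le_compat_r; lra).
  assert (m * rad <= M * rad) by (apply Rmult_le_compat_r; lra).
  assert (Ef : f2 (nx n + rad) = ny n - eta + nm n * rad).
  { rewrite (f2_near n); auto; [|rewrite Rabs_right; lra]. unfold tent, nh.
    rewrite E, Rmax_left by (rewrite Rabs_right; lra). ring. }
  rewrite Ef. set (y2 := ny n + m * rad - (ny n - eta + nm n * rad)).
  pose proof (psi_bd y2) as Bp.
  eapply Rlt_le_trans; [|apply (bump_f1 n); auto]. unfold bump. rewrite E.
  assert (0 <= steep * psi y2) by (apply Rmult_le_pos; lra).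
  assert (steep * psi y2 <= steep * del) by (apply Rmult_le_compat_l; lra).
  unfold y2 at 1. repeat apply Rmin_glb_lt; lra.
Qed.

Lemma kap_quot q : gam <= q -> 0 < kap / q <= del / 2.
Proof.
  intros Hq. params. split; [apply Rdiv_lt_0_compat; lra|].
  apply Rmult_le_reg_r with q; [lra|]. unfold Rdiv at 1. rewrite Rmult_assoc, Rinv_l by lra.
  unfold kap. assert (del * gam <= del * q) by (apply Rmult_le_compat_l; lra). lra.
Qed.

(** The segment gains height [kap] within [del / 2] of the symbol; at this height the wall is
    shifted by [del], so it overhangs the segment. *)
Lemma below_sym_above n m : In n nodes -> ns n = true -> nm n + gam <= m ->
  exists t, 0 < t < gam /\ below (nx n + t) (ny n + m * t).
Proof.
  intros Hn E Hm. params. pose proof steep_ge.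
  destruct (kap_quot (m - nm n)) as [Ht1 Ht2]; [lra|].
  set (t := kap / (m - nm n)) in *.
  assert (Et : (m - nm n) * t = kap) by (unfold t; field; lra).
  exists t. split; [lra|]. unfold below.
  assert (Ef : f2 (nx n + t) = ny n + nm n * t).
  { rewrite (f2_near n); auto; [|rewrite Rabs_right; lra]. unfold tent, nh.
    rewrite E, Rmax_left by (rewrite Rabs_right; lra). ring. }
  rewrite Ef. replace (ny n + m * t - (ny n + nm n * t)) with kap by lra.
  rewrite psi_mid by lra.
  eapply Rlt_le_trans; [|apply (bump_f1 n); auto]. unfold bump. rewrite E.
  assert (steep * t <= steep * (del / 2)) by (apply Rmult_le_compat_l; lra).
  assert (0 <= steep * t) by (apply Rmult_le_pos; lra).
  repeat apply Rmin_glb_lt; lra.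
Qed.

(** The segment has height [eta + kap] within [del / 2] of the column; there the shift has ceased,
    and the wall starting at [nx n - del] covers the segment. *)
Lemma below_col_above n m : In n nodes -> ns n = false -> m + gam <= nm n ->
  exists t, 0 < t < gam /\ below (nx n - t) (ny n - m * t).
Proof.
  intros Hn E Hm. params. pose proof steep_ge.
  destruct (kap_quot (nm n - m)) as [Ht1 Ht2]; [lra|].
  set (t := kap / (nm n - m)) in *.
  assert (Et : (nm n - m) * t = kap) by (unfold t; field; lra).
  exists t. split; [lra|]. unfold below.
  assert (Ef : f2 (nx n - t) = ny n - eta - nm n * t).
  { rewrite (f2_near n); auto; [|rewrite Rabs_left1; lra]. unfold tent, nh.
    rewrite E, Rmax_left by (rewrite Rabs_left1; lra). ring. }
  rewrite Ef. replace (ny n - m * t - (ny n - eta - nm n * t)) with (eta + kap) by lra.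
  rewrite psi_top, Rminus_0_r.
  eapply Rlt_le_trans; [|apply (bump_f1 n); auto]. unfold bump. rewrite E.
  assert (steep * t <= steep * (del / 2)) by (apply Rmult_le_compat_l; lra).
  assert (0 <= steep * t) by (apply Rmult_le_pos; lra).
  repeat apply Rmin_glb_lt; lra.
Qed.

Lemma continuity_f2 : continuity f2.
Proof.
  apply continuity_fmax. intros g Hg. apply in_app_or in Hg.
  destruct Hg as [Hg|Hg]; apply in_map_iff in Hg; destruct Hg as (z & <- & _).
  - unfold tent. apply (continuity_minus (fun x => ny z - nh z + nm z * (x - nx z))
      (fun x => lam * Rmax 0 (Rabs (x - nx z) - rad))); [reg|].
    apply continuity_scal'. apply (continuity_Rmax (fun _ => 0) (fun x => Rabs (x - nx z) - rad)).
    + apply continuity_cst.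
    + apply (continuity_minus (fun x => Rabs (x - nx z)) (fun _ => rad)); [|apply continuity_cst].
      apply (continuity_Rabs (fun x => x - nx z)). reg.
  - unfold wtent. apply (continuity_minus (fun _ => snd z) (fun x => lam * Rabs (x - fst z)));
      [apply continuity_cst|].
    apply continuity_scal'. apply (continuity_Rabs (fun x => x - fst z)). reg.
Qed.

Lemma continuity_f1 : continuity f1.
Proof.
  apply continuity_fmax. intros g Hg. apply in_map_iff in Hg. destruct Hg as (z & <- & _).
  unfold bump. destruct (ns z).
  - apply (continuity_Rmin (fun _ => 2 * eta)
      (fun u => Rmin (- steep * (u - nx z)) (steep * (u - nx z + 3 * rad)))); [apply continuity_cst|].
    apply (continuity_Rmin (fun u => - steep * (u - nx z)) (fun u => steep * (u - nx z + 3 * rad)));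
      reg.
  - apply (continuity_Rmin (fun _ => 2 * eta)
      (fun u => Rmin (eta + steep * (u - (nx z - del))) (eta + steep * (nx z - del + 3 * rad - u))));
      [apply continuity_cst|].
    apply (continuity_Rmin (fun u => eta + steep * (u - (nx z - del)))
      (fun u => eta + steep * (nx z - del + 3 * rad - u))); reg.
Qed.

Lemma continuity_psi : continuity psi.
Proof.
  unfold psi. apply continuity_scal'.
  apply (continuity_Rmax (fun _ => 0) (fun y => Rmin 1 (Rmin (y / kap) (1 + (eta - y) / kap))));
    [apply continuity_cst|].
  apply (continuity_Rmin (fun _ => 1) (fun y => Rmin (y / kap) (1 + (eta - y) / kap)));
    [apply continuity_cst|].
  pose proof kap_pos.
  apply (continuity_Rmin (fun y => y / kap) (fun y => 1 + (eta - y) / kap)).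
  - apply continuity_ext with (fun y => / kap * y); [intros; field; lra|reg].
  - apply continuity_ext with (fun y => 1 + / kap * (eta - y)); [intros; field; lra|reg].
Qed.

(** * The floor as part of a Jordan curve *)

Definition rho : R := 10 * M + 10.
Definition arc (u : R) : R := sqrt (Rmax 0 (rho * rho - u * u)).
(** [Psi] is the composition of the shears; [arc] flattens the lower half of the
    circle before the floor is shaped. *)
Definition Psi (z : pt) : pt :=
  (fst z + psi (snd z + f1 (fst z) + arc (fst z)),
   snd z + f1 (fst z) + arc (fst z) + f2 (fst z + psi (snd z + f1 (fst z) + arc (fst z)))).
Definition Phi (p : pt) : pt :=
  (fst p - psi (snd p - f2 (fst p)),
   snd p - f2 (fst p) - f1 (fst p - psi (snd p - f2 (fst p)))
   - arc (fst p - psi (snd p - f2 (fst p)))).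

Lemma Phi_Psi z : Phi (Psi z) = z.
Proof.
  destruct z as [u v]. unfold Phi, Psi; simpl.
  set (y := v + f1 u + arc u). set (x := u + psi y).
  replace (y + f2 x - f2 x) with y by ring. replace (x - psi y) with u by (unfold x; ring).
  f_equal. unfold y. ring.
Qed.

Lemma Psi_Phi z : Psi (Phi z) = z.
Proof.
  destruct z as [x y]. unfold Phi, Psi; simpl.
  set (w := y - f2 x). set (u := x - psi w).
  replace (w - f1 u - arc u + f1 u + arc u) with w by ring.
  replace (u + psi w) with x by (unfold u; ring). f_equal. unfold w. ring.
Qed.

Lemma arc_pos u : 0 <= arc u.
Proof. apply sqrt_pos. Qed.

Lemma arc_le u : arc u <= rho.
Proof.
  unfold arc. assert (0 <= rho) by (unfold rho; lra).
  rewrite <- (sqrt_square rho) at 3 by auto. apply sqrt_le_1_alt.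
  apply Rmax_lub; nra.
Qed.

Lemma continuity_arc : continuity arc.
Proof.
  unfold arc. apply (continuity_sqrt (fun u => Rmax 0 (rho * rho - u * u))).
  - intros; apply Rmax_l.
  - apply (continuity_Rmax (fun _ => 0) (fun u => rho * rho - u * u)); [apply continuity_cst|reg].
Qed.

Lemma Psi_cont p : cont p -> cont (fun t => Psi (p t)).
Proof.
  intros Cp. assert (C1 := cont_fst p Cp). assert (C2 := cont_snd p Cp).
  assert (C3 : continuity (fun t => snd (p t) + f1 (fst (p t)) + arc (fst (p t)))).
  { apply (continuity_plus (fun t => snd (p t) + f1 (fst (p t))) (fun t => arc (fst (p t)))).
    - apply (continuity_plus (fun t => snd (p t)) (fun t => f1 (fst (p t)))); auto.
      apply (continuity_comp (fun t => fst (p t)) f1); auto. apply continuity_f1.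
    - apply (continuity_comp (fun t => fst (p t)) arc); auto. apply continuity_arc. }
  assert (C4 : continuity (fun t => fst (p t) + psi (snd (p t) + f1 (fst (p t)) + arc (fst (p t))))).
  { apply (continuity_plus (fun t => fst (p t))
      (fun t => psi (snd (p t) + f1 (fst (p t)) + arc (fst (p t))))); auto.
    apply (continuity_comp (fun t => snd (p t) + f1 (fst (p t)) + arc (fst (p t))) psi); auto.
    apply continuity_psi. }
  unfold Psi. apply cont_pair; auto.
  apply (continuity_plus (fun t => snd (p t) + f1 (fst (p t)) + arc (fst (p t)))
    (fun t => f2 (fst (p t) + psi (snd (p t) + f1 (fst (p t)) + arc (fst (p t)))))); auto.
  apply (continuity_comp (fun t => fst (p t) + psi (snd (p t) + f1 (fst (p t)) + arc (fst (p t)))) f2);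
    auto. apply continuity_f2.
Qed.

Lemma Phi_cont p : cont p -> cont (fun t => Phi (p t)).
Proof.
  intros Cp. assert (C1 := cont_fst p Cp). assert (C2 := cont_snd p Cp).
  assert (C3 : continuity (fun t => snd (p t) - f2 (fst (p t)))).
  { apply (continuity_minus (fun t => snd (p t)) (fun t => f2 (fst (p t)))); auto.
    apply (continuity_comp (fun t => fst (p t)) f2); auto. apply continuity_f2. }
  assert (C4 : continuity (fun t => fst (p t) - psi (snd (p t) - f2 (fst (p t))))).
  { apply (continuity_minus (fun t => fst (p t)) (fun t => psi (snd (p t) - f2 (fst (p t))))); auto.
    apply (continuity_comp (fun t => snd (p t) - f2 (fst (p t))) psi); auto. apply continuity_psi. }
  unfold Phi. apply cont_pair; auto.
  apply (continuity_minus
    (fun t => snd (p t) - f2 (fst (p t)) - f1 (fst (p t) - psi (snd (p t) - f2 (fst (p t)))))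
    (fun t => arc (fst (p t) - psi (snd (p t) - f2 (fst (p t)))))).
  - apply (continuity_minus (fun t => snd (p t) - f2 (fst (p t)))
      (fun t => f1 (fst (p t) - psi (snd (p t) - f2 (fst (p t)))))); auto.
    apply (continuity_comp (fun t => fst (p t) - psi (snd (p t) - f2 (fst (p t)))) f1); auto.
    apply continuity_f1.
  - apply (continuity_comp (fun t => fst (p t) - psi (snd (p t) - f2 (fst (p t)))) arc); auto.
    apply continuity_arc.
Qed.

Lemma norm2_triangle (p q : pt) B : Rabs (fst p - fst q) + Rabs (snd p - snd q) <= B ->
  norm2 p <= norm2 q + B.
Proof.
  intros HB. set (a := fst p - fst q) in *. set (b := snd p - snd q) in *.
  pose proof (sqn_norm2 p) as E1. pose proof (sqn_norm2 q) as E2.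
  pose proof (norm2_pos p). pose proof (norm2_pos q).
  pose proof (dist2_fst q (0, 0)) as F1. pose proof (dist2_snd q (0, 0)) as F2.
  fold (norm2 q) in F1, F2. simpl in F1, F2. rewrite Rminus_0_r in F1, F2.
  pose proof (Rabs_pos a). pose proof (Rabs_pos b).
  destruct (mul_abs_le (fst q) a (norm2 q) F1) as [G1 _].
  destruct (mul_abs_le (snd q) b (norm2 q) F2) as [G2 _].
  assert (Ea : a * a = Rabs a * Rabs a) by (rewrite <- Rabs_mult, Rabs_right; nra).
  assert (Eb : b * b = Rabs b * Rabs b) by (rewrite <- Rabs_mult, Rabs_right; nra).
  assert (Esq : sqn p = sqn q + 2 * (fst q * a + snd q * b) + (a * a + b * b)).
  { unfold sqn. replace (fst p) with (fst q + a) by (unfold a; ring).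
    replace (snd p) with (snd q + b) by (unfold b; ring). ring. }
  destruct (Rle_lt_dec (norm2 p) (norm2 q + (Rabs a + Rabs b))); [lra|exfalso].
  assert ((norm2 q + (Rabs a + Rabs b)) * (norm2 q + (Rabs a + Rabs b)) < norm2 p * norm2 p)
    by (apply Rmult_le_0_lt_compat; lra).
  nra.
Qed.

Lemma Psi_moves z : Rabs (fst (Psi z) - fst z) + Rabs (snd (Psi z) - snd z) <= rho + 2 * M + 6.
Proof.
  params. set (y := snd z + f1 (fst z) + arc (fst z)). set (x := fst z + psi y).
  assert (E1 : fst (Psi z) - fst z = psi y) by (unfold Psi, y; simpl; ring).
  assert (E2 : snd (Psi z) - snd z = f1 (fst z) + arc (fst z) + f2 x)
    by (unfold Psi, x, y; simpl; ring).
  rewrite E1, E2. pose proof (psi_bd y). pose proof (f1_low (fst z)). pose proof (f1_high (fst z)).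
  pose proof (arc_pos (fst z)). pose proof (arc_le (fst z)).
  pose proof (f2_low x). pose proof (f2_high x).
  rewrite (Rabs_right (psi y)) by lra.
  assert (Rabs (f1 (fst z) + arc (fst z) + f2 x) <= rho + 2 * M + 5); [|lra].
  apply Rabs_le. lra.
Qed.

Definition floor_curve : R -> pt := curve Psi rho.

Lemma rho_pos : 0 < rho. Proof. unfold rho; lra. Qed.

Lemma floor_jordan : jordan_param floor_curve.
Proof. exact (curve_jordan Psi Phi rho Phi_Psi Psi_cont rho_pos). Qed.

Lemma arc_sqr u : Rabs u <= rho -> arc u * arc u = rho * rho - u * u.
Proof.
  intros Hu. unfold arc. pose proof rho_pos.
  assert (0 <= rho * rho - u * u).
  { pose proof (Rle_abs u). pose proof (Rle_abs (- u)) as B. rewrite Rabs_Ropp in B. nra. }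
  rewrite Rmax_right by auto. now apply sqrt_def.
Qed.

(** [Phi] sends the point below the lower half of the circle, or sideways beyond the circle. *)
Lemma below_exterior x y : below x y -> exterior (image floor_curve) (x, y).
Proof.
  intros Hb. apply (outside_exterior Psi Phi rho (rho + 2 * M + 6)); auto using Phi_Psi, Psi_Phi, Psi_cont, rho_pos.
  - intros z. apply norm2_triangle. rewrite (Rabs_minus_sym (fst z)), (Rabs_minus_sym (snd z)).
    apply Psi_moves.
  - unfold below in Hb. unfold sqn, Phi; simpl. set (u := x - psi (y - f2 x)) in *.
    pose proof (arc_pos u). pose proof rho_pos.
    set (v := y - f2 x - f1 u - arc u). assert (Hv : v < - arc u) by (unfold v; lra).
    destruct (Rle_lt_dec (Rabs u) rho) as [Hu|Hu].
    + pose proof (arc_sqr u Hu). nra.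
    + assert (rho * rho < Rabs u * Rabs u) by nra. pose proof (Rsqr_abs u) as Eu. unfold Rsqr in Eu. nra.
Qed.

Lemma above_not_exterior x y : Rabs x <= M -> Rabs y <= M -> above x y ->
  ~ exterior (image floor_curve) (x, y).
Proof.
  intros Hx Hy Ha.
  apply (inside_not_exterior Psi Phi rho (rho + 2 * M + 6)); auto using Phi_Psi, Psi_Phi, Phi_cont, rho_pos.
  - intros z. apply norm2_triangle. apply Psi_moves.
  - unfold above in Ha. unfold sqn, Phi; simpl. set (u := x - psi (y - f2 x)) in *.
    params. pose proof (psi_bd (y - f2 x)) as Bp.
    assert (Hu : Rabs u <= M + 1).
    { pose proof (Rle_abs x). pose proof (Rle_abs (- x)) as B. rewrite Rabs_Ropp in B.
      apply Rabs_le. unfold u. lra. }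
    pose proof (arc_pos u) as Hap. pose proof (arc_sqr u ltac:(unfold rho; lra)) as Ea.
    assert (Hua : u * u <= (M + 1) * (M + 1)).
    { pose proof (Rabs_pos u). assert (Rabs u * Rabs u <= (M + 1) * (M + 1))
        by (apply Rmult_le_compat; lra).
      pose proof (Rsqr_abs u) as Eu. unfold Rsqr in Eu. lra. }
    (* [rho] is so large that the upper half of the circle stays above all points considered. *)
    assert (Hbig : 4 * M + 4 <= arc u) by (unfold rho in Ea; nra).
    pose proof (f1_low u). pose proof (f2_low x). pose proof (Rle_abs y).
    set (w := y - f2 x - f1 u) in *. assert (0 <= w <= 2 * arc u) by (unfold w; lra).
    nra.
Qed.

Lemma node_on_curve n : In n nodes -> image floor_curve (nx n, ny n).
Proof.
  intros Hn. apply (on_curve Psi Phi rho Phi_Psi Psi_Phi rho_pos).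
  pose proof (node_on_floor n Hn) as E. unfold sqn, Phi; simpl.
  set (u := nx n - psi (ny n - f2 (nx n))) in *. rewrite E.
  assert (Hu : Rabs u <= rho).
  { params. destruct (node_bd n Hn) as (B & _). pose proof (psi_bd (ny n - f2 (nx n))).
    pose proof (Rle_abs (nx n)). pose proof (Rle_abs (- nx n)) as B'. rewrite Rabs_Ropp in B'.
    apply Rabs_le. unfold u, rho. lra. }
  pose proof (arc_sqr u Hu).
  replace (ny n - f2 (nx n) - (ny n - f2 (nx n)) - arc u) with (- arc u) by ring. nra.
Qed.

End Floor.

(** * From configurations to visibility graphs *)

Lemma finite_witnesses {A : Type} (l : list A) (B : A -> Prop) (P : A -> pt -> Prop) (Q : pt -> Prop) :
  (forall x, In x l -> B x -> exists p, Q p /\ P x p) ->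
  exists ws, (forall p, In p ws -> Q p) /\ forall x, In x l -> B x -> exists p, In p ws /\ P x p.
Proof.
  induction l as [|a l IH]; intros H.
  - exists []. split; [intros p []|intros x []].
  - destruct IH as (ws & H1 & H2); [intros; apply H; simpl; auto|].
    destruct (classic (B a)) as [Ba|Ba].
    + destruct (H a) as (p & Qp & Pp); [now left|auto|].
      exists (p :: ws). split.
      * intros q [<-|Hq]; auto.
      * intros x [<-|Hx] Bx.
        -- exists p. split; [now left|auto].
        -- destruct (H2 x Hx Bx) as (q & Hq & Pq). exists q. split; [now right|auto].
    + exists ws. split; auto. intros x [<-|Hx] Bx; [contradiction|auto].
Qed.

Lemma ev_const c : 0 < c -> ev (fun g => g <= c).
Proof. intros Hc. exists c. split; auto. intros; lra. Qed.

(** Used for cone boundaries. The first inequality is weak, as the outermost edge may run along the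
    boundary; the second is strict, to leave room for [gam]. *)
Lemma separating_value {A : Type} (l : list A) (f : A -> R) (P Q : A -> Prop) :
  (forall x y, In x l -> In y l -> P x -> Q y -> f x < f y) ->
  exists m, forall x, In x l -> (P x -> f x <= m) /\ (Q x -> m < f x).
Proof.
  intros H.
  assert (Hmax : (forall x, In x l -> ~ P x) \/
    exists x0, In x0 l /\ P x0 /\ forall x, In x l -> P x -> f x <= f x0).
  { clear H. induction l as [|a l IH]; [left; intros x []|].
    destruct IH as [IH|(x0 & H0 & P0 & IH)]; destruct (classic (P a)) as [Pa|Pa].
    - right. exists a. split; [now left|]. split; auto. intros x [<-|Hx] Px; [lra|].
      now destruct (IH x Hx).
    - left. intros x [<-|Hx]; auto.
    - right. destruct (Rle_lt_dec (f x0) (f a)) as [Hle|Hlt].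
      + exists a. split; [now left|]. split; auto. intros x [<-|Hx] Px; [lra|].
        specialize (IH x Hx Px). lra.
      + exists x0. split; [now right|]. split; auto. intros x [<-|Hx] Px; [lra|auto].
    - right. exists x0. split; [now right|]. split; auto. intros x [<-|Hx] Px; [contradiction|auto]. }
  destruct Hmax as [Hn|(x0 & H0 & P0 & Hmax)].
  - destruct (bound_list l (fun x b => - b < f x)) as [b Hb].
    { intros x _. exists (- f x). intros; lra. }
    exists (- (b + 1)). intros x Hx. split; [intros Px; now destruct (Hn x Hx)|].
    intros _. apply Hb; auto. lra.
  - exists (f x0). intros x Hx. split; [auto|]. intros Qx. now apply H.
Qed.

Lemma det_slope_l a d p : fst a < fst d -> fst a < fst p ->
  det a d p = (slope a d - slope a p) * ((fst d - fst a) * (fst p - fst a)).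
Proof. intros. unfold det, slope. field. lra. Qed.

Lemma det_slope_r a d p : fst a < fst d -> fst p < fst d ->
  det a d p = (slope p d - slope a d) * ((fst d - fst a) * (fst d - fst p)).
Proof. intros. unfold det, slope. field. lra. Qed.

Lemma det_slope_m a d p : fst a < fst d ->
  det a d p = (snd a + slope a d * (fst p - fst a) - snd p) * (fst d - fst a).
Proof. intros. unfold det, slope. field. lra. Qed.

Lemma Rmult_pos_cancel x y : 0 < y -> 0 < x * y -> 0 < x.
Proof. intros Hy Hxy. apply Rmult_lt_reg_r with y; lra. Qed.

Definition realizable (n e : nat) : Prop :=
  exists (f : R -> pt) (P : nat -> pt) (I : Type) (L : I -> R -> pt),
    jordan_param f /\
    (forall a b, (a < n)%nat -> (b < n)%nat -> P a = P b -> a = b) /\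
    (forall a, (a < n)%nat -> image f (P a)) /\
    pseudoline_family L /\
    (forall a b, (a < n)%nat -> (b < n)%nat -> a <> b ->
       exists i s t, L i s = P a /\ L i t = P b) /\
    ~ (exists A B : list nat, length A = 3%nat /\ length B = 3%nat /\
         NoDup (A ++ B) /\ (forall x, In x (A ++ B) -> (x < n)%nat) /\
         forall x y, In x A -> In y B -> pvis_adj f L P x y) /\
    (exists E : list (nat * nat), NoDup E /\
       (forall ab, In ab E -> (fst ab < snd ab)%nat /\ (snd ab < n)%nat /\
                            pvis_adj f L P (fst ab) (snd ab)) /\
       length E = e).

Section Realize.
Variables (xs : list R) (G : config).
Hypothesis V : valid xs G.
Hypothesis no_spots : spots G = [].

Let vs := syms G ++ cols G.
Let S (a d : vtx G) := slope (place a) (place d).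

Lemma targets_cols : targets G = cols G.
Proof. unfold targets, spotpts. rewrite no_spots. apply app_nil_r. Qed.

Lemma verts_vs : verts G = vs.
Proof. unfold verts. now rewrite targets_cols. Qed.

Lemma vs_nodup : NoDup vs.
Proof. rewrite <- verts_vs. apply (v_nodup _ _ V). Qed.

Lemma vs_inj u v : In u vs -> In v vs -> xc u = xc v -> u = v.
Proof. rewrite <- verts_vs. apply (v_xinj _ _ V). Qed.

Lemma sym_not_col v : In v (syms G) -> In v (cols G) -> False.
Proof. intros Hs Hc. apply (disj_sym_target _ _ v V Hs). now rewrite targets_cols. Qed.

Lemma adj_in a d : adj a d -> In a (syms G) /\ In d (cols G) /\ xc a < xc d.
Proof. rewrite <- targets_cols. apply (v_adj _ _ V). Qed.

(** The neighbours of a symbol or of a column lie on or below the line of slope [m] through it; for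
    a column, which looks to the left, this reverses the inequalities between slopes. *)
Definition cone_slope (v : vtx G) (m : R) : Prop :=
  (In v (syms G) -> forall d, In d (cols G) -> xc v < xc d ->
     (adj v d -> S v d <= m) /\ (~ adj v d -> blocked_sym G v d -> m < S v d)) /\
  (In v (cols G) -> forall a, In a (syms G) -> xc a < xc v ->
     (adj a v -> m <= S a v) /\ (~ adj a v -> blocked_col G a v -> S a v < m)).

Lemma cone_slope_exists v : exists m, cone_slope v m.
Proof.
  destruct (classic (In v (syms G))) as [Hs|Hs].
  - destruct (separating_value (cols G) (S v) (fun d => adj v d)
      (fun d => xc v < xc d /\ blocked_sym G v d)) as [m Hm].
    { intros d' d Hd' Hd A [Hx B]. specialize (B d' A). destruct (adj_in _ _ A) as (_ & _ & Hx').
      unfold xc in *. rewrite det_slope_l in B by auto. apply Rmult_pos_cancel in B.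
      - unfold S. lra.
      - apply Rmult_lt_0_compat; lra. }
    exists m. split.
    + intros _ d Hd Hx. destruct (Hm d Hd). split; auto.
    + intros Hc. destruct (sym_not_col v Hs Hc).
  - destruct (separating_value (syms G) (fun a => - S a v) (fun a => adj a v)
      (fun a => xc a < xc v /\ blocked_col G a v)) as [m Hm].
    { intros b a Hb Ha A [Hx B]. specialize (B b A). destruct (adj_in _ _ A) as (_ & _ & Hx').
      unfold xc in *. rewrite det_slope_r in B by auto. apply Rmult_pos_cancel in B.
      - unfold S. lra.
      - apply Rmult_lt_0_compat; lra. }
    exists (- m). split; [tauto|]. intros _ a Ha Hx. destruct (Hm a Ha) as [H1 H2]. split.
    + intros A. specialize (H1 A). lra.
    + intros _ B. specialize (H2 (conj Hx B)). lra.
Qed.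

Lemma witnesses_exist : exists ws,
  (forall p, In p ws -> under G p /\ forall v, In v vs -> xc v <> fst p) /\
  forall a d, In a (syms G) -> In d (cols G) -> blocked_inner G a d ->
    exists p, In p ws /\ xc a < fst p < xc d /\ det (place a) (place d) p < 0.
Proof.
  destruct (finite_witnesses (list_prod (syms G) (cols G))
    (fun ad => blocked_inner G (fst ad) (snd ad))
    (fun ad p => xc (fst ad) < fst p < xc (snd ad) /\ det (place (fst ad)) (place (snd ad)) p < 0)
    (fun p => under G p /\ forall v, In v vs -> xc v <> fst p)) as (ws & H1 & H2).
  - intros [a d] _ B. destruct (blocked_inner_generic _ _ _ _ V B) as (p & Hp & Hd & Hu & Hv).
    rewrite verts_vs in Hv. exists p. auto.
  - exists ws. split; auto. intros a d Ha Hd. apply (H2 (a, d)). now apply in_prod.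
Qed.

Section Data.
Variables (m : vtx G -> R) (ws : list pt) (M gam : R) (v0 : vtx G).
Hypothesis m_cone : forall v, cone_slope v (m v).
Hypothesis M_ge : 1 <= M.
Hypothesis gam_pos : 0 < gam.
Hypothesis gam_le : gam <= 1.
Hypothesis vs_bd : forall v, In v vs ->
  (Rabs (xc v) <= M /\ Rabs (snd (place v)) <= M) /\ Rabs (m v) <= M.
Hypothesis S_bd : forall u v, In u vs -> In v vs -> Rabs (S u v) <= M.
Hypothesis ws_bd : forall p, In p ws -> Rabs (fst p) <= M /\ Rabs (snd p) <= M.
Hypothesis vs_sep : forall u v, In u vs -> In v vs -> u <> v -> gam <= Rabs (xc u - xc v).
Hypothesis ws_sep : forall p v, In p ws -> In v vs -> gam <= Rabs (xc v - fst p).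
Hypothesis adj_over : forall a d v, adj a d -> In v vs -> xc a < xc v < xc d ->
  snd (place v) + gam <= snd (place a) + S a d * (xc v - xc a).
Hypothesis adj_wover : forall a d p, adj a d -> In p ws -> xc a <= fst p <= xc d ->
  snd p + gam <= snd (place a) + S a d * (fst p - xc a).
Hypothesis blocked_by : forall a d, In a (syms G) -> In d (cols G) -> xc a < xc d -> ~ adj a d ->
  (exists p, In p ws /\ xc a < fst p < xc d /\ snd (place a) + S a d * (fst p - xc a) + gam <= snd p) \/
  m a + gam <= S a d \/ S a d + gam <= m d.

Definition nd (b : bool) (v : vtx G) : node := Node (xc v) (snd (place v)) (m v) b.
Definition nodes : list node := map (nd true) (syms G) ++ map (nd false) (cols G).

Lemma in_nodes n : In n nodes -> exists v b, n = nd b v /\ In v vs /\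
  (b = true -> In v (syms G)) /\ (b = false -> In v (cols G)).
Proof.
  unfold nodes, vs. rewrite in_app_iff, !in_map_iff.
  intros [(v & <- & Hv)|(v & <- & Hv)]; exists v; eexists; (split; [reflexivity|]);
    rewrite in_app_iff; repeat split; auto; discriminate.
Qed.

Lemma sym_node a : In a (syms G) -> In (nd true a) nodes.
Proof. intros. apply in_or_app; left. now apply in_map. Qed.

Lemma col_node d : In d (cols G) -> In (nd false d) nodes.
Proof. intros. apply in_or_app; right. now apply in_map. Qed.

Lemma vs_node v : In v vs -> exists b, In (nd b v) nodes.
Proof.
  intros Hv. apply in_app_or in Hv. destruct Hv; [exists true; now apply sym_node|exists false; now apply col_node].
Qed.

Lemma node_bd n : In n nodes -> Rabs (nx n) <= M /\ Rabs (ny n) <= M /\ Rabs (nm n) <= M.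
Proof. intros Hn. apply in_nodes in Hn. destruct Hn as (v & b & -> & Hv & _). simpl. destruct (vs_bd v Hv) as [[? ?] ?]. auto. Qed.

Lemma node_sep n n' : In n nodes -> In n' nodes -> n <> n' -> gam <= Rabs (nx n - nx n').
Proof.
  intros Hn Hn' Hne. apply in_nodes in Hn, Hn'.
  destruct Hn as (v & b & -> & Hv & Hb1 & Hb2), Hn' as (v' & b' & -> & Hv' & Hb1' & Hb2').
  apply vs_sep; auto. intros ->. apply Hne. f_equal.
  destruct b, b'; auto; exfalso; apply (sym_not_col v'); auto.
Qed.

Lemma node_ws_sep p n : In p ws -> In n nodes -> gam <= Rabs (nx n - fst p).
Proof. intros Hp Hn. apply in_nodes in Hn. destruct Hn as (v & b & -> & Hv & _). now apply ws_sep. Qed.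

Definition K : R -> pt := floor_curve nodes ws M gam.
Definition seg (u v : vtx G) (x : R) : R := snd (place u) + S u v * (x - xc u).

Lemma seg_end u v : xc u < xc v -> seg u v (xc v) = snd (place v).
Proof. unfold seg, S, slope, xc. intros. field. lra. Qed.

Lemma seg_sym u v x : xc u <> xc v -> seg u v x = seg v u x.
Proof. unfold seg, S, slope, xc. intros. field. split; lra. Qed.

Lemma seg_bd u v x : In u vs -> In v vs -> xc u < xc v -> xc u <= x <= xc v -> Rabs (seg u v x) <= M.
Proof.
  intros Hu Hv Hx Hr. destruct (vs_bd u Hu) as [[_ B1] _], (vs_bd v Hv) as [[_ B2] _].
  pose proof (seg_end u v Hx) as E. unfold seg in *.
  pose proof (Rle_abs (snd (place u))). pose proof (Rle_abs (- snd (place u))) as C1.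
  pose proof (Rle_abs (snd (place v))). pose proof (Rle_abs (- snd (place v))) as C2.
  rewrite Rabs_Ropp in C1, C2. apply Rabs_le. destruct (Rle_lt_dec 0 (S u v)).
  - assert (0 <= S u v * (x - xc u)) by (apply Rmult_le_pos; lra).
    assert (0 <= S u v * (xc v - x)) by (apply Rmult_le_pos; lra). lra.
  - assert (0 <= - S u v * (x - xc u)) by (apply Rmult_le_pos; lra).
    assert (0 <= - S u v * (xc v - x)) by (apply Rmult_le_pos; lra). lra.
Qed.

Lemma adj_visible a d x : adj a d -> xc a <= x <= xc d -> ~ exterior (image K) (x, seg a d x).
Proof.
  intros A Hx. destruct (adj_in a d A) as (Ha & Hd & Hlt).
  assert (Va : In a vs) by (apply in_or_app; auto). assert (Vd : In d vs) by (apply in_or_app; auto).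
  destruct (m_cone a) as [Ca _]. destruct (m_cone d) as [_ Cd].
  apply above_not_exterior; auto using node_bd, node_sep, node_ws_sep.
  - destruct (vs_bd a Va) as [[B1 _] _], (vs_bd d Vd) as [[B2 _] _].
    pose proof (Rle_abs (xc d)). pose proof (Rle_abs (- xc a)) as B3. rewrite Rabs_Ropp in B3.
    apply Rabs_le. lra.
  - now apply seg_bd.
  - apply (edge_above nodes ws M gam M_ge gam_pos gam_le node_bd node_sep ws_bd node_ws_sep
      (nd true a) (nd false d) (S a d)); auto using sym_node, col_node; simpl.
    + symmetry. now apply seg_end.
    + now apply (Ca Ha d Hd Hlt).
    + now apply (Cd Hd a Ha Hlt).
    + intros n Hn Hr. apply in_nodes in Hn. destruct Hn as (v & b & -> & Hv & _). simpl in *.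
      now apply adj_over.
    + intros p Hp Hr. now apply adj_wover.
Qed.

(** A segment with a symbol as right end or a column as left end runs into the wall there; only a
    symbol to the left of a column requires [blocked_by]. *)
Lemma nonadj_hidden u v : In u vs -> In v vs -> xc u < xc v -> ~ adj u v ->
  exists x, xc u <= x <= xc v /\ exterior (image K) (x, seg u v x).
Proof.
  intros Hu Hv Hlt A.
  assert (Hgap : gam <= xc v - xc u).
  { assert (Hne : v <> u) by (intros ->; lra). pose proof (vs_sep v u Hv Hu Hne) as B.
    rewrite Rabs_right in B; lra. }
  assert (Hrad : rad M gam < gam).
  { pose proof (rad_le M gam M_ge gam_pos). unfold eta in *. lra. }
  pose proof (rad_pos M gam M_ge gam_pos) as Hrp.
  assert (Hext : forall x y, below nodes ws M gam x y -> exterior (image K) (x, y)).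
  { intros x y. apply below_exterior; auto using node_bd, node_sep, node_ws_sep. }
  assert (Hr : forall t, seg u v (xc v - t) = snd (place v) - S u v * t).
  { intros t. rewrite <- (seg_end u v Hlt). unfold seg. ring. }
  assert (Hl : forall t, seg u v (xc u + t) = snd (place u) + S u v * t).
  { intros t. unfold seg. ring. }
  assert (Hv' := Hv). assert (Hu' := Hu). apply in_app_or in Hv', Hu'.
  destruct Hv' as [Hv'|Hv'].
  { exists (xc v - rad M gam). split; [lra|]. apply Hext. rewrite Hr.
    apply (below_sym_left nodes ws M gam M_ge gam_pos gam_le node_bd node_sep ws_bd node_ws_sep
      (nd true v) (S u v)); auto using sym_node. }
  destruct Hu' as [Hu'|Hu'].
  2: { exists (xc u + rad M gam). split; [lra|]. apply Hext. rewrite Hl.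
    apply (below_col_right nodes ws M gam M_ge gam_pos gam_le node_bd node_sep ws_bd node_ws_sep
      (nd false u) (S u v)); auto using col_node. }
  destruct (blocked_by u v Hu' Hv' Hlt A) as [(p & Hp & Hx & Hb)|[Hb|Hb]].
  - exists (fst p). split; [lra|]. apply Hext. now apply below_witness.
  - destruct (below_sym_above nodes ws M gam M_ge gam_pos gam_le node_bd node_sep ws_bd node_ws_sep
      (nd true u) (S u v) (sym_node u Hu') eq_refl Hb) as (t & Ht & B).
    exists (xc u + t). split; [lra|]. apply Hext. rewrite Hl. exact B.
  - destruct (below_col_above nodes ws M gam M_ge gam_pos gam_le node_bd node_sep ws_bd node_ws_sep
      (nd false v) (S u v) (col_node v Hv') eq_refl Hb) as (t & Ht & B).
    exists (xc v - t). split; [lra|]. apply Hext. rewrite Hr. exact B.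
Qed.

(** A diagonal pair contributes the horizontal line through its vertex, as 0 divided by 0 is 0. *)
Definition lines : list (R * R) :=
  map (fun uv => (S (fst uv) (snd uv), snd (place (fst uv)) - S (fst uv) (snd uv) * xc (fst uv)))
    (list_prod vs vs).
Definition point (i : nat) : pt := place (nth i vs v0).

Lemma bent_left th mk x : x <= M -> bent M th mk x = fst mk * x + snd mk.
Proof. intros Hx. unfold bent. rewrite Rmax_left by lra. ring. Qed.

Lemma xc_le v : In v vs -> xc v <= M.
Proof. intros Hv. destruct (vs_bd v Hv) as [[B _] _]. pose proof (Rle_abs (xc v)). lra. Qed.

Lemma bent_through th mk u v s t x : In u vs -> In v vs -> xc u <> xc v ->
  (s, bent M th mk s) = place u -> (t, bent M th mk t) = place v -> x <= M ->
  s = xc u /\ t = xc v /\ bent M th mk x = seg u v x.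
Proof.
  intros Hu Hv Hne Eu Ev Hx.
  assert (Es : s = xc u) by (unfold xc; now rewrite <- Eu).
  assert (Et : t = xc v) by (unfold xc; now rewrite <- Ev).
  subst s t. split; auto. split; auto.
  apply (f_equal snd) in Eu, Ev. simpl in Eu, Ev.
  rewrite bent_left in * by (auto using xc_le).
  unfold seg, S, slope. rewrite <- Eu, <- Ev. unfold xc in *. field. lra.
Qed.

(** Bends occur only beyond abscissa [M], so between two vertices each pseudoline is a straight
    segment. *)
Lemma visible_iff th i j : (i < length vs)%nat -> (j < length vs)%nat ->
  pvis_adj K (fun (l : {mk : R * R | In mk lines}) t => (t, bent M th (proj1_sig l) t)) point i j <->
  adj (nth i vs v0) (nth j vs v0) \/ adj (nth j vs v0) (nth i vs v0).
Proof.
  intros Hi Hj. set (u := nth i vs v0). set (v := nth j vs v0).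
  assert (Hu : In u vs) by now apply nth_In. assert (Hv : In v vs) by now apply nth_In.
  split.
  - intros (Hij & [mk Hmk] & s & t & Es & Et & Hvis). simpl in *. unfold point in *. fold u in Es. fold v in Et.
    assert (Huv : u <> v).
    { intros E. apply Hij. apply (proj1 (NoDup_nth vs v0) vs_nodup i j Hi Hj E). }
    assert (Hx : xc u <> xc v) by (intros E; apply Huv; now apply vs_inj).
    destruct (bent_through th mk u v s t (xc u) Hu Hv Hx Es Et (xc_le u Hu)) as (-> & -> & _).
    apply NNPP. intros Hn.
    destruct (Rlt_le_dec (xc u) (xc v)) as [Hlt|Hle].
    + destruct (nonadj_hidden u v Hu Hv Hlt) as (x & Hr & Hext); [tauto|].
      apply (Hvis x).
      * rewrite Rmin_left, Rmax_right; lra.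
      * pose proof (xc_le v Hv). destruct (bent_through th mk u v _ _ x Hu Hv Hx Es Et) as (_ & _ & ->); [lra|auto].
    + destruct (nonadj_hidden v u Hv Hu) as (x & Hr & Hext); [lra|tauto|].
      apply (Hvis x).
      * rewrite Rmin_right, Rmax_left; lra.
      * pose proof (xc_le u Hu). destruct (bent_through th mk u v _ _ x Hu Hv Hx Es Et) as (_ & _ & ->); [lra|].
        now rewrite seg_sym.
  - intros A.
    assert (Hx : xc u <> xc v) by (destruct A as [A|A]; apply adj_in in A; lra).
    assert (Hin : In (S u v, snd (place u) - S u v * xc u) lines).
    { unfold lines. apply in_map_iff. exists (u, v). split; auto. now apply in_prod. }
    assert (Eb : forall x, x <= M -> bent M th (S u v, snd (place u) - S u v * xc u) x = seg u v x).
    { intros x Hxm. rewrite bent_left by auto. unfold seg; simpl. ring. }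
    split; [intros E; apply Hx; unfold u, v; now rewrite E|].
    exists (exist (fun mk => In mk lines) _ Hin), (xc u), (xc v). simpl. unfold point. fold u v. rewrite !Eb by (auto using xc_le).
    split; [|split].
    + unfold seg, xc. rewrite Rminus_diag, Rmult_0_r, Rplus_0_r. now destruct (place u).
    + rewrite seg_sym by auto. unfold seg, xc. rewrite Rminus_diag, Rmult_0_r, Rplus_0_r. now destruct (place v).
    + intros x Hr. destruct A as [A|A]; destruct (adj_in _ _ A) as (_ & _ & Hlt).
      * rewrite Rmin_left, Rmax_right in Hr by lra. pose proof (xc_le v Hv).
        rewrite Eb by lra. now apply adj_visible.
      * rewrite Rmin_right, Rmax_left in Hr by lra. pose proof (xc_le u Hu).
        rewrite Eb by lra. rewrite seg_sym by auto. now apply adj_visible.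
Qed.

(** Edges lead from symbols to columns, so one side of a K_{2,2} would consist of symbols and the
    other of columns, against [v_k22]. Thus even K_{2,2} is excluded. *)
Lemma no_common_pairs i i' j j' : (i < length vs)%nat -> (i' < length vs)%nat ->
  (j < length vs)%nat -> (j' < length vs)%nat -> i <> i' -> j <> j' ->
  (forall x y, (x = i \/ x = i') -> (y = j \/ y = j') ->
    adj (nth x vs v0) (nth y vs v0) \/ adj (nth y vs v0) (nth x vs v0)) -> False.
Proof.
  intros Hi Hi' Hj Hj' Hii Hjj Hall.
  assert (Hex : forall a b c : vtx G, adj a b -> adj b c -> False).
  { intros a b c A B. apply adj_in in A, B. apply (sym_not_col b); tauto. }
  assert (Hinj : forall x y, (x < length vs)%nat -> (y < length vs)%nat ->
    nth x vs v0 = nth y vs v0 -> x = y).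
  { intros x y Hx Hy. apply (proj1 (NoDup_nth vs v0) vs_nodup x y Hx Hy). }
  destruct (Hall i j) as [A|A]; auto.
  - destruct (Hall i j') as [A'|A']; auto; [|eauto].
    destruct (Hall i' j) as [B|B]; auto; [|eauto].
    destruct (Hall i' j') as [B'|B']; auto; [|eauto].
    destruct (v_k22 _ _ V _ _ _ _ A A' B B') as [E|E]; apply Hinj in E; auto.
  - destruct (Hall i j') as [A'|A']; auto; [eauto|].
    destruct (Hall i' j) as [B|B]; auto; [eauto|].
    destruct (Hall i' j') as [B'|B']; auto; [eauto|].
    destruct (v_k22 _ _ V _ _ _ _ A B A' B') as [E|E]; apply Hinj in E; auto.
Qed.

Lemma edges_indices e : has_edges G e -> exists E : list (nat * nat),
  NoDup E /\ length E = e /\ forall x y, In (x, y) E ->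
    (x < y)%nat /\ (y < length vs)%nat /\ adj (nth x vs v0) (nth y vs v0).
Proof.
  intros (l & N & El & Hl).
  destruct (functional_choice (fun v i => In v vs -> (i < length vs)%nat /\ nth i vs v0 = v)) as [idx Hidx].
  { intros v. destruct (classic (In v vs)) as [Hv|Hv].
    - destruct (In_nth vs v v0 Hv) as (i & Hi & E). exists i. auto.
    - exists 0%nat. tauto. }
  assert (Hvs : forall a d, In (a, d) l -> In a vs /\ In d vs).
  { intros a d Hi. destruct (Hl a d Hi) as [A _]. apply adj_in in A. unfold vs. rewrite !in_app_iff. tauto. }
  exists (map (fun ad => (idx (fst ad), idx (snd ad))) l). split; [|split].
  - apply NoDup_map_NoDup_ForallPairs; auto. intros [a d] [a' d'] H1 H2 E. simpl in E.
    injection E as E1 E2. destruct (Hvs a d H1) as [Va Vd], (Hvs a' d' H2) as [Va' Vd'].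
    f_equal.
    + rewrite <- (proj2 (Hidx a Va)), <- (proj2 (Hidx a' Va')). now rewrite E1.
    + rewrite <- (proj2 (Hidx d Vd)), <- (proj2 (Hidx d' Vd')). now rewrite E2.
  - now rewrite length_map.
  - intros x y Hxy. apply in_map_iff in Hxy. destruct Hxy as ([a d] & E & Hi). simpl in E.
    injection E as <- <-. destruct (Hvs a d Hi) as [Va Vd]. destruct (Hl a d Hi) as [A _].
    destruct (Hidx a Va) as [La Ea], (Hidx d Vd) as [Ld Ed].
    split; [|split]; auto; [|now rewrite Ea, Ed].
    (* In [vs] the symbols precede the columns, which orders the two indices. *)
    destruct (adj_in a d A) as (Sa & Cd & _).
    assert (Ha : (idx a < length (syms G))%nat).
    { destruct (le_lt_dec (length (syms G)) (idx a)) as [Hle|?]; auto. exfalso.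
      apply (sym_not_col a); auto. rewrite <- Ea. unfold vs. rewrite app_nth2 by lia.
      apply nth_In. unfold vs in La. rewrite length_app in La. lia. }
    assert (Hd : (length (syms G) <= idx d)%nat).
    { destruct (le_lt_dec (length (syms G)) (idx d)) as [?|Hlt]; auto. exfalso.
      apply (sym_not_col d); auto. rewrite <- Ed. unfold vs. rewrite app_nth1 by lia.
      now apply nth_In. }
    lia.
Qed.

Lemma realize_data e : has_edges G e -> realizable (length vs) e.
Proof.
  intros He. unfold realizable. destruct (bent_family M lines) as [th Hth].
  exists K, point, {mk : R * R | In mk lines}, (fun l t => (t, bent M th (proj1_sig l) t)).
  assert (Hinj : forall x y, (x < length vs)%nat -> (y < length vs)%nat ->
    xc (nth x vs v0) = xc (nth y vs v0) -> x = y).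
  { intros x y Hx Hy E. apply (proj1 (NoDup_nth vs v0) vs_nodup x y Hx Hy).
    apply vs_inj; auto; now apply nth_In. }
  split; [|split; [|split; [|split; [|split; [|split]]]]].
  - apply floor_jordan; auto using node_bd, node_sep, node_ws_sep.
  - intros a b Ha Hb E. apply Hinj; auto. unfold xc. unfold point in E. now rewrite E.
  - intros a Ha. destruct (vs_node (nth a vs v0)) as [b Hb]; [now apply nth_In|].
    unfold point. rewrite (surjective_pairing (place (nth a vs v0))).
    apply (node_on_curve nodes ws M gam M_ge gam_pos gam_le node_bd node_sep ws_bd node_ws_sep (nd b (nth a vs v0)) Hb).
  - exact Hth.
  - intros a b Ha Hb Hab. set (u := nth a vs v0). set (v := nth b vs v0).
    assert (Hu : In u vs) by now apply nth_In. assert (Hv : In v vs) by now apply nth_In.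
    assert (Hx : xc u <> xc v) by (intros E; apply Hab; now apply Hinj).
    assert (Hin : In (S u v, snd (place u) - S u v * xc u) lines).
    { unfold lines. apply in_map_iff. exists (u, v). split; auto. now apply in_prod. }
    exists (exist (fun mk => In mk lines) _ Hin), (xc u), (xc v). simpl. unfold point. fold u v.
    rewrite !bent_left by (auto using xc_le). simpl. split.
    + apply injective_projections; simpl; [reflexivity|unfold xc; ring].
    + apply injective_projections; simpl; [reflexivity|]. unfold S, slope, xc in *. field. lra.
  - intros (A & B & LA & LB & N & Hlt & Hvis).
    destruct A as [|a [|a' [|a2 [|]]]]; try discriminate.
    destruct B as [|b [|b' [|b2 [|]]]]; try discriminate.
    simpl in *. apply (no_common_pairs a a' b b'); try (apply Hlt; simpl; tauto).
    + intros <-. inversion N; subst. simpl in *. tauto.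
    + intros <-. inversion N as [|? ? _ N1]; subst. inversion N1 as [|? ? _ N2]; subst.
      inversion N2 as [|? ? _ N3]; subst. inversion N3; subst. simpl in *. tauto.
    + intros x y Hx Hy. apply (visible_iff th); [| |apply Hvis; destruct Hx, Hy; auto];
        apply Hlt; destruct Hx, Hy; subst; simpl; tauto.
  - destruct (edges_indices e He) as (E & N & LE & HE). exists E. split; auto. split; auto.
    intros [x y] Hxy. destruct (HE x y Hxy) as (H1 & H2 & A). simpl. split; [|split]; auto.
    apply visible_iff; auto. lia.
Qed.

End Data.

Lemma Rmult_neg_cancel x y : 0 < y -> x * y < 0 -> x < 0.
Proof. intros Hy Hxy. apply Rmult_lt_reg_r with y; lra. Qed.

Lemma Rabs_pos_diff x y : x <> y -> 0 < Rabs (x - y).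
Proof. intros H. apply Rabs_pos_lt. lra. Qed.

(** [M] exceeds finitely many absolute values, and [gam] is smaller than the finitely many margins
    by which the strict inequalities of the configuration hold. *)
Theorem realize e : has_edges G e -> (1 <= length vs)%nat -> realizable (length vs) e.
Proof.
  intros He Hlen.
  assert (v0 : vtx G) by (destruct vs as [|v l]; [simpl in Hlen; lia|exact v]).
  destruct (functional_choice cone_slope cone_slope_exists) as [m Hm].
  destruct witnesses_exist as (ws & Hws & Hin).
  assert (EM : exists b, forall M, b < M ->
    ((forall v, In v vs -> (Rabs (xc v) <= M /\ Rabs (snd (place v)) <= M) /\ Rabs (m v) <= M) /\
     (forall u, In u vs -> forall v, In v vs -> Rabs (S u v) <= M)) /\
    (forall p, In p ws -> Rabs (fst p) <= M /\ Rabs (snd p) <= M)).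
  { destruct (bound_list vs (fun v M => Rabs (xc v) <= M /\ Rabs (snd (place v)) <= M /\ Rabs (m v) <= M))
      as [b1 B1].
    { intros v _. exists (Rabs (xc v) + Rabs (snd (place v)) + Rabs (m v)). intros t Ht.
      pose proof (Rabs_pos (xc v)). pose proof (Rabs_pos (snd (place v))). pose proof (Rabs_pos (m v)). lra. }
    destruct (bound_list vs (fun u M => forall v, In v vs -> Rabs (S u v) <= M)) as [b2 B2].
    { intros u _. apply bound_list. intros v _. exists (Rabs (S u v)). intros; lra. }
    destruct (bound_list ws (fun p M => Rabs (fst p) <= M /\ Rabs (snd p) <= M)) as [b3 B3].
    { intros p _. exists (Rabs (fst p) + Rabs (snd p)). intros t Ht.
      pose proof (Rabs_pos (fst p)). pose proof (Rabs_pos (snd p)). lra. }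
    exists (Rmax b1 (Rmax b2 b3)). intros M HM.
    pose proof (Rmax_l b1 (Rmax b2 b3)). pose proof (Rmax_r b1 (Rmax b2 b3)).
    pose proof (Rmax_l b2 b3). pose proof (Rmax_r b2 b3).
    split; [split|].
    - intros v Hv. destruct (B1 M ltac:(lra) v Hv) as (? & ? & ?). auto.
    - intros u Hu. apply B2; auto; lra.
    - apply B3; lra. }
  destruct EM as [b EM]. set (M := Rmax b 1 + 1).
  assert (HM1 : 1 <= M) by (unfold M; pose proof (Rmax_r b 1); lra).
  destruct (EM M) as ((M1 & M2) & M3); [unfold M; pose proof (Rmax_l b 1); lra|].
  assert (EG : ev (fun gam => gam <= 1 /\
    (forall u, In u vs -> forall v, In v vs -> u <> v -> gam <= Rabs (xc u - xc v)) /\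
    (forall p, In p ws -> forall v, In v vs -> gam <= Rabs (xc v - fst p)) /\
    (forall a, In a (syms G) -> forall d, In d (cols G) -> adj a d ->
       forall v, In v vs -> xc a < xc v < xc d ->
       snd (place v) + gam <= snd (place a) + S a d * (xc v - xc a)) /\
    (forall a, In a (syms G) -> forall d, In d (cols G) -> adj a d ->
       forall p, In p ws -> xc a <= fst p <= xc d ->
       snd p + gam <= snd (place a) + S a d * (fst p - xc a)) /\
    (forall a, In a (syms G) -> forall d, In d (cols G) -> xc a < xc d -> ~ adj a d ->
       (exists p, In p ws /\ xc a < fst p < xc d /\
          snd (place a) + S a d * (fst p - xc a) + gam <= snd p) \/
       m a + gam <= S a d \/ S a d + gam <= m d))).
  { apply ev_and; [apply ev_const; lra|]. apply ev_and; [|apply ev_and; [|apply ev_and; [|apply ev_and]]].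
    - apply ev_list; intros u Hu. apply ev_list; intros v Hv. apply ev_imp; intros Hne.
      apply ev_const. apply Rabs_pos_diff. intros E. apply Hne. now apply vs_inj.
    - apply ev_list; intros p Hp. apply ev_list; intros v Hv. apply ev_const. apply Rabs_pos_diff.
      now apply Hws.
    - apply ev_list; intros a Ha. apply ev_list; intros d Hd. apply ev_imp; intros A.
      apply ev_list; intros v Hv. apply ev_imp; intros Hx.
      pose proof (v_below _ _ V a d v A) as Hb. rewrite verts_vs in Hb. specialize (Hb Hv Hx).
      unfold xc in *. rewrite det_slope_m in Hb by lra. apply Rmult_pos_cancel in Hb; [|lra].
      eapply ev_impl; [apply (ev_const _ Hb)|]. intros k _ H. fold (S a d) in H. lra.
    - apply ev_list; intros a Ha. apply ev_list; intros d Hd. apply ev_imp; intros A.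
      apply ev_list; intros p Hp. apply ev_imp; intros Hx.
      destruct (Hws p Hp) as [Hu _]. specialize (Hu a d A Hx). destruct (adj_in _ _ A) as (_ & _ & Hlt).
      unfold xc in *. rewrite det_slope_m in Hu by lra. apply Rmult_pos_cancel in Hu; [|lra].
      eapply ev_impl; [apply (ev_const _ Hu)|]. intros k _ H. fold (S a d) in H. lra.
    - apply ev_list; intros a Ha. apply ev_list; intros d Hd.
      apply ev_imp; intros Hx. apply ev_imp; intros A.
      destruct (Hm a) as [Ca _]. destruct (Hm d) as [_ Cd].
      destruct (v_block _ _ V a d Ha) as [Hi|[Hs|[_ Hc]]]; auto; [now rewrite targets_cols| | |].
      + destruct (Hin a d Ha Hd Hi) as (p & Hp & Hxp & Hdet).
        unfold xc in *. rewrite det_slope_m in Hdet by lra. apply Rmult_neg_cancel in Hdet; [|lra].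
        eapply ev_impl; [apply (ev_const (- (snd (place a) + S a d * (fst p - fst (place a)) - snd p)))|].
        * unfold S. lra.
        * intros k _ H. left. exists p. split; auto. split; auto. lra.
      + destruct (Ca Ha d Hd Hx) as [_ H]. specialize (H A Hs).
        eapply ev_impl; [apply (ev_const (S a d - m a)); lra|]. intros k _ Hk. right; left. lra.
      + destruct (Cd Hd a Ha Hx) as [_ H]. specialize (H A Hc).
        eapply ev_impl; [apply (ev_const (m d - S a d)); lra|]. intros k _ Hk. right; right. lra. }
  apply ev_ex in EG. destruct EG as (gam & Hg & G1 & G2 & G3 & G4 & G5 & G6).
  apply (realize_data m ws M gam v0); auto.
  - intros a d v A. destruct (adj_in a d A) as (Ha & Hd & _). now apply (G4 a Ha d Hd A).
  - intros a d p A. destruct (adj_in a d A) as (Ha & Hd & _). now apply (G5 a Ha d Hd A).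
Qed.

End Realize.

Theorem theorem1p4 :
  exists c : R, 0 < c /\
  forall n : nat, (1 <= n)%nat ->
  exists (f : R -> pt) (V : nat -> pt) (I : Type) (L : I -> R -> pt),
    jordan_param f /\
    (forall a b, (a < n)%nat -> (b < n)%nat -> V a = V b -> a = b) /\
    (forall a, (a < n)%nat -> image f (V a)) /\
    pseudoline_family L /\
    (forall a b, (a < n)%nat -> (b < n)%nat -> a <> b ->
       exists i s t, L i s = V a /\ L i t = V b) /\
    (* G_L(K,V) contains no K_{3,3} *)
    ~ (exists A B : list nat, length A = 3%nat /\ length B = 3%nat /\
         NoDup (A ++ B) /\ (forall x, In x (A ++ B) -> (x < n)%nat) /\
         forall x y, In x A -> In y B -> pvis_adj f L V x y) /\
    (* G_L(K,V) has at least c * n * alpha(n) edges *)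
    (exists E : list (nat * nat), NoDup E /\
       (forall e, In e E -> (fst e < snd e)%nat /\ (snd e < n)%nat /\
                            pvis_adj f L V (fst e) (snd e)) /\
       c * INR n * INR (inv_ack n) <= INR (length E)).
Proof.
  exists (/ 60). split; [lra|]. intros n Hn.
  destruct (config_exists n Hn) as (xs & G & e & V & Hs & Hlen & He & Hcount).
  rewrite <- length_app in Hlen.
  destruct (realize xs G V Hs e He) as (f & P & I & L & H1 & H2 & H3 & H4 & H5 & H6 & E & N & HE & HL);
    [lia|]. rewrite Hlen in *.
  exists f, P, I, L. repeat (split; [assumption|]). exists E. split; [assumption|].
  split; [assumption|]. rewrite HL. apply le_INR in Hcount. rewrite !mult_INR in Hcount.
  replace (INR 60) with 60 in Hcount by (simpl; ring). lra.
Qed.
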